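(* Let $d\geq 2$ and let $k$ be a field of prime characteristic $p>2$. Let $(R,\mathfrak{m}_R,k)$, $(S,\mathfrak{m}_S,k)$ and $(T,\mathfrak{m}_T,k)$ be local rings of prime characteristic $p$ with the same residue field $k$, let $\epsilon_R:R\to T$ and $\epsilon_S:S\to T$ be surjective ring homomorphisms, and assume that $R$ is a non-regular complete intersection of dimension $d$. Let $R_d=k[[x_0,\dots,x_d]]/(x_0^2+\cdots+x_d^2)$. If $\dim(R)>\dim(S)>\dim(T)$, then for every real $s>0$, $$e_s(R\times_T S)\geq e_s(R_d).$$
   Context: All rings are commutative, Noetherian, local, with identity. The fiber product is $R\times_T S=\{(r,s)\in R\times S:\epsilon_R(r)=\epsilon_S(s)\}$; it is a Noetherian local ring with maximal ideal $\mathfrak{m}=\mathfrak{m}_R\times_{\mathfrak{m}_T}\mathfrak{m}_S$ and residue field $k$, of characteristic $p$, with $\dim(R\times_T S)=\max\{\dim R,\dim S\}$. $s$-multiplicity: let $(A,\mathfrak{n})$ be a local ring of prime characteristic $p>0$ and dimension $d>0$, let $I,J$ be $\mathfrak{n}$-primary ideals, $N$ a finitely generated $A$-module, $s>0$ real. Put $$h_s(I,J;N)=\lim_{e\to\infty}\frac{\ell_A\big(N/(I^{\lceil sp^e\rceil}+J^{[p^e]})N\big)}{p^{ed}},$$ where $\ell_A$ is length and $J^{[p^e]}$ is the ideal generated by the $p^e$-th powers of elements of $J$ (the limit is known to exist), and $$e_s(I,J;N)=\frac{h_s(I,J;N)}{\mathcal{H}_s(d)},\qquad \mathcal{H}_s(d)=\sum_{i=0}^{\lfloor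 s\rfloor}\frac{(-1)^i}{d!}\binom{d}{i}(s-i)^d .$$ For a local ring $(A,\mathfrak{n})$, $e_s(A):=e_s(\mathfrak{n},\mathfrak{n};A)$. *)

(* Defs.v *)
From HB Require Import structures.
From mathcomp Require Import all_boot all_order all_algebra.
From mathcomp Require Import boolp classical_sets functions reals.
From mathcomp Require Import topology normedtype sequences.
From mathcomp Require Import ring.

Set Implicit Arguments.
Unset Strict Implicit.
Unset Printing Implicit Defensive.

Import Order.TTheory GRing.Theory Num.Theory.
Import numFieldNormedType.Exports.
Local Open Scope classical_set_scope.
Local Open Scope ring_scope.

(* The value is 0 (junk) when P is empty or unbounded. *)
Definition max_nat (P : set nat) : nat :=
  xget 0%N [set n | P n /\ forall m, P m -> (m <= n)%N].

(* Largest n for which there is a chain c 0 < c 1 < ... < c n (strict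
   inclusions) of sets satisfying P. *)
Definition max_chain (T : Type) (P : set (set T)) : nat :=
  max_nat [set n | exists c : nat -> set T,
    (forall i, (i <= n)%N -> P (c i)) /\
    (forall i, (i < n)%N -> c i `<` c i.+1)].

Definition submodule (A : pzRingType) (N : lmodType A) (L : set N) : Prop :=
  L 0 /\ forall a x y, L x -> L y -> L (a *: x + y).

Definition span (A : pzRingType) (N : lmodType A) (X : set N) : set N :=
  smallest (@submodule A N) X.

(* Length of the quotient module N / L, computed on the submodules of N that
   contain L. *)
Definition quot_length (A : pzRingType) (N : lmodType A) (L : set N) : nat :=
  max_chain [set M : set N | submodule M /\ L `<=` M].

(* The submodule I N' of N, for N' a submodule of N. *)
Definition ideal_smul (A : pzRingType) (N : lmodType A)
    (I : set A) (N' : set N) : set N :=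
  span [set z | exists a x, [/\ I a, N' x & z = a *: x]].

Section Ideals.
Variable A : comNzRingType.
Implicit Types I J P m : set A.

Definition ideal I : Prop := submodule (I : set A^o).

Definition ideal_gen (X : set A) : set A := span (X : set A^o).

Definition ideal_add I J : set A :=
  [set z | exists x y, [/\ I x, J y & z = x + y]].

Definition ideal_exp I (n : nat) : set A :=
  iter n (fun J => ideal_smul I (J : set A^o) : set A) setT.

(* J^[p^e] *)
Definition frobenius_power (p e : nat) J : set A :=
  ideal_gen [set x ^+ (p ^ e) | x in J].

Definition prime_ideal P : Prop :=
  [/\ ideal P, ~ P 1 & forall x y, P (x * y) -> P x \/ P y].

Definition maximal_ideal m : Prop :=
  [/\ ideal m, ~ m 1 &
      forall J, ideal J -> ~ J 1 -> m `<=` J -> J = m].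

Definition noetherian : Prop :=
  forall I, ideal I -> exists s : seq A, I = ideal_gen [set` s].

Definition noeth_local : Prop :=
  noetherian /\ exists! m, maximal_ideal m.

(* Meant for local rings; the zero ideal when there is no maximal ideal. *)
Definition max_ideal : set A := xget [set 0] maximal_ideal.

(* Junk value 0 in infinite dimension, which does not occur for Noetherian
   local rings. *)
Definition krull_dim : nat := max_chain prime_ideal.

Definition regular_local : Prop :=
  noeth_local /\
  exists s : seq A, size s = krull_dim /\ max_ideal = ideal_gen [set` s].

Definition regular_sequence (f : seq A) : Prop :=
  (forall i x, (i < size f)%N ->
     ideal_gen [set` take i f] (f`_i * x) -> ideal_gen [set` take i f] x) /\
  ideal_gen [set` f] <> setT.

End Ideals.
Arguments max_ideal : clear implicits.
Arguments krull_dim : clear implicits.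
Arguments noetherian : clear implicits.
Arguments noeth_local : clear implicits.
Arguments regular_local : clear implicits.

Definition has_residue_field (A : comNzRingType) (k : fieldType) : Prop :=
  exists pi : {rmorphism A -> k},
    (forall y, exists x, pi x = y) /\ forall x, pi x = 0 <-> max_ideal A x.

Section IdealLemmas.
Variable A : comNzRingType.
Implicit Types I J : set A.

Lemma span_submodule (N : lmodType A) (X : set N) : submodule (span X).
Proof.
split=> [M [[]//]|a x y Lx Ly M MP]; have [[_ MD] _] := MP.
by apply: MD; [exact: Lx|exact: Ly].
Qed.

Lemma ideal_exp_ideal I n : ideal (ideal_exp I n).
Proof. by case: n => [|n]; [split|exact: span_submodule]. Qed.

Lemma ideal_exp1_sub I : ideal I -> ideal_exp I 1 `<=` I.
Proof.
move=> iI x; apply; split=> // _ [a [y [Ia _ ->]]].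
by have := iI.2 y a 0 Ia iI.1; rewrite addr0 /GRing.scale /= mulrC.
Qed.

Lemma ideal_idealr_closed I : ideal I -> ~ I 1 -> idealr_closed [in I].
Proof.
move=> [I0 ID] I1; split; first exact/mem_set.
  by apply/negP=> /set_mem.
by move=> a x y /set_mem Ix /set_mem Iy; apply/mem_set/(ID a x y).
Qed.

Lemma max_ideal_proper : ideal (max_ideal A) /\ ~ max_ideal A 1.
Proof.
rewrite /max_ideal; case: xgetP => [m _ []//|_]; split=> [|/= /eqP].
  by split=> //= a x y -> ->; rewrite scaler0 addr0.
by rewrite oner_eq0.
Qed.

Lemma max_ideal_closed : idealr_closed [in max_ideal A].
Proof. by have [] := max_ideal_proper; exact: ideal_idealr_closed. Qed.

End IdealLemmas.

Definition max_idealr (A : comNzRingType) : A -> bool := [in max_ideal A].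

HB.instance Definition _ (A : comNzRingType) :=
  isIdealr.Build A (@max_idealr A) (max_ideal_closed A).

(* The completion of A at the proper ideal I, that is, the inverse limit of
   the rings A / I^n: coherent sequences of representatives, modulo those
   representing 0 at every level. *)
Section Completion.
Variables (A : comNzRingType) (I : idealr A).

Let Iset : set A := [set x | x \in (I : {pred A})].

Let Iset_ideal : ideal Iset.
Proof.
split=> [|a x y Ix Iy]; first exact: idealr0.
by apply: rpredD => //; exact: idealMr.
Qed.

Definition coherent : {pred nat -> A} :=
  [pred u | `[< forall n, ideal_exp Iset n (u n.+1 - u n) >]].

Let expD n x y : ideal_exp Iset n x -> ideal_exp Iset n y ->
  ideal_exp Iset n (x + y).
Proof. by move=> /((ideal_exp_ideal Iset n).2 1 x y)/[apply]; rewrite scale1r. Qed.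

Let expM n a x : ideal_exp Iset n x -> ideal_exp Iset n (a * x).
Proof.
have [I0 ID] := ideal_exp_ideal Iset n.
by move=> /(ID a x 0)/(_ I0); rewrite addr0.
Qed.

Let expB n x y : ideal_exp Iset n x -> ideal_exp Iset n y ->
  ideal_exp Iset n (x - y).
Proof. by move=> Ix Iy; apply: expD => //; rewrite -mulN1r; exact: expM. Qed.

Lemma coherent_subring : subring_closed coherent.
Proof.
split=> [|u v /asboolP cu /asboolP cv|u v /asboolP cu /asboolP cv];
  apply/asboolP=> n.
- by rewrite subrr; exact: (ideal_exp_ideal Iset n).1.
- rewrite !fctE.
  have -> : u n.+1 - v n.+1 - (u n - v n) = (u n.+1 - u n) - (v n.+1 - v n).
    by ring.
  exact: expB.
- rewrite !fctE.
  have -> : u n.+1 * v n.+1 - u n * v n =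
      u n.+1 * (v n.+1 - v n) + v n * (u n.+1 - u n) by ring.
  by apply: expD; exact: expM.
Qed.

HB.instance Definition _ := GRing.isSubringClosed.Build (nat -> A) coherent
  coherent_subring.

Record coherent_seq := CoherentSeq
  { coherent_val :> nat -> A; _ : coherent_val \in coherent }.

HB.instance Definition _ := [isSub for coherent_val].
HB.instance Definition _ := [Choice of coherent_seq by <:].
HB.instance Definition _ := [SubChoice_isSubComNzRing of coherent_seq by <:].

Definition null_seq : coherent_seq -> bool :=
  fun u => `[< forall n, ideal_exp Iset n (u n) >].

Lemma null_seq_idealr : idealr_closed null_seq.
Proof.
split.
- by apply/asboolP=> n; exact: (ideal_exp_ideal Iset n).1.
- apply/negP=> /asboolP/(_ 1%N)/(ideal_exp1_sub Iset_ideal) /=.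
  by rewrite /Iset /= idealr1.
- move=> a u v /asboolP nu /asboolP nv; apply/asboolP=> n.
  by apply: expD; [exact: expM|exact: nv].
Qed.

HB.instance Definition _ := isIdealr.Build coherent_seq null_seq null_seq_idealr.

Definition completion : comNzRingType := {ideal_quot (null_seq : idealr coherent_seq)}.

End Completion.

Definition complete_intersection (A : comNzRingType) : Prop :=
  noeth_local A /\
  exists (Q : comNzRingType) (f : seq Q)
      (phi : {rmorphism Q -> completion (@max_idealr A)}),
    [/\ regular_local Q, regular_sequence f,
        forall y, exists x, phi x = y
      & forall x, phi x = 0 <-> ideal_gen [set` f] x].

Section FiberProduct.
Variables (R S T : comNzRingType).
Variables (epsR : {rmorphism R -> T}) (epsS : {rmorphism S -> T}).

Definition fiber_pred : {pred R * S} := [pred x | epsR x.1 == epsS x.2].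

Lemma fiber_subring : subring_closed fiber_pred.
Proof.
split=> [|x y /eqP Ex /eqP Ey|x y /eqP Ex /eqP Ey]; apply/eqP => /=.
- by rewrite !rmorph1.
- by rewrite !rmorphB /= Ex Ey.
- by rewrite !rmorphM /= Ex Ey.
Qed.

HB.instance Definition _ := GRing.isSubringClosed.Build (R * S)%type fiber_pred
  fiber_subring.

Record fiber_product := FiberProduct
  { fiber_val :> R * S; _ : fiber_val \in fiber_pred }.

HB.instance Definition _ := [isSub for fiber_val].
HB.instance Definition _ := [Choice of fiber_product by <:].
HB.instance Definition _ := [SubChoice_isSubComNzRing of fiber_product by <:].

End FiberProduct.

(* Formal power series in n variables: m : {ffun 'I_n -> nat} is the exponent
   of the monomial \prod_i x_i ^ m_i. *)
Section PowerSeries.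
Variables (n : nat) (k : comNzRingType).

Local Notation mon := {ffun 'I_n -> nat}.

Record fps := FPS { fps_coef : mon -> k }.

HB.instance Definition _ := gen_eqMixin fps.
HB.instance Definition _ := gen_choiceMixin fps.

Implicit Types f g h : fps.

Lemma fpsP f g : (forall m, fps_coef f m = fps_coef g m) -> f = g.
Proof. by case: f g => [f] [g] /= /funext ->. Qed.

Definition fps0 := FPS (fun=> 0).
Definition fps_opp f := FPS (fun m => - fps_coef f m).
Definition fps_add f g := FPS (fun m => fps_coef f m + fps_coef g m).

Program Definition fps_zmod := GRing.isZmodule.Build fps
  (zero := fps0) (opp := fps_opp) (add := fps_add) _ _ _ _.
Next Obligation. by move=> f g h; apply: fpsP => m /=; rewrite addrA. Qed.
Next Obligation. by move=> f g; apply: fpsP => m /=; rewrite addrC. Qed.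
Next Obligation. by move=> f; apply: fpsP => m /=; rewrite add0r. Qed.
Next Obligation. by move=> f; apply: fpsP => m /=; rewrite addNr. Qed.
HB.instance Definition _ := fps_zmod.

Definition mon_of N (a : {ffun 'I_n -> 'I_N}) : mon := [ffun i => a i : nat].

(* For N > \sum_i m i this is the sum over all pairs (a, b) of exponents with
   a + b = m, since the entries of such a and b are at most \sum_i m i. *)
Definition conv N f g (m : mon) : k :=
  \sum_(a : {ffun 'I_n -> 'I_N}) \sum_(b : {ffun 'I_n -> 'I_N}
                                        | mon_of a + mon_of b == m)
    fps_coef f (mon_of a) * fps_coef g (mon_of b).

Definition fps1 := FPS (fun m => (m == 0)%:R).
Definition fps_mul f g := FPS (fun m => conv (\sum_i m i).+1 f g m).

Lemma mon_of_lt N (a : {ffun 'I_n -> 'I_N}) i : (mon_of a i < N)%N.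
Proof. by rewrite ffunE. Qed.

Lemma sum_mon_of1 N (F : mon -> k) (m : mon) : (forall i, (m i < N.+1)%N) ->
  \sum_(a : {ffun 'I_n -> 'I_N.+1} | mon_of a == m) F (mon_of a) = F m.
Proof.
move=> mN; set a0 : {ffun 'I_n -> 'I_N.+1} := [ffun i => inord (m i)].
have a0E : mon_of a0 = m by apply/ffunP=> i; rewrite !ffunE inordK.
rewrite (big_pred1 a0) ?a0E // => a /=; rewrite -a0E; apply/eqP/eqP => [|-> //].
by move=> /ffunP aa0; apply/ffunP=> i; have := aa0 i; rewrite !ffunE => /val_inj.
Qed.

Lemma sum_mon_of_bound N M (F : mon -> k) :
    (forall m i, F m != 0 -> (m i < N.+1)%N && (m i < M.+1)%N) ->
  \sum_(a : {ffun 'I_n -> 'I_N.+1}) F (mon_of a) =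
  \sum_(a : {ffun 'I_n -> 'I_M.+1}) F (mon_of a).
Proof.
move=> bF.
transitivity (\sum_(a : {ffun 'I_n -> 'I_N.+1})
    \sum_(b : {ffun 'I_n -> 'I_M.+1} | mon_of b == mon_of a) F (mon_of b)).
  apply: eq_bigr => a _; have [F0|Fn0] := eqVneq (F (mon_of a)) 0.
    by rewrite big1 ?F0 // => b /eqP ->.
  by rewrite sum_mon_of1 // => i; have /andP[] := bF _ i Fn0.
rewrite (exchange_big_dep xpredT) //=; apply: eq_bigr => b _.
have [F0|Fn0] := eqVneq (F (mon_of b)) 0; first by rewrite big1 ?F0.
under eq_bigl do rewrite eq_sym.
rewrite (eq_bigr (fun a => F (mon_of a))) => [|a /eqP -> //].
by rewrite sum_mon_of1 // => i; have /andP[] := bF _ i Fn0.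
Qed.

Lemma mon_leq_sum (m : mon) i : (m i <= \sum_i m i)%N.
Proof. by rewrite (bigD1 i) //= leq_addr. Qed.

Lemma conv_bound N M f g (m : mon) :
  (forall i, (m i <= N)%N) -> (forall i, (m i <= M)%N) ->
  conv N.+1 f g m = conv M.+1 f g m.
Proof.
move=> mN mM.
have bnd (a b : mon) : (if a + b == m then fps_coef f a * fps_coef g b else 0) != 0 ->
    forall i, (a i <= m i)%N && (b i <= m i)%N.
  case: ifP => [/eqP <- _ i|_ /eqP //]; by rewrite ffunE leq_addr leq_addl.
pose F (a b : mon) := if a + b == m then fps_coef f a * fps_coef g b else 0.
have inner N' a : (forall i, (m i <= N')%N) -> forall M', (forall i, (m i <= M')%N) ->
    \sum_(b : {ffun 'I_n -> 'I_N'.+1}) F a (mon_of b) =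
    \sum_(b : {ffun 'I_n -> 'I_M'.+1}) F a (mon_of b).
  move=> mN' M' mM'; apply: sum_mon_of_bound => b i /bnd/(_ i)/andP[_ bm].
  by rewrite !ltnS !(leq_trans bm).
rewrite /conv; under eq_bigr do rewrite big_mkcond /=.
under [RHS]eq_bigr do rewrite big_mkcond /=.
transitivity (\sum_(a : {ffun 'I_n -> 'I_N.+1})
    \sum_(b : {ffun 'I_n -> 'I_M.+1}) F (mon_of a) (mon_of b)).
  by apply: eq_bigr => a _; exact: inner.
apply: (@sum_mon_of_bound N M (fun a => \sum_b F a (mon_of b))) => a i.
case: (boolP (a i <= m i)%N) => [am|nam].
  by rewrite !ltnS (leq_trans am (mN i)) (leq_trans am (mM i)).
rewrite big1 ?eqxx // => b _; apply/eqP; apply: contraNT nam.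
by move=> /bnd/(_ i)/andP[].
Qed.

Lemma fps_mulC : commutative fps_mul.
Proof.
move=> f g; apply: fpsP => m /=; rewrite /conv (exchange_big_dep xpredT) //=.
apply: eq_bigr => b _; apply: eq_big => [a|a _]; first by rewrite addrC.
by rewrite mulrC.
Qed.

Lemma fps_mul3 f g h (m : mon) (N := (\sum_i m i).+1) :
  fps_coef (fps_mul f (fps_mul g h)) m =
  \sum_(a : {ffun 'I_n -> 'I_N}) \sum_(b : {ffun 'I_n -> 'I_N})
    \sum_(c : {ffun 'I_n -> 'I_N} | mon_of a + (mon_of b + mon_of c) == m)
      fps_coef f (mon_of a) * (fps_coef g (mon_of b) * fps_coef h (mon_of c)).
Proof.
rewrite /= /conv; apply: eq_bigr => a _.
transitivity (\sum_(u : {ffun 'I_n -> 'I_N} | mon_of a + mon_of u == m)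
    \sum_(b : {ffun 'I_n -> 'I_N}) \sum_(c : {ffun 'I_n -> 'I_N})
      if mon_of b + mon_of c == mon_of u then
      fps_coef f (mon_of a) * (fps_coef g (mon_of b) * fps_coef h (mon_of c))
      else 0).
  apply: eq_bigr => u /eqP um.
  rewrite -[X in _ * X]/(conv _ g h (mon_of u)) (@conv_bound _ (\sum_i m i)%N).
  - rewrite mulr_sumr; apply: eq_bigr => b _; rewrite mulr_sumr big_mkcond.
    by apply: eq_bigr => c _.
  - exact: mon_leq_sum.
  - by move=> i; rewrite -ltnS mon_of_lt.
rewrite exchange_big /=; apply: eq_bigr => b _.
rewrite exchange_big /= [RHS]big_mkcond; apply: eq_bigr => c _.
case: ifPn => [/eqP abc|nabc].
  rewrite -big_mkcondr /= -[RHS](@sum_mon_of1 (\sum_i m i)%N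
    (fun=> fps_coef f (mon_of a) * (fps_coef g (mon_of b) * fps_coef h (mon_of c)))
    (mon_of b + mon_of c)); last first.
    move=> i; rewrite ltnS; apply: leq_trans (mon_leq_sum m i).
    by rewrite -abc [X in (_ <= X)%N]ffunE leq_addl.
  apply: eq_bigl => u; apply/andP/eqP => [[_ /eqP //]|ubc].
  by rewrite ubc; split; [exact/eqP|exact: eqxx].
rewrite big1 // => u /eqP um; case: eqP => // bcu.
by rewrite bcu um eqxx in nabc.
Qed.

Lemma fps_mulA : associative fps_mul.
Proof.
move=> f g h; rewrite [RHS]fps_mulC; apply: fpsP => m; rewrite !fps_mul3.
rewrite [RHS]exchange_big; apply: eq_bigr => a _ /=.
transitivity (\sum_(b : {ffun 'I_n -> 'I_(\sum_i m i).+1})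
    \sum_(c : {ffun 'I_n -> 'I_(\sum_i m i).+1}
         | mon_of a + (mon_of b + mon_of c) == m)
    fps_coef h (mon_of c) * (fps_coef f (mon_of a) * fps_coef g (mon_of b))).
  by apply: eq_bigr => b _; apply: eq_bigr => c _; rewrite [RHS]mulrC mulrA.
rewrite (exchange_big_dep xpredT) //=; apply: eq_bigr => c _.
by apply: eq_bigl => b; rewrite [in RHS]addrC addrA.
Qed.

Lemma fps_mul1 : left_id fps1 fps_mul.
Proof.
move=> f; apply: fpsP => m /=; rewrite /conv.
pose F (a : mon) := \sum_(b : {ffun 'I_n -> 'I_(\sum_i m i).+1}
    | a + mon_of b == m) (a == 0)%:R * fps_coef f (mon_of b).
rewrite (eq_bigr (fun a => F (mon_of a))) // (bigID (fun a => mon_of a == 0)) /=.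
rewrite [X in _ + X]big1 ?addr0 => [|a /negPf a0]; last first.
  by rewrite /F big1 // => b _; rewrite a0 mul0r.
rewrite (@sum_mon_of1 (\sum_i m i)%N F) => [|i]; last by rewrite ffunE.
rewrite -[RHS](@sum_mon_of1 (\sum_i m i)%N) => [|i]; last first.
  by rewrite ltnS mon_leq_sum.
by apply: eq_big => [b|b _]; rewrite ?add0r // eqxx mul1r.
Qed.

Lemma fps_mulDl : left_distributive fps_mul +%R.
Proof.
move=> f g h; apply: fpsP => m; rewrite [RHS]/= /conv -big_split /=.
apply: eq_bigr => a _; rewrite -big_split /=.
by apply: eq_bigr => b _; rewrite mulrDl.
Qed.

Lemma fps_nonzero1 : fps1 != 0.
Proof.
apply/eqP => /(congr1 (fun f => fps_coef f 0)) /= /eqP.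
by rewrite eqxx oner_eq0.
Qed.

HB.instance Definition _ := GRing.Zmodule_isComNzRing.Build fps
  fps_mulA fps_mulC fps_mul1 fps_mulDl fps_nonzero1.

Definition fps_X (i : 'I_n) : fps :=
  FPS (fun m => (m == [ffun j => (j == i : nat)])%:R).

Lemma fps_coef0M f g : fps_coef (f * g) 0 = fps_coef f 0 * fps_coef g 0.
Proof.
have zero_lt i : ((0%R : mon) i <= 0)%N by rewrite ffunE.
rewrite [LHS]/= (@conv_bound _ 0%N) //; last exact: mon_leq_sum.
rewrite /conv (bigD1 [ffun=> ord0]) //= [X in _ + X]big1 ?addr0; last first.
  by move=> a /eqP []; apply/ffunP=> i; rewrite [RHS]ffunE ord1.
have a0 : mon_of [ffun=> ord0 : 'I_1] = 0 by apply/ffunP=> i; rewrite !ffunE.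
rewrite a0 -mulr_sumr; congr (_ * _).
rewrite -[RHS](@sum_mon_of1 0%N) //.
by apply: eq_bigl => b; rewrite add0r.
Qed.

Definition sum_X_sq : fps := \sum_(i < n) fps_X i ^+ 2.

Definition quadric_ideal : fps -> bool := [in ideal_gen [set sum_X_sq]].

Lemma quadric_ideal_closed : idealr_closed quadric_ideal.
Proof.
apply: ideal_idealr_closed; first exact: span_submodule.
move=> /(_ [set f | fps_coef f 0 = 0]) /= H.
suff /H/eqP : submodule [set f : fps^o | fps_coef f 0 = 0] /\
    [set sum_X_sq] `<=` [set f | fps_coef f 0 = 0] by rewrite eqxx oner_eq0.
split=> [|_ ->].
  split=> //= a x y x0 y0.
  rewrite -[LHS]/(fps_coef (a * x : fps) 0 + fps_coef y 0).
  by rewrite fps_coef0M x0 y0 mulr0 addr0.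
have coef0D : {morph (fun f => fps_coef f 0) : f g / f + g} by [].
rewrite /sum_X_sq /= (big_morph _ coef0D (erefl _)) big1 // => i _.
rewrite expr2 fps_coef0M /=; case: eqP => [/ffunP/(_ i)|]; last by rewrite mul0r.
by rewrite !ffunE eqxx.
Qed.

HB.instance Definition _ := isIdealr.Build fps quadric_ideal
  quadric_ideal_closed.

End PowerSeries.

(* k[[x_0, ..., x_d]] / (x_0^2 + ... + x_d^2) *)
Definition quadric (k : fieldType) (d : nat) : comNzRingType :=
  {ideal_quot (@quadric_ideal d.+1 k : idealr (fps d.+1 k))}.

Section SMultiplicity.
Variables (RR : realType) (p : nat).

Definition h_mult (s : RR) (A : comNzRingType) (I J : set A)
    (N : lmodType A) : RR :=
  lim ((fun e : nat =>
    (quot_length (ideal_smul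
       (ideal_add (ideal_exp I `|Num.ceil (s * p%:R ^+ e)|%N)
                  (frobenius_power p e J))
       [set: N]))%:R / p%:R ^+ (e * krull_dim A) : RR) @ \oo).

Definition calH (s : RR) (d : nat) : RR :=
  \sum_(0 <= i < (Num.truncn s).+1)
    (-1) ^+ i / d`!%:R * 'C(d, i)%:R * (s - i%:R) ^+ d.

Definition e_mult (s : RR) (A : comNzRingType) (I J : set A)
    (N : lmodType A) : RR :=
  h_mult s I J N / calH s (krull_dim A).

Definition s_mult (s : RR) (A : comNzRingType) : RR :=
  e_mult s (max_ideal A) (max_ideal A) A^o.

End SMultiplicity.

(* Main.v *)
Require Import Defs.
From HB Require Import structures.
From mathcomp Require Import all_boot all_order all_algebra.
From mathcomp Require Import boolp classical_sets functions reals.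
From mathcomp Require Import topology normedtype sequences.
From mathcomp Require Import ring_quotient zify ring lra.

(** For a local ring [(A, m)] let [L A b q] be the colength of
    [m^b + m^[q]]; up to normalization [s_mult] is the limit of
    [L A b q / q^dim A] with [b = ceil (s q)] and [q = p^e].  The proof
    compares these colengths for each [e] separately.

    A coefficient field of [R / m^N] presents [R], up to [m^N], as a polynomial
    ring modulo [c + 1] relations [F], with [dim R + c + 1] variables.  As [R]
    is not regular, one relation [F_0] can be taken in the square of the
    maximal ideal.  Let [G] consist of [x_0^2 + ... + x_d^2] and the other [c]
    variables, which present the quadric.  Since [p] is odd, Newton iteration
    on the variables identifies the family [G + s F] with the constant family
    [G] modulo every power of [s]; as the colength of a generic member of the
    pencil is at most that of [F], the quadric has the smaller colength.

    The sequence [L R b q / q^d] converges: separating ideals by Cartier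
    operators shows that a Frobenius step multiplies colengths in the
    polynomial ring by at least [p^n], which makes the sequence nondecreasing
    up to shifting [b] by a constant, and the Hilbert function bound
    [b (L R (b + 1) q - L R b q) = O (q^d)] makes the shift harmless.

    The kernel of the projection from the fiber product to [R] is a finitely
    generated ideal of [S], so the colengths of the fiber product and of [R]
    differ by [O (q^dim S)] only.

    The Krull dimension [D] of the quadric is not computed: if [D > d] its
    sequence tends to [0], if [D < d] it is unbounded, so that [lim] has its
    junk value [0], and [calH >= 0]. *)

Set Implicit Arguments.
Unset Strict Implicit.
Unset Printing Implicit Defensive.

Import Defs.
Import Order.TTheory GRing.Theory Num.Theory.
Import numFieldNormedType.Exports.
Local Open Scope ring_scope.
Local Open Scope classical_set_scope.

(** * Length *)

(** Every colength involved depends only on a quotient modulo a power of the maximal ideal. The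
    completion of [R] therefore enters only through [R / m^N], and polynomial rings over [k] take
    the place of power series rings. They are not local, but the ideals whose colengths are compared
    contain a power of [pmax].

    The quadratic part of [F_0] may be any form, even zero, and [k] may be finite or imperfect. So
    nothing is diagonalized and no member of the pencil is specialized: the pencil is studied over
    [k['X] / 'X^m]. There its length is at least [m] times the colength of the quadric and at most
    [m] times that of [F] plus an error independent of [m]; a large [m] gives the inequality.

    Odd characteristic serves to divide by the derivative [2 x_i] of a square.

    As [lim] has a junk value, termwise inequalities do not suffice: convergence has to be proved
    for [R], and it passes to the fiber product by squeezing, since [dim S < dim R]. *)

Definition sadd (V : zmodType) (L M : set V) : set V :=
  [set z | exists x y, [/\ L x, M y & z = x + y]].

Lemma max_nat_le (P : set nat) n : (forall m, P m -> (m <= n)%N) ->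
  (max_nat P <= n)%N.
Proof. by move=> le; rewrite /max_nat; case: xgetP => // m _ [/le]. Qed.

Lemma max_nat_ex (P : set nat) n m : P m -> (forall m, P m -> (m <= n)%N) ->
  P (max_nat P) /\ forall m, P m -> (m <= max_nat P)%N.
Proof.
move=> Pm le; have exP : exists i, `[< P i >] by exists m; apply/asboolP.
have leP i : `[< P i >] -> (i <= n)%N by move/asboolP/le.
have [x /asboolP Px maxx] := ex_maxnP exP leP.
rewrite /max_nat; case: xgetP => [y -> [Py maxy]//|/(_ x) []].
by split=> // i /asboolP /maxx.
Qed.

Section Length.
Variables (A : comNzRingType) (N : lmodType A).
Implicit Types (L M K X Y : set N).

Lemma sub0 L : submodule L -> L 0. Proof. by case. Qed.

Lemma subZ L a x : submodule L -> L x -> L (a *: x).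
Proof. by move=> [L0 LD] Lx; have := LD a _ _ Lx L0; rewrite addr0. Qed.

Lemma subD L x y : submodule L -> L x -> L y -> L (x + y).
Proof. by move=> [_ LD] Lx Ly; have := LD 1 _ _ Lx Ly; rewrite scale1r. Qed.

Lemma subN L x : submodule L -> L x -> L (- x).
Proof. by move=> sL /(subZ (-1) sL); rewrite scaleN1r. Qed.

Lemma subB L x y : submodule L -> L x -> L y -> L (x - y).
Proof. by move=> sL Lx Ly; apply: subD => //; exact: subN. Qed.

Lemma sub_sum L (I : Type) (r : seq I) (P : pred I) (F : I -> N) :
  submodule L -> (forall i, P i -> L (F i)) -> L (\sum_(i <- r | P i) F i).
Proof.
by move=> sL LF; apply: big_ind => //; [exact: sub0|move=> *; exact: subD].
Qed.

Lemma submodule_setI L M : submodule L -> submodule M -> submodule (L `&` M).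
Proof.
move=> [L0 LD] [M0 MD]; split=> // a x y [Lx Mx] [Ly My].
by split; [exact: LD|exact: MD].
Qed.

Lemma submodule_sadd L M : submodule L -> submodule M -> submodule (sadd L M).
Proof.
move=> [L0 LD] [M0 MD]; split; first by exists 0, 0; split; rewrite ?addr0.
move=> a _ _ [x [y [Lx My ->]]] [x' [y' [Lx' My' ->]]].
exists (a *: x + x'), (a *: y + y'); split; [exact: LD|exact: MD|].
by rewrite scalerDr addrACA.
Qed.

Lemma sadd_l L M : submodule M -> L `<=` sadd L M.
Proof. by move=> [M0 _] x Lx; exists x, 0; rewrite addr0. Qed.

Lemma sadd_r L M : submodule L -> M `<=` sadd L M.
Proof. by move=> [L0 _] x Lx; exists 0, x; rewrite add0r. Qed.

Lemma sadd_sub L M K : submodule K -> L `<=` K -> M `<=` K -> sadd L M `<=` K.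
Proof. by move=> sK LK MK _ [x [y [/LK ? /MK ? ->]]]; exact: subD. Qed.

Lemma saddS L M L' M' : L `<=` L' -> M `<=` M' -> sadd L M `<=` sadd L' M'.
Proof. by move=> LL MM _ [x [y [/LL ? /MM ? ->]]]; exists x, y. Qed.

Lemma span_sub (X : set N) : X `<=` span X.
Proof. by move=> x Xx M [_]; exact. Qed.

Lemma span_min (X : set N) L : submodule L -> X `<=` L -> span X `<=` L.
Proof. by move=> sL XL x; apply. Qed.

(** The chain need not start at [L] or end at [M], so that [lenge] is monotone in the interval
    without reattaching endpoints. *)
Definition lenge L M n := exists c : nat -> set N,
  (forall i, (i <= n)%N -> [/\ submodule (c i), L `<=` c i & c i `<=` M]) /\
  (forall i, (i < n)%N -> c i `<` c i.+1).

Definition lenle L M n := forall m, lenge L M m -> (m <= n)%N.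

(* 0 (junk) when the length is infinite; hence the predicates [lenge] and [lenle]. *)
Definition len L M : nat := max_nat [set n | lenge L M n].

Lemma quot_lengthE L : quot_length L = len L setT.
Proof.
congr max_nat; apply/seteqP; split=> n [c [cP cS]]; exists c; split=> // i le_in.
  by have /= [? ?] := cP i le_in; split.
by have [? ? _] := cP i le_in; split.
Qed.

Lemma lenge0 L M : submodule L -> L `<=` M -> lenge L M 0.
Proof. by move=> sL LM; exists (fun=> L); split=> [i _|//]; split. Qed.

Lemma lenge_sub L M L' M' n : L' `<=` L -> M `<=` M' -> lenge L M n ->
  lenge L' M' n.
Proof.
move=> LL MM [c [cP cS]]; exists c; split=> // i /cP[sc Lc cM].
by split=> //; [exact: subset_trans Lc|exact: subset_trans MM].
Qed.

Lemma lenle_sub L M L' M' n : L' `<=` L -> M `<=` M' -> lenle L' M' n ->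
  lenle L M n.
Proof. by move=> LL MM le m /(lenge_sub LL MM)/le. Qed.

Lemma lenle_leq L M n m : (n <= m)%N -> lenle L M n -> lenle L M m.
Proof. by move=> nm le i /le/leq_trans; apply. Qed.

Lemma len_le L M n : lenle L M n -> (len L M <= n)%N.
Proof. by move=> le; exact: max_nat_le. Qed.

Lemma len_ex L M n : submodule L -> L `<=` M -> lenle L M n ->
  lenge L M (len L M) /\ lenle L M (len L M).
Proof. by move=> sL LM le; apply: (@max_nat_ex _ n 0%N _ le); exact: lenge0. Qed.

Lemma len_ge L M n m : submodule L -> L `<=` M -> lenle L M n -> lenge L M m ->
  (m <= len L M)%N.
Proof. by move=> sL LM le; have [_] := len_ex sL LM le; exact. Qed.

Lemma lenge_rcons L X Y n : submodule Y -> L `<=` X -> X `<` Y -> lenge L X n ->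
  lenge L Y n.+1.
Proof.
move=> sY LX [XY nYX] [c [cP cS]].
exists (fun i => if (i <= n)%N then c i else Y); split=> i le_i.
  case: ifPn => [/cP[? ? cX]|_]; last by split=> //; exact: subset_trans XY.
  by split=> //; exact: subset_trans XY.
rewrite -ltnS le_i; case: ifPn => [/cS//|]; rewrite -leqNgt => ni.
have {ni} ni : n = i by apply/eqP; rewrite eqn_leq ni -ltnS.
have [_ _ cX] := cP n (leqnn n); rewrite -ni; split; first exact: subset_trans XY.
by move=> Yc; apply: nYX; exact: subset_trans cX.
Qed.

Lemma lenge_cat L M K a b : submodule M -> lenge L M a -> lenge M K b -> lenge L K (a + b).
Proof.
move=> sM La [d [dP dS]]; elim: b dP dS => [|b IHb] dP dS.
  have [_ Md dK] := dP 0%N isT; rewrite addn0; apply: lenge_sub La => //.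
  exact: subset_trans Md dK.
rewrite addnS.
have [sd Md dK] := dP b.+1 (leqnn _); have [sb Mb _] := dP b (leqnSn _).
apply: (@lenge_sub L (d b.+1)) => //.
apply: (@lenge_rcons _ (d b)) => //; last 1 first.
- have {IHb} : lenge L (d b) (a + b).
    elim: b {IHb sd Md dK} dP dS sb Mb => [|b IHb] dP dS sb Mb.
      by rewrite addn0; apply: lenge_sub La.
    rewrite addnS; have [sb' Mb' _] := dP b (leqW (leqnSn _)).
    apply: (@lenge_rcons _ (d b)) => //.
    + by have [c [cP _]] := La; have [_ Lc cM] := cP _ (leq0n _);
        apply: subset_trans Mb'; apply: subset_trans cM.
    + exact: dS.
    + apply: IHb => // i lei; first by apply: dP; rewrite leqW.
      by apply: dS; rewrite ltnW.
  by [].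
- by have [c [cP _]] := La; have [_ Lc cM] := cP _ (leq0n _);
    apply: subset_trans Mb; apply: subset_trans cM.
- exact: dS.
Qed.

Lemma len_mono L X Y n : submodule L -> L `<=` X -> X `<=` Y -> lenle L Y n ->
  (len L X <= len L Y)%N.
Proof.
move=> sL LX XY le; have leX := lenle_sub (@subset_refl _ L) XY le.
have [+ _] := len_ex sL LX leX => /(lenge_sub (@subset_refl _ L) XY).
by apply: (len_ge sL _ le); exact: subset_trans XY.
Qed.

Lemma len_strict L X Y n : submodule L -> submodule Y -> L `<=` X -> X `<` Y ->
  lenle L Y n -> (len L X < len L Y)%N.
Proof.
move=> sL sY LX XY le; have leX := lenle_sub (@subset_refl _ L) XY.1 le.
have [+ _] := len_ex sL LX leX => /(lenge_rcons sY LX XY).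
by apply: (len_ge sL _ le); apply: subset_trans XY.1.
Qed.

(** Modular law, used contrapositively: a strict inclusion of [X] in [Y] stays strict after
    intersecting with [M] or after adding [M]. *)
Lemma modular_strict M X Y : submodule M -> submodule X -> submodule Y ->
  X `<=` Y -> Y `&` M `<=` X -> Y `<=` sadd M X -> Y `<=` X.
Proof.
move=> sM sX sY XY MX Ys y Yy; have [m [x [Mm Xx yE]]] := Ys y Yy.
rewrite yE; apply: subD => //; apply: MX; split=> //.
by have -> : m = y - x; [rewrite yE addrK|apply: subB => //; exact: XY].
Qed.

(* By the modular law, [len (X `&` M) + len (M + X)] increases strictly along a
   chain of submodules [X]. *)
Lemma lenle_add L M K a b : submodule L -> submodule M -> submodule K -> L `<=` M -> M `<=` K ->
  lenle L M a -> lenle M K b -> lenle L K (a + b).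
Proof.
move=> sL sM sK LM MK La Mb n [c [cP cS]].
pose f i := (len L (c i `&` M) + len M (sadd M (c i)))%N.
have f_le i : (i <= n)%N -> (i <= f i <= a + b)%N.
  have fb j : (j <= n)%N -> (f j <= a + b)%N.
    move=> /cP[sc Lc cK]; apply: leq_add; apply: len_le.
      by apply: lenle_sub La => // x [].
    by apply: lenle_sub Mb => //; exact: sadd_sub.
  move=> le_in; rewrite fb // andbT; elim: i le_in => // i IHi lt_in.
  apply: leq_ltn_trans (IHi (ltnW lt_in)) _.
  have [[sc Lc cK] [sc' Lc' cK']] := (cP i (ltnW lt_in), cP i.+1 lt_in).
  have [cc ncc] := cS i lt_in.
  have le1 : (len L (c i `&` M) <= len L (c i.+1 `&` M))%N.
    apply: (@len_mono _ _ _ a) => //.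
    - by move=> x Lx; split; [exact: Lc|exact: LM].
    - by apply: setSI.
    - by apply: lenle_sub La => // x [].
  have le2 : (len M (sadd M (c i)) <= len M (sadd M (c i.+1)))%N.
    apply: (@len_mono _ _ _ b) => //.
    - exact: sadd_l.
    - exact: saddS.
    - by apply: lenle_sub Mb => //; exact: sadd_sub.
  rewrite /f; have [e1|ne1] := pselect (c i.+1 `&` M `<=` c i); last first.
    rewrite -addSn; apply: leq_add => //.
    apply: (@len_strict _ _ _ a) => //.
    - exact: submodule_setI.
    - by move=> x Lx; split; [exact: Lc|exact: LM].
    - split; first exact: setSI.
      by move=> h; apply: ne1 => x /h[].
    - by apply: lenle_sub La => // x [].
  rewrite -addnS; apply: leq_add => //; apply: (@len_strict _ _ _ b) => //.
  - exact: submodule_sadd.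
  - exact: sadd_l.
  - split; first exact: saddS.
    move=> h; apply: ncc; apply: (@modular_strict M) => //.
    by move=> x cx; apply: h; exact: sadd_r.
  - by apply: lenle_sub Mb => //; exact: sadd_sub.
by have /andP[h1 h2] := f_le n (leqnn n); exact: leq_trans h2.
Qed.

Lemma lenD L M K a b : submodule L -> submodule M -> submodule K -> L `<=` M -> M `<=` K ->
  lenle L M a -> lenle M K b -> len L K = (len L M + len M K)%N.
Proof.
move=> sL sM sK LM MK La Mb; have [L1 L2] := len_ex sL LM La.
have [M1 M2] := len_ex sM MK Mb; have LK := lenle_add sL sM sK LM MK L2 M2.
apply/eqP; rewrite eqn_leq (len_le LK) (len_ge sL _ LK) //.
  exact: subset_trans MK.
exact: lenge_cat M1.
Qed.

End Length.

Section Transfer.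
Variables (A B : comNzRingType) (N : lmodType A) (N' : lmodType B).

(** Order embeddings between intervals of submodules preserve strict chains. The two rings may
    differ, since chains are moved along ring maps and from [{poly A}]-submodules to
    [A]-submodules. *)
Lemma lenge_transfer (F : set N -> set N') (L M : set N) (L' M' : set N') n :
    (forall X, submodule X -> L `<=` X -> X `<=` M ->
      [/\ submodule (F X), L' `<=` F X & F X `<=` M']) ->
    (forall X Y, submodule X -> submodule Y -> L `<=` X -> X `<=` Y -> Y `<=` M ->
      F X `<=` F Y) ->
    (forall X Y, submodule X -> submodule Y -> L `<=` X -> X `<=` Y -> Y `<=` M ->
      F Y `<=` F X -> Y `<=` X) ->
  lenge L M n -> lenge L' M' n.
Proof.
move=> FP F1 F2 [c [cP cS]]; exists (F \o c); split=> i lei.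
  by have [? ? ?] := cP i lei; exact: FP.
have [[sc Lc cM] [sc' Lc' cM']] := (cP i (ltnW lei), cP i.+1 lei).
by have [cc ncc] := cS i lei; split=> /=; [apply: F1|move=> /F2 h; apply: ncc; exact: h].
Qed.

End Transfer.

Section LengthImage.
Variables (A : comNzRingType) (N N' : lmodType A).

(** [(Y + f X) / Y] is a quotient of [X / X']. Pulling a chain back to [X] collapses no step,
    because every element of the interval is an element of [Y] plus a value of [f]. *)
Lemma lenle_image (f : N -> N') (X' X : set N) (Y : set N') n :
    (forall a x y, f (a *: x + y) = a *: f x + f y) ->
    submodule X' -> submodule X -> X' `<=` X -> submodule Y -> (forall x, X' x -> Y (f x)) ->
  lenle X' X n -> lenle Y (sadd Y (f @` X)) n.
Proof.
move=> fL sX' sX X'X sY fY le m.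
have f0 : f 0 = 0 by have := fL (-1) 0 0; rewrite scaler0 addr0 scaleN1r addNr.
move=> /(@lenge_transfer _ _ _ N (fun Z => X `&` f @^-1` Z) _ _ X' X) h; apply/le/h.
- move=> Z sZ YZ ZY; split=> [|x X'x|x []//]; last by split; [exact: X'X|apply/YZ/fY].
  apply: submodule_setI => //; split=> [/=|a x y /= Zx Zy].
    by rewrite f0; exact: sub0.
  by rewrite fL; exact: sZ.2.
- by move=> Z Z' _ _ _ ZZ' _; apply: setIS => x /=; exact: ZZ'.
move=> Z Z' sZ sZ' YZ ZZ' Z'Y h' z Z'z; have [y [_ [Yy [x Xx <-] zE]]] := Z'Y _ Z'z.
have fxE : f x = z - y by rewrite zE addrAC subrr add0r.
rewrite zE; apply: subD => //; first exact: YZ.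
have [] // := h' x; split=> //=; rewrite fxE; apply: subB => //.
by apply/ZZ'/YZ.
Qed.

End LengthImage.

(** * Ideals, powers and colength *)

Section IdealBasics.
Variable A : comNzRingType.
Implicit Types (I J K P : set A) (x y a : A).

Lemma idl0 I : ideal I -> I 0. Proof. by case. Qed.

Lemma idlM I a x : ideal I -> I x -> I (a * x).
Proof. by move=> iI Ix; exact: (@subZ A A^o I a x iI Ix). Qed.

Lemma idlMr I a x : ideal I -> I x -> I (x * a).
Proof. by rewrite mulrC; exact: idlM. Qed.

Lemma idlD I x y : ideal I -> I x -> I y -> I (x + y).
Proof. by move=> iI; exact: (@subD A A^o I x y iI). Qed.

Lemma idlN I x : ideal I -> I x -> I (- x).
Proof. by move=> iI; exact: (@subN A A^o I x iI). Qed.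

Lemma idlB I x y : ideal I -> I x -> I y -> I (x - y).
Proof. by move=> iI; exact: (@subB A A^o I x y iI). Qed.

Lemma idl_sum I (T : Type) (r : seq T) (P : pred T) (F : T -> A) :
  ideal I -> (forall i, P i -> I (F i)) -> I (\sum_(i <- r | P i) F i).
Proof. exact: (@sub_sum A A^o I). Qed.

Lemma idl1 I : ideal I -> I 1 -> I = setT.
Proof.
by move=> iI I1; apply/seteqP; split=> // x _; rewrite -(mulr1 x); exact: idlM.
Qed.

Lemma mk_ideal I : I 0 -> (forall x y, I x -> I y -> I (x + y)) ->
  (forall a x, I x -> I (a * x)) -> ideal I.
Proof. by move=> I0 ID IM; split=> // a x y Ix Iy; apply: ID => //; exact: IM. Qed.

Lemma ideal_sadd I J : ideal I -> ideal J -> ideal (sadd I J).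
Proof. exact: (@submodule_sadd A A^o). Qed.

Lemma idl_gen_ideal (X : set A) : ideal (ideal_gen X).
Proof. exact: span_submodule. Qed.

Lemma idl_gen_sub (X : set A) : X `<=` ideal_gen X.
Proof. exact: (@span_sub A A^o). Qed.

Lemma idl_gen_min (X : set A) I : ideal I -> X `<=` I -> ideal_gen X `<=` I.
Proof. exact: (@span_min A A^o). Qed.

Lemma idl_genS (X Y : set A) : X `<=` Y -> ideal_gen X `<=` ideal_gen Y.
Proof.
move=> XY; apply: idl_gen_min; first exact: idl_gen_ideal.
by apply: subset_trans XY _; exact: idl_gen_sub.
Qed.

Definition princ x : set A := [set z | exists a, z = a * x].

Lemma ideal_princ x : ideal (princ x).
Proof.
apply: mk_ideal; first by exists 0; rewrite mul0r.
  by move=> _ _ [a ->] [b ->]; exists (a + b); rewrite mulrDl.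
by move=> a _ [b ->]; exists (a * b); rewrite mulrA.
Qed.

Lemma princ_id x : princ x x. Proof. by exists 1; rewrite mul1r. Qed.

Lemma princ_sub x I : ideal I -> I x -> princ x `<=` I.
Proof. by move=> iI Ix _ [a ->]; exact: idlM. Qed.

Definition colon I x : set A := [set a | I (a * x)].

Lemma ideal_colon I x : ideal I -> ideal (colon I x).
Proof.
move=> iI; apply: mk_ideal; rewrite /colon /=; first by rewrite mul0r; exact: idl0.
  by move=> a b Ia Ib; rewrite mulrDl; exact: idlD.
by move=> a b Ib; rewrite -mulrA; exact: idlM.
Qed.

Definition imul I J : set A := ideal_smul I (J : set A^o).

Lemma ideal_imul I J : ideal (imul I J).
Proof. exact: span_submodule. Qed.

Lemma imulP I J x y : I x -> J y -> imul I J (x * y).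
Proof. by move=> Ix Jy; apply: idl_gen_sub; exists x, y. Qed.

Lemma imul_min I J K : ideal K -> (forall x y, I x -> J y -> K (x * y)) ->
  imul I J `<=` K.
Proof. by move=> iK IJK; apply: idl_gen_min => // _ [a [x [Ia Jx ->]]]; exact: IJK. Qed.

Lemma imul_subl I J : ideal I -> imul I J `<=` I.
Proof. by move=> iI; apply: imul_min => // x y Ix _; exact: idlMr. Qed.

Lemma imul_subr I J : ideal J -> imul I J `<=` J.
Proof. by move=> iJ; apply: imul_min => // x y _ Jy; exact: idlM. Qed.

Lemma iexpS I n : ideal_exp I n.+1 = imul I (ideal_exp I n).
Proof. by []. Qed.

Lemma iexp_ideal I n : ideal (ideal_exp I n).
Proof. exact: ideal_exp_ideal. Qed.

Lemma iexp1 I : ideal I -> ideal_exp I 1 = I.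
Proof.
move=> iI; apply/seteqP; split; first exact: ideal_exp1_sub.
by move=> x Ix; rewrite -(mulr1 x); exact: imulP.
Qed.

Lemma iexp_le I m n : (m <= n)%N -> ideal_exp I n `<=` ideal_exp I m.
Proof.
move=> le_mn; rewrite -(subnK le_mn); elim: (n - m)%N => [|k IHk] //.
by apply: subset_trans IHk; rewrite addSn iexpS; apply: imul_subr; exact: iexp_ideal.
Qed.

Lemma iexp_sub I n : ideal I -> (0 < n)%N -> ideal_exp I n `<=` I.
Proof. by move=> iI n0; rewrite -[X in _ `<=` X]iexp1 //; exact: iexp_le. Qed.

Lemma iexpD I m n x y : ideal_exp I m x -> ideal_exp I n y ->
  ideal_exp I (m + n) (x * y).
Proof.
move=> + Iy; elim: m x => [|m IHm] x; first by move=> _; apply: idlM => //; exact: iexp_ideal.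
rewrite iexpS addSn; apply: (@imul_min _ _ (colon (ideal_exp I (m + n).+1) y)).
  by apply: ideal_colon; exact: iexp_ideal.
by move=> a b Ia Ib; rewrite /colon /= -mulrA; apply: imulP => //; exact: IHm.
Qed.

Lemma iexpX I x n : I x -> ideal_exp I n (x ^+ n).
Proof.
by move=> Ix; elim: n => [|n IHn] //; rewrite exprS; exact: imulP.
Qed.

Lemma iexpMX I n m x : ideal_exp I n x -> ideal_exp I (n * m) (x ^+ m).
Proof.
move=> Ix; elim: m => [|m IHm]; first by rewrite muln0.
by rewrite exprS mulnS; exact: iexpD.
Qed.

Definition frob (q : nat) J : set A := ideal_gen [set x ^+ q | x in J].

Lemma frob_ideal q J : ideal (frob q J). Proof. exact: idl_gen_ideal. Qed.

Lemma frobP q J x : J x -> frob q J (x ^+ q).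
Proof. by move=> Jx; apply: idl_gen_sub; exists x. Qed.

Lemma frob_min q J K : ideal K -> (forall x, J x -> K (x ^+ q)) -> frob q J `<=` K.
Proof. by move=> iK h; apply: idl_gen_min => // _ [x Jx <-]; exact: h. Qed.

Lemma frob_sub q J : ideal J -> (0 < q)%N -> frob q J `<=` J.
Proof.
by move=> iJ; case: q => // q _; apply: frob_min => // x Jx; rewrite exprS; exact: idlMr.
Qed.

Lemma frobS q J K : J `<=` K -> frob q J `<=` frob q K.
Proof. by move=> JK; apply: idl_genS => _ [x /JK Kx <-]; exists x. Qed.

Lemma gen_seqP (s : seq A) x :
  ideal_gen [set` s] x <-> exists c : nat -> A, x = \sum_(i < size s) c i * s`_i.
Proof.
split.
  apply: (@idl_gen_min _ [set x | exists c : nat -> A, x = \sum_(i < size s) c i * s`_i]).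
    apply: mk_ideal => /=; first by exists (fun=> 0); rewrite big1 // => i _; rewrite mul0r.
      move=> _ _ [c ->] [c' ->]; exists (fun i => c i + c' i).
      by rewrite -big_split; apply: eq_bigr => i _; rewrite mulrDl.
    move=> a _ [c ->]; exists (fun i => a * c i).
    by rewrite mulr_sumr; apply: eq_bigr => i _; rewrite mulrA.
  move=> y /= ys; exists (fun i => (i == index y s)%:R).
  have lt_i : (index y s < size s)%N by rewrite index_mem.
  rewrite (bigD1 (Ordinal lt_i)) //= eqxx mul1r nth_index // big1 ?addr0 // => i.
  by move/negPf => ni; move: ni; rewrite -val_eqE /= => ->; rewrite mul0r.
case=> c ->; apply: idl_sum => [|i _]; first exact: idl_gen_ideal.
apply: (idlM _ (idl_gen_ideal _)); apply: idl_gen_sub => /=; exact: mem_nth.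
Qed.

Lemma isaddC I J : sadd I J = sadd J I.
Proof.
suff H I' J' : sadd I' J' `<=` sadd J' I' by apply/seteqP; split; exact: H.
by move=> _ [x [y [Ix Jy ->]]]; exists y, x; rewrite addrC.
Qed.

Lemma isaddA I J K : sadd I (sadd J K) = sadd (sadd I J) K.
Proof.
apply/seteqP; split.
  move=> _ [x [_ [Ix [y [z [Jy Kz ->]]] ->]]]; exists (x + y), z; rewrite addrA; split=> //.
  by exists x, y.
move=> _ [_ [z [[x [y [Ix Jy ->]]] Kz ->]]]; exists x, (y + z); rewrite addrA; split=> //.
by exists y, z.
Qed.

Lemma isadd_l I J : ideal J -> I `<=` sadd I J.
Proof. exact: (@sadd_l A A^o). Qed.

Lemma isadd_r I J : ideal I -> J `<=` sadd I J.
Proof. exact: (@sadd_r A A^o). Qed.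

Lemma isadd_min I J K : ideal K -> I `<=` K -> J `<=` K -> sadd I J `<=` K.
Proof. exact: (@sadd_sub A A^o). Qed.

Lemma isaddS I J I' J' : I `<=` I' -> J `<=` J' -> sadd I J `<=` sadd I' J'.
Proof. exact: (@saddS A A^o). Qed.

Lemma gen_cons x (s : seq A) :
  ideal_gen [set` x :: s] = sadd (princ x) (ideal_gen [set` s]).
Proof.
have ip := ideal_princ x; have ig := @idl_gen_ideal [set` s].
apply/seteqP; split.
  apply: idl_gen_min; first exact: ideal_sadd.
  move=> y /=; rewrite inE => /orP[/eqP ->|ys].
    by apply: (isadd_l ig); exact: princ_id.
  by apply: (isadd_r ip); exact: idl_gen_sub.
apply: isadd_min; first exact: idl_gen_ideal.
  apply: princ_sub; first exact: idl_gen_ideal.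
  by apply: idl_gen_sub => /=; rewrite mem_head.
by apply: idl_genS => y /= ys; rewrite inE ys orbT.
Qed.

Lemma gen_nil : ideal_gen [set` [::] : seq A] = [set 0].
Proof.
apply/seteqP; split=> [|_ ->]; last exact: (idl0 (idl_gen_ideal _)).
apply: idl_gen_min => //; apply: mk_ideal => //= [x y -> ->|a x ->].
  by rewrite addr0.
by rewrite mulr0.
Qed.

Lemma gen_cat (s t : seq A) :
  ideal_gen [set` s ++ t] = sadd (ideal_gen [set` s]) (ideal_gen [set` t]).
Proof.
elim: s => [|x s IHs] /=; last by rewrite !gen_cons IHs isaddA.
rewrite gen_nil; apply/seteqP; split=> [x gx|_ [_ [y [-> gy ->]]]]; last by rewrite add0r.
by exists 0, x; rewrite add0r.
Qed.

End IdealBasics.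

Section Images.
Variables (A B : comNzRingType) (f : {rmorphism A -> B}).

Lemma ideal_preim (J : set B) : ideal J -> ideal (f @^-1` J).
Proof.
move=> iJ; apply: mk_ideal => /=; first by rewrite rmorph0; exact: idl0.
  by move=> x y Jx Jy; rewrite rmorphD; exact: idlD.
by move=> a x Jx; rewrite rmorphM; exact: idlM.
Qed.

Lemma iexp_preim (I : set A) (J : set B) n : (forall x, I x -> J (f x)) ->
  forall x, ideal_exp I n x -> ideal_exp J n (f x).
Proof.
move=> IJ; elim: n => [|n IHn] // x.
apply: (@imul_min _ _ _ (f @^-1` ideal_exp J n.+1)); first exact: (ideal_preim (iexp_ideal _ _)).
by move=> a b /IJ Ja /IHn Jb; rewrite /= rmorphM; exact: imulP.
Qed.

Lemma frob_preim (I : set A) (J : set B) q : (forall x, I x -> J (f x)) ->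
  forall x, frob q I x -> frob q J (f x).
Proof.
move=> IJ x; apply: (@frob_min _ _ _ (f @^-1` frob q J)).
  exact: (ideal_preim (frob_ideal _ _)).
by move=> a /IJ Ja; rewrite /= rmorphXn; exact: frobP.
Qed.

Hypothesis fsurj : forall y, exists x, f x = y.

Lemma ideal_im (I : set A) : ideal I -> ideal (f @` I).
Proof.
move=> iI; apply: mk_ideal; first by exists 0; [exact: idl0|rewrite rmorph0].
  by move=> _ _ [x Ix <-] [y Iy <-]; exists (x + y); [exact: idlD|rewrite rmorphD].
move=> b _ [x Ix <-]; have [a <-] := fsurj b.
by exists (a * x); [exact: idlM|rewrite rmorphM].
Qed.

Lemma iexp_im (I : set A) n : f @` ideal_exp I n = ideal_exp (f @` I) n.
Proof.
elim: n => [|n IHn]; first by apply/seteqP; split=> // y _; have [x <-] := fsurj y; exists x.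
apply/seteqP; split.
  by move=> _ [x + <-]; apply: iexp_preim => y Iy; exists y.
rewrite !iexpS -IHn; apply: imul_min; first by apply: ideal_im; exact: ideal_imul.
by move=> _ _ [x Ix <-] [y Iy <-]; exists (x * y); [exact: imulP|rewrite rmorphM].
Qed.

Lemma frob_im (I : set A) q : f @` frob q I = frob q (f @` I).
Proof.
apply/seteqP; split; first by move=> _ [x + <-]; apply: frob_preim => y Iy; exists y.
apply: frob_min; first by apply: ideal_im; exact: frob_ideal.
by move=> _ [x Ix <-]; exists (x ^+ q); [exact: frobP|rewrite rmorphXn].
Qed.

Lemma sadd_im (I J : set A) : f @` sadd I J = sadd (f @` I) (f @` J).
Proof.
apply/seteqP; split.
  by move=> _ [_ [x [y [Ix Jy ->]]] <-]; exists (f x), (f y); rewrite rmorphD; split.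
by move=> _ [_ [_ [[x Ix <-] [y Jy <-] ->]]]; exists (x + y); [exists x, y|rewrite rmorphD].
Qed.

End Images.

(* [s_mult] is defined by the colengths for [b = ceil (s q)] and [q = p ^ e]. *)
Definition mixpow (A : comNzRingType) (M : set A) b q := sadd (ideal_exp M b) (frob q M).

Section MixedPowers.
Variables (A : comNzRingType) (M : set A) (q : nat).

Lemma ideal_mixpow b : ideal (mixpow M b q).
Proof. exact: (ideal_sadd (iexp_ideal _ _) (frob_ideal _ _)). Qed.

Lemma iexp_mixpow b : ideal_exp M b `<=` mixpow M b q.
Proof. by apply: isadd_l; exact: frob_ideal. Qed.

Lemma frob_mixpow b : frob q M `<=` mixpow M b q.
Proof. by apply: isadd_r; exact: iexp_ideal. Qed.

Lemma mixpow_le b b' : (b <= b')%N -> mixpow M b' q `<=` mixpow M b q.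
Proof. by move=> le_b; apply: isaddS => //; exact: iexp_le. Qed.

End MixedPowers.

Section IdealLength.
Variables (A : comNzRingType).
Implicit Types (I J K : set A).

Definition ile I J n := @lenle A A^o I J n.
Definition ige I J n := @lenge A A^o I J n.
Definition col I := @len A A^o I setT.

Lemma ile_sub I J I' J' n : I' `<=` I -> J `<=` J' -> ile I' J' n -> ile I J n.
Proof. exact: (@lenle_sub A A^o). Qed.

Lemma ile_add I J K a b : ideal I -> ideal J -> ideal K -> I `<=` J -> J `<=` K ->
  ile I J a -> ile J K b -> ile I K (a + b).
Proof. exact: (@lenle_add A A^o). Qed.

Lemma ige_cat I J K a b : ideal J -> ige I J a -> ige J K b -> ige I K (a + b).
Proof. exact: (@lenge_cat A A^o). Qed.

Lemma ile_setT n : ile setT setT n.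
Proof.
apply: (@lenle_leq _ _ _ _ 0%N) => //.
case=> // m [c [cP /(_ 0%N isT)[_ []]]]; have [_ h _] := cP 0%N isT => x _; exact: h.
Qed.

Lemma col_le I n : ile I setT n -> (col I <= n)%N. Proof. exact: len_le. Qed.

Lemma col_ile I n : ideal I -> ile I setT n -> ile I setT (col I).
Proof. by move=> iI /(len_ex iI (@subsetT _ I))[]. Qed.

Lemma col_ige I n : ideal I -> ile I setT n -> ige I setT (col I).
Proof. by move=> iI /(len_ex iI (@subsetT _ I))[]. Qed.

Lemma col_ge I n m : ideal I -> ile I setT n -> ige I setT m -> (m <= col I)%N.
Proof. by move=> iI /(len_ge iI (@subsetT _ I)); exact. Qed.

Lemma col_mono I J n : ideal J -> I `<=` J -> ideal I -> ile I setT n -> (col J <= col I)%N.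
Proof.
move=> iJ IJ iI fI; apply: col_le; apply: (ile_sub IJ _ (col_ile iI fI)) => //.
Qed.

(* [X / X'] maps onto [(Y + z X) / Y]. *)
Lemma ile_mul z I J Y n : ideal I -> ideal J -> I `<=` J -> ideal Y ->
    (forall x, I x -> Y (z * x)) -> ile I J n -> ile Y (sadd Y [set z * x | x in J]) n.
Proof.
move=> iI iJ IJ iY zI; apply: (@lenle_image A A^o A^o (fun x => z * x)) => //.
by move=> a x y; rewrite mulrDr /GRing.scale /= mulrCA.
Qed.

(** Multiplication by [y ^+ j] maps [A / (I + (y))] onto the layer between [y ^+ j.+1] and [y ^+ j],
    and there are [k] layers. *)
Lemma ile_pow I y n k : ideal I -> ile (sadd I (princ y)) setT n ->
  ile (sadd I (princ (y ^+ k))) setT (k * n).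
Proof.
move=> iI fy; have ip (z : A) := ideal_princ z; have iIp z := ideal_sadd iI (ip z).
elim: k => [|k IHk].
  rewrite mul0n; apply: ile_sub (ile_setT _) => // x _.
  by exists 0, x; split; [exact: idl0|exists x; rewrite mulr1|rewrite add0r].
have sub : sadd I (princ (y ^+ k.+1)) `<=` sadd I (princ (y ^+ k)).
  by apply: isaddS => // _ [a ->]; exists (a * y); rewrite exprS mulrA.
rewrite mulSn; apply: (@ile_add _ (sadd I (princ (y ^+ k)))) => //.
apply: (@ile_sub _ _ (sadd I (princ (y ^+ k.+1)))
    (sadd (sadd I (princ (y ^+ k.+1))) [set y ^+ k * x | x in setT])) => //.
  move=> _ [x [_ [Ix [a ->] ->]]]; exists x, (a * y ^+ k); split=> //.
    by exists x, 0; rewrite addr0; split=> //; exists 0; rewrite mul0r.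
  by exists a => //; rewrite mulrC.
apply: (@ile_mul _ (sadd I (princ y))) => // _ [x [_ [Ix [a ->] ->]]].
exists (y ^+ k * x), (a * y ^+ k.+1); split; [exact: idlM|by exists a|].
by rewrite mulrDr exprS; congr (_ + _); ring.
Qed.

Lemma ile_cyclic I J x n : ideal I -> ideal J -> (forall a, J a -> I (a * x)) ->
  ile J setT n -> ile I (sadd I (princ x)) n.
Proof.
move=> iI iJ JI /(@ile_mul x _ _ I) H; apply: (ile_sub _ _ (H _ _ _ _ _)) => //.
  by move=> _ [y [_ [Iy [a ->] ->]]]; exists y, (a * x); split=> //; exists a; rewrite // mulrC.
by move=> a Ja; rewrite mulrC; exact: JI.
Qed.

Lemma ile0 I J n : J `<=` I -> ile I J n.
Proof.
move=> JI; apply: (@lenle_leq _ _ _ _ 0%N) => //.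
case=> // m [c [cP /(_ 0%N isT)[_ []]]]; have [_ h _] := cP 0%N isT.
by have [_ _ h'] := cP 1%N isT => x /h' /JI /h.
Qed.

End IdealLength.

Section LengthSurj.
Variables (A B : comNzRingType) (f : {rmorphism A -> B}).
Hypothesis fsurj : forall y, exists x, f x = y.
Variable I : set A.
Hypotheses (iI : ideal I) (kI : forall x, f x = 0 -> I x).

Lemma ige_surj n : ige I setT n <-> ige (f @` I) setT n.
Proof.
have key X x : ideal X -> I `<=` X -> (f @` X) (f x) -> X x.
  move=> iX IX [y Xy fxy]; have -> : x = y + (x - y) by ring.
  by apply: idlD => //; apply: IX; apply: kI; rewrite rmorphB fxy subrr.
split; [apply: (@lenge_transfer A B A^o B^o (fun X => f @` X))|
  apply: (@lenge_transfer B A B^o A^o (fun X => f @^-1` X))].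
- by move=> X iX IX _; split=> //; [exact: ideal_im|exact: image_subset].
- by move=> X Y _ _ _ XY _; exact: image_subset.
- move=> X Y iX iY IX XY _ h y Yy; apply: (key X) => //; apply: h; exact: imageP.
- move=> X iX IX _; split=> //; first exact: ideal_preim.
  by move=> x Ix /=; apply: IX; exact: imageP.
- by move=> X Y _ _ _ XY _ x; exact: XY.
- by move=> X Y iX iY IX XY _ h y; have [x <-] := fsurj y; exact: h.
Qed.

Lemma ile_surj n : ile I setT n <-> ile (f @` I) setT n.
Proof. by split=> h m /ige_surj; exact: h. Qed.

Lemma col_surj : col I = col (f @` I).
Proof. by congr max_nat; apply/seteqP; split=> n /ige_surj. Qed.

End LengthSurj.

(** * Noetherian local rings *)

Section Noetherian.
Variable A : comNzRingType.
Implicit Types (I J K m : set A) (ps : seq (set A)).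
Hypothesis nA : noetherian A.

Lemma noeth_asc (c : nat -> set A) : (forall n, ideal (c n)) ->
  (forall n, c n `<=` c n.+1) -> exists n, forall k, c k `<=` c n.
Proof.
move=> ic cS.
have cmono i j : (i <= j)%N -> c i `<=` c j.
  by move=> /subnK <-; elim: (j - i)%N => // k IHk; apply: subset_trans IHk (cS _).
have [|s sE] := nA (I := [set x | exists n, c n x]).
  apply: mk_ideal => /=; first by exists 0%N; exact: idl0.
    move=> x y [i cx] [j cy]; exists (maxn i j); apply: idlD => //.
      exact: (cmono _ _ (leq_maxl i j)).
    exact: (cmono _ _ (leq_maxr i j)).
  by move=> a x [i cx]; exists i; exact: idlM.
have [n sn] : exists n, [set` s] `<=` c n.
  have: [set` s] `<=` [set x | exists n, c n x].
    by rewrite sE; exact: idl_gen_sub.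
  elim: s {sE} => [|x s IHs] sub; first by exists 0%N.
  have [|n sn] := IHs; first by move=> y ys; apply: sub; rewrite /= inE ys orbT.
  have [|k xk] := sub x; first by rewrite /= mem_head.
  exists (maxn n k) => y; rewrite /= inE => /orP[/eqP ->|ys].
    exact: (cmono _ _ (leq_maxr n k)).
  by apply: (cmono _ _ (leq_maxl n k)); exact: sn.
exists n => k x cx.
have : [set x | exists n, c n x] x by exists k.
by rewrite sE; apply: idl_gen_min.
Qed.

Lemma noeth_max (P : set (set A)) I : P I -> (forall J, P J -> ideal J) ->
  exists K, P K /\ forall J, P J -> K `<=` J -> J `<=` K.
Proof.
move=> PI Pid; apply: contrapT => nex.
have next (K : {K | P K}) : exists J : {J | P J}, sval K `<=` sval J /\ ~ sval J `<=` sval K.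
  case: K => K PK /=; apply: contrapT => nJ; apply: nex; exists K; split=> // J PJ KJ.
  by apply: contrapT => JK; apply: nJ; exists (exist _ J PJ).
have [f fP] := choice next.
pose c n := sval (iter n f (exist _ I PI)).
have [||n cn] := noeth_asc (c := c).
- by move=> n; apply: Pid; exact: (svalP (iter n f _)).
- by move=> n; have [] := fP (iter n f (exist _ I PI)).
- by have [_ []] := fP (iter n f (exist _ I PI)); exact: (cn n.+1).
Qed.

(** Locality through units rather than through uniqueness of a maximal ideal: this form is inherited
    by images and makes [1 - u] invertible for [u] in [m] at once. *)
Definition loc m := [/\ ideal m, ~ m 1 & forall x, ~ m x -> exists y, x * y = 1].

(** Let [K] be maximal among the ideals above [I] not containing [J], and [x] in [J] outside [K].
    Maximality puts [J] inside [K + (x)]; the hypothesis then puts [(1 - u) x] in [K] for some [u]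
    in [m], and [1 - u] is a unit. *)
Lemma nakayama m I J : loc m -> ideal I -> ideal J -> J `<=` sadd I (imul m J) -> J `<=` I.
Proof.
move=> [im m1 mU] iI iJ JmJ; apply: contrapT => nJI.
have [||K [[iK IK nJK] maxK]] := @noeth_max [set K | [/\ ideal K, I `<=` K & ~ J `<=` K]] I.
- by split.
- by move=> K [].
have /existsNP[x /not_implyP[Jx nKx]] := nJK.
have iKx : ideal (sadd K (princ x)) := ideal_sadd iK (ideal_princ x).
have JKx : J `<=` sadd K (princ x).
  apply: contrapT => nJ; apply: nKx; apply: (maxK (sadd K (princ x))).
  - by split=> //; apply: subset_trans IK _; exact: isadd_l (ideal_princ _).
  - exact: isadd_l (ideal_princ _).
  - by apply: (isadd_r iK); exact: princ_id.
pose L := [set z | exists2 u, m u & K (z - u * x)].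
have iL : ideal L.
  apply: mk_ideal; first by exists 0; [exact: idl0|rewrite mul0r subrr; exact: idl0].
    move=> a b [u mu Ka] [v mv Kb]; exists (u + v); first exact: idlD.
    have -> : a + b - (u + v) * x = (a - u * x) + (b - v * x) by ring.
    exact: idlD.
  move=> a b [u mu Kb]; exists (a * u); first exact: idlM.
  have -> : a * b - a * u * x = a * (b - u * x) by ring.
  exact: idlM.
have mJL : imul m J `<=` L.
  apply: imul_min => // a b ma /JKx[y [_ [Ky [t ->] ->]]].
  exists (a * t); first exact: idlMr.
  have -> : a * (y + t * x) - a * t * x = a * y by ring.
  exact: idlM.
have [y [z [Iy /mJL[u mu Kz] xE]]] := JmJ _ Jx.
apply: nKx; have [|v uv] := mU (1 - u).
  by move=> m1u; apply: m1; rewrite -(subrK u 1); exact: idlD.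
have -> : x = v * (y + (z - u * x)).
  have -> : y + (z - u * x) = (1 - u) * x by rewrite addrA -xE mulrBl mul1r.
  by rewrite mulrA [v * _]mulrC uv mul1r.
apply: idlM => //; apply: idlD => //; exact: IK.
Qed.

Definition iprod ps : set A := foldr (@imul A) setT ps.

Lemma prime_iprod ps q : prime_ideal q -> iprod ps `<=` q -> exists2 p, p \in ps & p `<=` q.
Proof.
move=> [iq q1 qP]; elim: ps => [|p ps IHps] /= sub; first by case: q1; exact: sub.
have [pq|/existsNP[x /not_implyP[px nqx]]] := pselect (p `<=` q).
  by exists p => //; rewrite mem_head.
have [|q' q'ps q'q] := IHps; last by exists q' => //; rewrite inE q'ps orbT.
by move=> y psy; have /qP[] : q (x * y) by apply: sub; exact: imulP.
Qed.

Lemma iprod_cat ps1 ps2 I : ideal I ->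
  (forall x y, iprod ps1 x -> iprod ps2 y -> I (x * y)) -> iprod (ps1 ++ ps2) `<=` I.
Proof.
elim: ps1 I => [|p ps1 IHps] I iI H /=.
  by move=> y py; rewrite -(mul1r y); exact: H.
apply: imul_min => // x y px; move: y; apply: (IHps [set y | I (x * y)]).
  apply: mk_ideal => /=; first by rewrite mulr0; exact: idl0.
    by move=> a b Ia Ib; rewrite mulrDr; exact: idlD.
  by move=> a b Ib; rewrite mulrCA; exact: idlM.
by move=> y z ry rz; rewrite /= mulrA; apply: H => //; exact: imulP.
Qed.

(** Noetherian induction: a maximal counterexample [K] is not prime, and products of primes inside
    [K + (x)] and [K + (y)], with [x y] in [K], multiply into [K]. The list stands in for the
    minimal primes of [I]. *)
Lemma prime_cover I : ideal I ->
  exists2 ps, iprod ps `<=` I & forall p, p \in ps -> prime_ideal p /\ I `<=` p.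
Proof.
move=> iI; apply: contrapT => nI.
pose ok I := exists2 ps, iprod ps `<=` I & forall p, p \in ps -> prime_ideal p /\ I `<=` p.
have [||K [[iK nK] maxK]] := @noeth_max [set K | ideal K /\ ~ ok K] I.
- by split.
- by move=> K [].
have nK1 : ~ K 1.
  by move=> K1; apply: nK; exists [::] => //=; rewrite (idl1 iK K1).
apply: nK; have [pK|npK] := pselect (prime_ideal K).
  by exists [:: K] => [|p]; [exact: (@imul_subl _ K setT)|rewrite inE => /eqP ->; split].
have [x [y [Kxy nKx nKy]]] : exists x y, [/\ K (x * y), ~ K x & ~ K y].
  apply: contrapT => nxy; apply: npK; split=> // x y Kxy.
  by have [|nx] := pselect (K x); [left|right; apply: contrapT => ny; apply: nxy; exists x, y].
have big z : ~ K z -> ok (sadd K (princ z)).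
  move=> nKz; apply: contrapT => nok; apply: nKz; apply: (maxK (sadd K (princ z))).
  - by split=> //; exact: ideal_sadd (ideal_princ _).
  - exact: isadd_l (ideal_princ _).
  - by apply: (isadd_r iK); exact: princ_id.
have [ps1 sub1 ps1P] := big _ nKx; have [ps2 sub2 ps2P] := big _ nKy.
exists (ps1 ++ ps2) => [|p]; last first.
  rewrite mem_cat => /orP[/ps1P|/ps2P] [pp Kp]; split=> //.
    by apply: subset_trans Kp; exact: isadd_l (ideal_princ _).
  by apply: subset_trans Kp; exact: isadd_l (ideal_princ _).
apply: iprod_cat => // a b /sub1[u [_ [Ku [s ->] ->]]] /sub2[v [_ [Kv [t ->] ->]]].
have -> : (u + s * x) * (v + t * y) = (v + t * y) * u + (s * x * v + s * t * (x * y)) by ring.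
by apply: idlD => //; [|apply: idlD => //]; exact: idlM.
Qed.

(** When the current [y] falls into [p], it is corrected by some [w] in [J] that lies outside [p]
    and inside every listed prime not contained in [p]. Taking [w] in [J] keeps [y + w] outside [J].
    Listed primes contained in [p] are avoided together with [p]. *)
Lemma prime_avoid m J ps : ideal m -> ideal J -> J `<=` m -> ~ m `<=` J ->
  (forall p, p \in ps -> prime_ideal p /\ ~ J `<=` p) ->
  exists y, [/\ m y, ~ J y & forall p, p \in ps -> ~ p y].
Proof.
move=> im iJ Jm mJ; elim: ps => [|p ps IHps] psP.
  by have /existsNP[x /not_implyP[? ?]] := mJ; exists x.
have [|y [my nJy yps]] := IHps; first by move=> q qps; apply: psP; rewrite inE qps orbT.
have [[ip p1 pP] nJp] := psP p (mem_head _ _).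
have [py|npy] := pselect (p y); last first.
  by exists y; split=> // q; rewrite inE => /orP[/eqP ->|/yps].
have [w [Jw npw wP]] : exists w, [/\ J w, ~ p w &
    forall q, q \in ps -> ~ q `<=` p -> q w].
  elim: ps {IHps yps} psP => [|q ps IHps] psP.
    by have /existsNP[x /not_implyP[? ?]] := nJp; exists x.
  have [|w [Jw npw wP]] := IHps.
    by move=> q'; rewrite inE => /orP[/eqP ->|h]; apply: psP; rewrite !inE ?eqxx ?h ?orbT.
  have [[iq _ _] _] : prime_ideal q /\ ~ J `<=` q by apply: psP; rewrite !inE eqxx orbT.
  have [qp|/existsNP[x /not_implyP[qx npx]]] := pselect (q `<=` p).
    by exists w; split=> // q'; rewrite inE => /orP[/eqP ->|/wP].
  exists (x * w); split=> [||q']; [exact: idlM|by case/pP|].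
  rewrite inE => /orP[/eqP -> _|q'ps nq']; first exact: idlMr.
  have [[iq' _ _] _] : prime_ideal q' /\ ~ J `<=` q' by apply: psP; rewrite !inE q'ps !orbT.
  by apply: idlM => //; exact: wP.
exists (y + w); split.
- by apply: idlD => //; exact: Jm.
- by move=> Jyw; apply: nJy; rewrite -(addrK w y); exact: idlB.
have npyw : ~ p (y + w) by move=> h; apply: npw; rewrite -(addKr y w) addrC; exact: idlB.
move=> q; rewrite inE => /orP[/eqP -> //|qps] qyw.
have [[iq _ _] _] : prime_ideal q /\ ~ J `<=` q by apply: psP; rewrite inE qps orbT.
have [qp|nqp] := pselect (q `<=` p); first exact/npyw/qp.
by apply: (yps _ qps); rewrite -(addrK w y); apply: idlB => //; exact: wP.
Qed.

(** * Chains of primes and systems of parameters *)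

Definition pchain I l := exists c : nat -> set A,
  (forall i, (i <= l)%N -> prime_ideal (c i) /\ I `<=` c i) /\
  (forall i, (i < l)%N -> c i `<` c i.+1).

Lemma pchain_sub I J l : I `<=` J -> pchain J l -> pchain I l.
Proof.
move=> IJ [c [cP cS]]; exists c; split=> // i /cP[pc Jc].
by split=> //; exact: subset_trans Jc.
Qed.

Lemma pchain_cons I p l c : prime_ideal p -> I `<=` p ->
  (forall i, (i <= l)%N -> prime_ideal (c i) /\ I `<=` c i) ->
  (forall i, (i < l)%N -> c i `<` c i.+1) -> p `<` c 0%N -> pchain I l.+1.
Proof.
move=> pp Ip cP cS pc; exists (fun i => if i is j.+1 then c j else p).
by split=> [[|i]//|[|i]//]; rewrite ltnS; [exact: cP|exact: cS].
Qed.

Section Local.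
Variable m : set A.
Hypothesis lm : loc m.

Lemma loc_sub I : ideal I -> ~ I 1 -> I `<=` m.
Proof.
move=> iI I1 x Ix; have [_ _ mU] := lm; apply: contrapT => /mU[y xy].
by apply: I1; rewrite -xy; exact: idlMr.
Qed.

Lemma loc_prime : prime_ideal m.
Proof.
have [im m1 mU] := lm; split=> // x y mxy.
have [|nx] := pselect (m x); [by left|right].
have [z xz] := mU _ nx; have -> : y = z * (x * y) by rewrite mulrA [z * x]mulrC xz mul1r.
exact: idlM.
Qed.

Lemma prime_sq p : prime_ideal p -> ideal_exp m 2 `<=` p -> m `<=` p.
Proof.
move=> [ip p1 pP] sub x mx; have /sub : ideal_exp m 2 (x * x).
  by rewrite -expr2; exact: iexpX.
by case/pP.
Qed.

Lemma iprod_eq_m ps : (forall p, p \in ps -> p = m) -> iprod ps = ideal_exp m (size ps).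
Proof.
elim: ps => [|p ps IHps] // psm; rewrite /= (psm p) ?mem_head // IHps //.
by move=> q qps; apply: psm; rewrite inE qps orbT.
Qed.

Lemma only_prime_m I ps : iprod ps `<=` I -> (forall p, p \in ps -> prime_ideal p) ->
  (forall p, p \in ps -> m `<=` p) -> exists r, ideal_exp m r `<=` I.
Proof.
move=> sub pps mps; exists (size ps); rewrite -iprod_eq_m // => p h.
by apply/seteqP; split; [have [? ? _] := pps _ h; exact: loc_sub|exact: mps].
Qed.

(** A system of parameters for [A / I]. Each [y] avoids the primes of a cover of [I] other than [m],
    so a chain above [I + (y)] can be lengthened below by one of them. Prime avoidance is used with
    [J = m^2] because a prime containing [m^2] contains [m]. *)
Lemma params I h : ideal I -> (forall l, pchain I l -> (l <= h)%N) ->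
  exists ys : seq A, [/\ size ys = h, (forall y, y \in ys -> m y) &
    exists r, ideal_exp m r `<=` sadd I (ideal_gen [set` ys])].
Proof.
have [im m1 mU] := lm.
elim: h I => [|h IHh] I iI le.
  exists [::]; split=> //; have [ps sub psP] := prime_cover iI.
  have pps p : p \in ps -> prime_ideal p by case/psP.
  have mps p : p \in ps -> m `<=` p.
    move=> /psP[pp Ip]; apply: contrapT => nmp.
    have /le // : pchain I 1.
    have [ip p1 _] := pp; have pm := loc_sub ip p1.
    exists (fun i => if i is 0%N then p else m); split=> [[|[|i]]|[|i]] // _.
    by split; [exact: loc_prime|exact: subset_trans pm].
  have [r rI] := only_prime_m sub pps mps.
  by exists r; apply: subset_trans rI _; exact: isadd_l (idl_gen_ideal _).
(* If [m] equals its square, it vanishes by Nakayama and zeros serve as parameters. *)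
have [mm2|nmm2] := pselect (m `<=` ideal_exp m 2).
  exists (nseq h.+1 0); split; first by rewrite size_nseq.
    by move=> y /nseqP[-> _]; exact: idl0.
  exists 1%N; rewrite iexp1 // => x mx; suff -> : x = 0 by exact: idl0 (ideal_sadd iI (idl_gen_ideal _)).
  have i0 : ideal [set (0 : A)] by rewrite -gen_nil; exact: idl_gen_ideal.
  apply: (nakayama lm i0 im _ mx); apply: subset_trans mm2 _.
  by rewrite iexpS iexp1 //; exact: isadd_r.
have [ps sub psP] := prime_cover iI.
have [|p|y [my nm2y yps]] := @prime_avoid m (ideal_exp m 2) [seq p <- ps | `[< ~ m `<=` p >]] im
    (iexp_ideal _ _) _ nmm2.
- exact: iexp_sub.
- rewrite mem_filter => /andP[/asboolP nmp /psP[pp _]].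
  by split=> // sq; apply: nmp; exact: prime_sq.
have iIy := ideal_sadd iI (ideal_princ y).
have [|ys [sz ysm [r rI]]] := IHh (sadd I (princ y)) iIy.
  move=> l [c [cP cS]]; have [[ic c1 cpr] Ic] := cP 0%N isT.
  have [|p pps pc] := prime_iprod (And3 ic c1 cpr) (ps := ps).
    by apply: subset_trans sub _; apply: subset_trans Ic; exact: isadd_l (ideal_princ _).
  have [pp Ip] := psP _ pps.
  have [mp|nmp] := pselect (m `<=` p).
    case: l cP cS => // l cP cS; have [_ nc] := cS 0%N isT.
    case: nc; have [[ic1 c11 _] _] := cP 1%N isT.
    by apply: subset_trans (loc_sub ic1 c11) _; exact: subset_trans pc.
  have : pchain I l.+1.
    apply: (@pchain_cons _ p _ c) => //.
      move=> i /cP[? h']; split=> //; apply: subset_trans h'; exact: isadd_l (ideal_princ _).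
    split=> // cp; have : p y by apply/cp/Ic/(isadd_r iI)/princ_id.
    by apply: yps; rewrite mem_filter pps andbT; exact/asboolP.
  by move/le.
exists (y :: ys); split; first by rewrite /= sz.
  by move=> z; rewrite inE => /orP[/eqP ->|/ysm].
by exists r; rewrite gen_cons isaddA.
Qed.

End Local.
End Noetherian.

Lemma noeth_local_loc (A : comNzRingType) : noeth_local A -> noetherian A /\ loc (max_ideal A).
Proof.
case=> nA [m [mm mu]]; split=> //.
have -> : max_ideal A = m by rewrite /max_ideal; case: xgetP => [x _ /mu //|/(_ m)].
have [im m1 _] := mm; split=> // x nmx; apply: contrapT => nu.
have [||K [[iK xK K1] maxK]] := @noeth_max _ nA
    [set K | [/\ ideal K, princ x `<=` K & ~ K 1]] (princ x).
- split=> //; first exact: ideal_princ.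
  by case=> y e; apply: nu; exists y; rewrite mulrC -e.
- by move=> K [].
have maxiK : maximal_ideal K.
  split=> // J iJ J1 KJ; apply/seteqP; split=> //; apply: maxK => //.
  by split=> //; exact: subset_trans KJ.
by apply: nmx; rewrite (mu _ maxiK); apply: xK; exact: princ_id.
Qed.

(** * Artin-Rees and growth of colengths *)

Lemma hilbert_basis (A : comNzRingType) : noetherian A -> noetherian {poly A}.
Proof.
move=> nA J iJ.
pose L n := [set a | exists f : {poly A}, [/\ J f, (size f <= n.+1)%N & f`_n = a]].
have iL n : ideal (L n).
  apply: mk_ideal; first by exists 0; rewrite size_poly0 coef0; split=> //; exact: idl0.
    move=> _ _ [f [Jf sf <-]] [g [Jg sg <-]]; exists (f + g); rewrite coefD; split=> //.
      exact: idlD.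
    by apply: leq_trans (size_polyD _ _) _; rewrite geq_max sf.
  move=> a _ [f [Jf sf <-]]; exists (a%:P * f); rewrite coefCM; split=> //; first exact: idlM.
  by rewrite mul_polyC; apply: leq_trans (size_scale_leq _ _) sf.
have LS n : L n `<=` L n.+1.
  move=> _ [f [Jf sf <-]]; exists (f * 'X); rewrite coefMX; split=> //; first exact: idlMr.
  by apply: leq_trans (size_polyMleq _ _) _; rewrite size_polyX addn2.
have [n0 Ln0] := noeth_asc nA iL LS.
have [G [GJ GL]] : exists G : seq {poly A}, [set` G] `<=` J /\
    forall n a, (n < n0.+1)%N -> L n a ->
    exists g, [/\ ideal_gen [set` G] g, (size g <= n.+1)%N & g`_n = a].
  elim: n0.+1 => [|k [G [GJ GL]]]; first by exists [::]; split.
  have [s sE] := nA _ (iL k).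
  have [t tP] : exists t : A -> {poly A}, forall a, L k a ->
      [/\ J (t a), (size (t a) <= k.+1)%N & (t a)`_k = a].
    have H a : exists f, L k a -> [/\ J f, (size f <= k.+1)%N & f`_k = a].
      by have [[f fP]|nL] := pselect (L k a); [exists f|exists 0].
    by have [t tP] := choice H; exists t.
  exists (map t s ++ G); split.
    move=> f; rewrite /= mem_cat => /orP[/mapP[a as_ ->]|/GJ //].
    by have [] // := tP a; rewrite sE; exact: idl_gen_sub.
  move=> n a; rewrite ltnS leq_eqVlt => /predU1P[->|lt_n] La.
    move: La; rewrite sE => /gen_seqP[c ->].
    exists (\sum_(i < size s) (c i)%:P * t s`_i).
    have Ls (i : 'I_(size s)) : L k s`_i by rewrite sE; apply: idl_gen_sub => /=; exact: mem_nth.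
    split.
    - apply: idl_sum => [|i _]; first exact: idl_gen_ideal.
      apply: (idlM _ (idl_gen_ideal _)); apply: idl_gen_sub.
      by rewrite /= mem_cat map_f // mem_nth.
    - apply: leq_trans (size_sum _ _ _) _; apply/bigmax_leqP => i _.
      rewrite mul_polyC; apply: leq_trans (size_scale_leq _ _) _.
      by have [] := tP _ (Ls i).
    - rewrite coef_sum; apply: eq_bigr => i _; rewrite coefCM.
      by have [_ _ ->] := tP _ (Ls i).
  have [g [Gg sg ga]] := GL _ _ lt_n La; exists g; split=> //.
  by apply: (idl_genS _ Gg) => f /= fG; rewrite mem_cat fG orbT.
exists G; apply/seteqP; split; last exact: idl_gen_min.
suff H k (f : {poly A}) : (size f <= k)%N -> J f -> ideal_gen [set` G] f by move=> f Jf; exact: (H (size f)).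
elim: k f => [|k IHk] f sf Jf.
  by move: sf; rewrite leqn0 size_poly_eq0 => /eqP ->; exact: (idl0 (idl_gen_ideal _)).
have [g [Gg sg gk]] : exists g, [/\ ideal_gen [set` G] g, (size g <= k.+1)%N & g`_k = f`_k].
  have Lk : L k f`_k by exists f.
  have [le_k|lt_k] := leqP k n0; first exact: GL.
  have [g [Gg sg gE]] := GL n0 f`_k (leqnn _) (Ln0 _ _ Lk).
  exists (g * 'X^(k - n0)); split; first exact: (idlMr _ (idl_gen_ideal _)).
    apply: leq_trans (size_polyMleq _ _) _; rewrite size_polyXn addnS /=.
    by apply: leq_trans (leq_add sg (leqnn _)) _; lia.
  by rewrite coefMXn ltnNge leq_subr /= subKn // ltnW.
rewrite -(subrK g f); apply: (idlD (idl_gen_ideal _)) => //.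
apply: IHk; last by apply: idlB => //; exact: (idl_gen_min iJ GJ).
apply/leq_sizeP => j; rewrite leq_eqVlt => /predU1P[<-|lt_kj].
  by rewrite coefB gk subrr.
by rewrite coefB !nth_default ?subrr //; [exact: leq_trans sg _|exact: leq_trans sf _].
Qed.

Section IteratedPolynomials.
Variable A : comNzRingType.

(** Variables are adjoined one at a time: Noetherianity, evaluation and the facts on Cartier
    operators then go by induction on [n] from statements about [{poly A}]. *)
Fixpoint ipoly n : comNzRingType := if n is n'.+1 then {poly (ipoly n')} else A.

Fixpoint ipC n : {rmorphism A -> ipoly n} :=
  if n is n'.+1 then GRing.RMorphism.clone _ _ (@polyC (ipoly n') \o ipC n') _
  else GRing.RMorphism.clone _ _ idfun _.

Fixpoint ivars n : seq (ipoly n) :=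
  if n is n'.+1 then ('X : {poly (ipoly n')}) :: map polyC (ivars n') else [::].

Lemma size_ivars n : size (ivars n) = n.
Proof. by elim: n => [|n IHn] //=; rewrite size_map IHn. Qed.

Lemma noetherian_ipoly n : noetherian A -> noetherian (ipoly n).
Proof. by move=> nA; elim: n => [|n IHn] //; exact: hilbert_basis. Qed.

Lemma ipoly_eval (B : comNzRingType) (phi : {rmorphism A -> B}) (z : nat -> B) n :
  exists f : {rmorphism ipoly n -> B},
    (forall a, f (ipC n a) = phi a) /\ forall i, (i < n)%N -> f (ivars n)`_i = z i.
Proof.
elim: n z => [|n IHn] z; first by exists phi.
have [f [fC fX]] := IHn (fun i => z i.+1).
have cfz : commr_rmorph f (z 0%N) by move=> x; exact: mulrC.
exists (GRing.RMorphism.clone _ _ (horner_morph cfz) _); split=> [a|[|i]] /=.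
- by rewrite horner_morphC fC.
- by rewrite horner_morphX.
- by rewrite ltnS => lt_in; rewrite (nth_map 0) ?size_ivars // horner_morphC fX.
Qed.

Lemma ipoly_ind n (K : set (ipoly n)) :
  (forall a, K (ipC n a)) -> (forall i, (i < n)%N -> K (ivars n)`_i) ->
  (forall x y, K x -> K y -> K (x + y)) -> (forall x y, K x -> K y -> K (x * y)) ->
  forall x, K x.
Proof.
elim: n K => [|n IHn] K KC KX KD KM x; first exact: (KC x).
have KP c : K c%:P.
  apply: (IHn [set c | K c%:P]) => [a|i lt_in|c1 c2|c1 c2] /=; first exact: (KC a).
  - by have := KX i.+1 lt_in; rewrite /= (nth_map 0) ?size_ivars.
  - by rewrite rmorphD; exact: KD.
  - by rewrite rmorphM; exact: KM.
elim/poly_ind: x => [|p c Kp]; first by rewrite -[0]/((0 : ipoly n)%:P).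
by apply: KD => //; apply: KM => //; exact: (KX 0%N).
Qed.

End IteratedPolynomials.

Lemma ile_pows (A : comNzRingType) (I : set A) (s : seq A) N n : ideal I ->
  ile (sadd I (ideal_gen [set` s])) setT n ->
  ile (sadd I (ideal_gen [set` [seq x ^+ N | x <- s]])) setT (N ^ size s * n).
Proof.
elim: s I n => [|x s IHs] I n iI; first by rewrite mul1n.
rewrite gen_cons isaddA => h.
have iIx := ideal_sadd iI (ideal_princ x).
have {}h := IHs _ _ iIx h.
rewrite /= gen_cons [sadd (princ _) _]isaddC isaddA expnS -mulnA.
apply: ile_pow; first by apply: ideal_sadd => //; exact: idl_gen_ideal.
by rewrite -isaddA [sadd (ideal_gen _) _]isaddC isaddA.
Qed.

Section ArtinRees.
Variables (A : comNzRingType) (m : set A).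
Hypotheses (nA : noetherian A) (im : ideal m).

(* The Rees algebra is Noetherian, as the image of [z_i |-> z_i 'X]. *)
Lemma artin_rees (I : set A) : ideal I -> exists c, forall N, (c <= N)%N ->
  forall a, I a -> ideal_exp m N a -> imul (ideal_exp m (N - c)) I a.
Proof.
move=> iI; have [z mE] := nA im; pose n := size z.
have [phi [phiC phiX]] := @ipoly_eval A {poly A} (@polyC A) (fun i => z`_i *: 'X) n.
have degP P i : ideal_exp m i (phi P)`_i.
  move: P i; apply: (@ipoly_ind _ _ [set P | forall i, ideal_exp m i (phi P)`_i]) => /=.
  - by move=> a [|i] //; rewrite phiC coefC; exact: (idl0 (iexp_ideal _ _)).
  - move=> j lt_jn i; rewrite phiX // coefZ coefX.
    have [->|_] := eqVneq i 1%N; last by rewrite mulr0; exact: (idl0 (iexp_ideal _ _)).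
    by rewrite mulr1 iexp1 // mE; apply: idl_gen_sub; exact: mem_nth.
  - by move=> P Q HP HQ i; rewrite rmorphD coefD; exact: (idlD (iexp_ideal _ _) (HP i) (HQ i)).
  - move=> P Q HP HQ i; rewrite rmorphM coefM; apply: idl_sum => [|j _]; first exact: iexp_ideal.
    by rewrite -{1}(subnKC (ltn_ord j : (j <= i)%N)); exact: iexpD.
have repr N a : ideal_exp m N a -> exists P, phi P = a%:P * 'X^N.
  have iR k : ideal [set a | exists P, phi P = a%:P * 'X^k].
    apply: mk_ideal => /=; first by exists 0; rewrite rmorph0 mul0r.
      by move=> x y [P PE] [Q QE]; exists (P + Q); rewrite rmorphD PE QE rmorphD mulrDl.
    by move=> b x [P PE]; exists (ipC A n b * P); rewrite rmorphM phiC PE mulrA -rmorphM.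
  elim: N a => [|N IHN] a; first by exists (ipC A n a); rewrite phiC expr0 mulr1.
  apply: (imul_min (iR N.+1)) => x y mx /IHN[Q QE] /=.
  have [P PE] : exists P, phi P = x%:P * 'X^1.
    move: mx; rewrite mE; apply: (idl_gen_min (iR 1%N)) => w /= wz.
    have lt_w : (index w z < n)%N by rewrite index_mem.
    by exists (ivars A n)`_(index w z); rewrite phiX // nth_index // mul_polyC.
  by exists (P * Q); rewrite rmorphM PE QE mulrACA -rmorphM -exprD.
(* The preimage of the polynomials with coefficients in [I]; its finitely many generators determine
   the constant. *)
pose J := [set P | forall i, I (phi P)`_i].
have iJ : ideal J.
  apply: mk_ideal; first by move=> i; rewrite rmorph0 coef0; exact: idl0.
    by move=> P Q HP HQ i; rewrite rmorphD coefD; exact: idlD.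
  move=> P Q HQ i; rewrite rmorphM coefM; apply: idl_sum => // j _; exact: idlM.
have [G GE] := noetherian_ipoly (n := n) nA iJ.
(* A nonzero [i]-th coefficient of the image of a generator has [i < c]. In degree [N] it is
   multiplied by a coefficient lying in [m^(N - i)], hence in [m^(N - c)]. *)
exists (\max_(g <- G) size (phi g)) => N le_cN a Ia /repr[P PE].
set c := \max_(g <- G) _ in le_cN *.
have : J P.
  by move=> i; rewrite PE coefCM coefXn; case: eqP; rewrite ?mulr1 // mulr0 => _; exact: idl0.
rewrite GE => /gen_seqP[h Ph].
have -> : a = \sum_(l < size G) \sum_(i < N.+1) (phi (h l))`_(N - i) * (phi G`_l)`_i.
  transitivity (phi P)`_N; first by rewrite PE coefCM coefXn eqxx mulr1.
  rewrite Ph rmorph_sum coef_sum; apply: eq_bigr => l _.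
  by rewrite rmorphM coefMr.
apply: idl_sum => [|l _]; first exact: ideal_imul.
apply: idl_sum => [|i _]; first exact: ideal_imul.
have Gl : G`_l \in G by exact: mem_nth.
have [le_i|lt_i] := leqP (size (phi G`_l)) i.
  by rewrite [X in _ * X]nth_default // mulr0; exact: (idl0 (ideal_imul _ _)).
apply: imulP.
  apply: (@iexp_le _ _ (N - c) (N - i)); last exact: degP.
  apply: leq_sub2l; apply: ltnW; apply: leq_trans lt_i _.
  by rewrite /c (big_rem G`_l) //= leq_maxl.
have : J G`_l by rewrite GE; exact: idl_gen_sub.
exact.
Qed.

(** Artin-Rees for [I + (x)]: if [a x = i + w] with [w] in [m^N], then [w - u x] is in [I] for some
    [u] in [m^(N - c)], whence [a - u] is in [I]. Each division by [x] costs [c]. *)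
Lemma colon_nzd (I : set A) x : ideal I -> (forall a, I (a * x) -> I a) ->
  exists c, forall j N a, sadd I (ideal_exp m N) (a * x ^+ j) ->
    sadd I (ideal_exp m (N - c * j)) a.
Proof.
move=> iI nzd; have iIx := ideal_sadd iI (ideal_princ x).
have [c cP] := artin_rees iIx; exists c.
have step N a : sadd I (ideal_exp m N) (a * x) -> sadd I (ideal_exp m (N - c)) a.
  have [lt_Nc _|le_cN [i [w [Ii mw axE]]]] := ltnP N c.
    have -> : (N - c = 0)%N by lia.
    by exists 0, a; rewrite add0r; split=> //; exact: idl0.
  have : imul (ideal_exp m (N - c)) (sadd I (princ x)) w.
    apply: cP => //; exists (- i), (a * x); rewrite axE addKr; split=> //; first exact: idlN.
    by exists a.
  have : imul (ideal_exp m (N - c)) (sadd I (princ x)) `<=`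
      [set w | exists2 u, ideal_exp m (N - c) u & I (w - u * x)].
    have ie := iexp_ideal m (N - c); apply: imul_min; first apply: mk_ideal => /=.
    - by exists 0; [exact: idl0|rewrite mul0r subrr; exact: idl0].
    - move=> y z [u mu Iu] [v mv Iv]; exists (u + v); first exact: idlD.
      have -> : y + z - (u + v) * x = (y - u * x) + (z - v * x) by ring.
      exact: idlD.
    - move=> b y [u mu Iu]; exists (b * u); first exact: idlM.
      have -> : b * y - b * u * x = b * (y - u * x) by ring.
      exact: idlM.
    move=> u _ mu [y [_ [Iy [t ->] ->]]]; exists (u * t); first exact: idlMr.
    have -> : u * (y + t * x) - u * t * x = u * y by ring.
    exact: idlM.
  move=> /[apply] -[u mu Iu]; exists (a - u), u; rewrite subrK; split=> //.
  apply: nzd; have -> : (a - u) * x = i + (w - u * x) by rewrite mulrBl axE addrA.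
  exact: idlD.
elim=> [|j IHj] N a; first by rewrite expr0 mulr1 muln0 subn0.
by rewrite exprSr mulrA => /step/IHj; rewrite -subnDA mulnS.
Qed.

End ArtinRees.

(** * Dimension from the growth of colengths *)

Section Growth.
Variables (A : comNzRingType) (m : set A).
Hypotheses (nA : noetherian A) (lm : loc m).
Implicit Types I J : set A.

Let im : ideal m. Proof. by case: lm. Qed.

Lemma ile_m : ile m setT 1.
Proof.
have [_ m1 mU] := lm; case=> [|[|n]] // [c [cP cS]].
have [ic mc _] := cP 1%N isT; have [ic0 mc0 _] := cP 0%N isT.
have [_ nc1] := cS 1%N isT; have [_ nc0] := cS 0%N isT.
have /existsNP[x /not_implyP[cx ncx]] := nc0.
have [|y xy] := mU x; first by move=> /mc0.
by case: nc1 => z _; rewrite -(mulr1 z) -xy mulrCA; exact: idlMr.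
Qed.

Lemma ile_iexp N : exists n, ile (ideal_exp m N) setT n.
Proof.
have [z mE] := nA im; exists (N ^ size z * 1)%N.
have i0 : ideal [set (0 : A)] by rewrite -gen_nil; exact: idl_gen_ideal.
apply: (@ile_sub _ _ _ (sadd [set 0] (ideal_gen [set` [seq x ^+ N | x <- z]])) setT) => //.
  apply: isadd_min; [exact: iexp_ideal|by move=> _ ->; exact: (idl0 (iexp_ideal _ _))|].
  apply: idl_gen_min; first exact: iexp_ideal.
  by move=> _ /= /mapP[x xz ->]; apply: iexpX; rewrite mE; exact: idl_gen_sub.
apply: ile_pows => //; apply: ile_sub ile_m => //.
by rewrite -mE; exact: isadd_r.
Qed.

Lemma ile_sadd_iexp I N : ideal I -> exists n, ile (sadd I (ideal_exp m N)) setT n.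
Proof.
by move=> iI; have [n h] := ile_iexp N; exists n; apply: ile_sub h => //; exact: isadd_r.
Qed.

Lemma mul_set_ideal I x : ideal I -> ideal [set x * b | b in I].
Proof.
move=> iI; apply: mk_ideal; first by exists 0; [exact: idl0|rewrite mulr0].
  by move=> _ _ [a Ia <-] [b Ib <-]; exists (a + b); [exact: idlD|rewrite mulrDr].
by move=> a _ [b Ib <-]; exists (a * b); [exact: idlM|rewrite mulrCA].
Qed.

(* The colon condition says that [x] embeds [A / J] into [A / I]. *)
Lemma ige_colon I J x n : ideal I -> (forall a, I (a * x) -> J a) ->
  ige J setT n -> ige I (sadd I (princ x)) n.
Proof.
move=> iI IJ; apply: (@lenge_transfer A A A^o A^o (fun X => sadd I [set x * b | b in X])).
- move=> X iX JX _; have imx := mul_set_ideal x iX; split.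
  + exact: ideal_sadd.
  + exact: isadd_l.
  + by apply: isaddS => // _ [b _ <-]; exists b; rewrite mulrC.
- move=> X Y _ _ _ XY _; apply: isaddS => // _ [b Xb <-]; exists b => //; exact: XY.
- move=> X Y iX iY JX XY _ h y Yy.
  have [|i [_ [Ii [b Xb <-] yE]]] := h (x * y); first by apply: (isadd_r iI); exists y.
  rewrite -(subrK b y); apply: idlD => //; apply: JX; apply: IJ.
  by rewrite mulrBl mulrC yE [b * x]mulrC addrK.
Qed.

(* The length of [A / (I + m ^ N)] is [O (N ^ (h - c))]. *)
Definition growth I c h := exists C, forall N,
  (col (sadd I (ideal_exp m N)) * N ^ c <= C * N ^ h)%N.

Lemma growth_sub I J c h : ideal I -> ideal J -> I `<=` J -> growth I c h -> growth J c h.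
Proof.
move=> iI iJ IJ [C CP]; exists C => N; apply: leq_trans (CP N); rewrite leq_mul2r; apply/orP; right.
have [n fin] := ile_sadd_iexp N iI; apply: col_mono fin.
- exact: (ideal_sadd _ (iexp_ideal _ _)).
- exact: isaddS.
- exact: (ideal_sadd _ (iexp_ideal _ _)).
Qed.

(** In [A / (I + m^N)] with [N = (k+1) M], the layers between [x^j] and [x^(j+1)], [j < M], are each
    at least as long as [A / (I + (x) + m^M)], because dividing by [x^j] lowers the exponent by
    [k j <= k M]. The [M] layers give the additional factor [M]. *)
Lemma growth_drop I x c h : ideal I -> (forall a, I (a * x) -> I a) ->
  growth I c h -> growth (sadd I (princ x)) c.+1 h.
Proof.
move=> iI nzd [C CP]; have [k kP] := colon_nzd nA im iI nzd.
exists (C * k.+1 ^ h)%N => M.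
set J := sadd (sadd I (princ x)) (ideal_exp m M).
suff H : (M * col J <= col (sadd I (ideal_exp m (k.+1 * M))))%N.
  have -> : (C * k.+1 ^ h * M ^ h = C * (k.+1 * M) ^ h)%N by rewrite expnMn mulnA.
  rewrite expnS mulnA [(col J * M)%N]mulnC.
  apply: leq_trans (leq_mul H (leqnn _)) _.
  apply: leq_trans (CP _); rewrite leq_mul2l; apply/orP; right.
  by rewrite expnMn leq_pmull // expn_gt0.
set N := (k.+1 * M)%N.
have iY j : ideal (sadd (sadd I (ideal_exp m N)) (princ (x ^+ j))).
  by apply: (ideal_sadd _ (ideal_princ _)); exact: (ideal_sadd _ (iexp_ideal _ _)).
have iIN : ideal (sadd I (ideal_exp m N)) := ideal_sadd iI (iexp_ideal _ _).
have iJ : ideal J := ideal_sadd (ideal_sadd iI (ideal_princ _)) (iexp_ideal _ _).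
have [n finN] := ile_sadd_iexp N iI; apply: (col_ge iIN finN).
have [n' finJ] := ile_sadd_iexp M (ideal_sadd iI (ideal_princ x)).
suff : ige (sadd (sadd I (ideal_exp m N)) (princ (x ^+ M))) setT (M * col J).
  by apply: lenge_sub => //; exact: (isadd_l (ideal_princ _)).
have: (M <= M)%N by []; elim: {-2}M => [|j IHj] le_jM.
  by rewrite mul0n; exact: (@lenge0 A A^o _ _ (iY 0%N) (@subsetT _ _)).
rewrite mulSn; apply: (@ige_cat _ _ (sadd (sadd I (ideal_exp m N)) (princ (x ^+ j)))) => //.
  apply: (@lenge_sub A A^o (sadd (sadd I (ideal_exp m N)) (princ (x ^+ j.+1)))
    (sadd (sadd (sadd I (ideal_exp m N)) (princ (x ^+ j.+1))) (princ (x ^+ j)))) => //.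
    apply: (isadd_min (iY j)).
      apply: (isadd_min (iY j)); first exact: (isadd_l (ideal_princ _)).
      by move=> _ [a ->]; apply: (isadd_r iIN); exists (a * x); rewrite exprS mulrA.
    exact: isadd_r.
  apply: ige_colon (col_ige iJ finJ) => // a [y [_ [Iy [t ->] E]]].
  have : sadd I (ideal_exp m N) ((a - t * x) * x ^+ j).
    by rewrite mulrBl E exprS mulrA addrK.
  move/kP => [u [v [Iu mv uvE]]].
  have -> : a = (u + t * x) + v by rewrite -(subrK (t * x) a) uvE addrAC.
  exists (u + t * x), v; split=> //; first by exists u, (t * x); split=> //; exists t.
  apply: iexp_le mv; rewrite /N; nia.
by apply: IHj; exact: ltnW.
Qed.

Lemma col_gt0 I n : ideal I -> ~ I 1 -> ile I setT n -> (0 < col I)%N.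
Proof.
move=> iI I1 fin; apply: (col_ge iI fin).
apply: (@lenge_rcons A A^o _ I) => //; first by split=> // /(_ 1 Logic.I).
exact: (@lenge0 A A^o _ _ iI (@subset_refl _ _)).
Qed.

Lemma growth_le I c h : ideal I -> I `<=` m -> growth I c h -> (c <= h)%N.
Proof.
(* At [N = C + 1] the bound [C * N^h] is below [N^(h+1)], hence below [N^c] if [h < c]. *)
move=> iI Im [C /(_ C.+1)]; have [n fin] := ile_sadd_iexp C.+1 iI.
have col0 : (0 < col (sadd I (ideal_exp m C.+1)))%N.
  apply: col_gt0 fin; first exact: (ideal_sadd _ (iexp_ideal _ _)).
  by have [_ m1 _] := lm => h1; apply: m1; move: h1; apply: isadd_min => //; exact: iexp_sub.
have [//|lt_hc] := leqP c h.
have : (C.+1 ^ h.+1 <= C.+1 ^ c)%N by exact: leq_pexp2l.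
rewrite expnS; have : (0 < C.+1 ^ h)%N by rewrite expn_gt0.
move: (C.+1 ^ h)%N (C.+1 ^ c)%N (col _) col0 => u v w; nia.
Qed.

(* Modulo a prime of the chain, an element of the next one is a nonzerodivisor,
   so that [growth_drop] applies at every step. *)
Lemma growth_chain I c h l : ideal I -> growth I c h -> pchain I l -> (l + c <= h)%N.
Proof.
move=> iI gI [q [qP qS]]; have [[iq q1 qpr] Iq] := qP 0%N isT.
have {}gI : growth (q 0%N) c h := growth_sub iI iq Iq gI.
elim: l c q qP qS iq q1 qpr {Iq} gI => [|l IHl] c q qP qS iq q1 qpr gI.
  by apply: (growth_le iq _ gI); exact: loc_sub.
have [qq /existsNP[x /not_implyP[qx nqx]]] := qS 0%N isT.
have gI' : growth (sadd (q 0%N) (princ x)) c.+1 h.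
  by apply: growth_drop => // a /qpr[].
have [[iq1 q11 qpr1] _] := qP 1%N isT.
rewrite addSnnS; apply: (IHl _ (fun i => q i.+1)) => //.
- by move=> i lt_il; exact: qP.
- by move=> i lt_il; exact: qS.
apply: growth_sub gI' => //; first exact: (ideal_sadd _ (ideal_princ _)).
by apply: isadd_min => //; exact: princ_sub.
Qed.

(** The [N]-th powers of the parameters lie in [m^N]. Together with [growth_chain] this bounds
    chains of primes by the number of parameters, without Hilbert polynomials. *)
Lemma growth_params I (ys : seq A) r : ideal I -> (forall y, y \in ys -> m y) ->
  ideal_exp m r `<=` sadd I (ideal_gen [set` ys]) -> growth I 0 (size ys).
Proof.
move=> iI ysm sub; have [n fin] := ile_iexp r.
have {}fin : ile (sadd I (ideal_gen [set` ys])) setT n by apply: ile_sub fin.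
exists n => N; rewrite expn0 muln1 mulnC; apply: col_le.
apply: ile_sub (ile_pows (N := N) iI fin) => //.
apply: isaddS => //; apply: idl_gen_min; first exact: iexp_ideal.
by move=> _ /= /mapP[y /ysm my ->]; exact: iexpX.
Qed.

End Growth.

(** * Quotient rings and regular sequences *)

Section IdealQuotient.
Local Open Scope quotient_scope.

Lemma ideal_quotP (A : comNzRingType) (I : idealr A) :
  exists f : {rmorphism A -> {ideal_quot I}},
    (forall y, exists x, f x = y) /\ forall x, f x = 0 <-> x \in (I : {pred A}).
Proof.
exists (GRing.RMorphism.clone _ _ (\pi_{ideal_quot I}) _); split=> [y|x].
  by exists (repr y); rewrite /= reprK.
rewrite -[x in X in _ <-> X]subr0 Quotient.idealrBE.
by rewrite -(rmorph0 (GRing.RMorphism.clone _ _ (\pi_{ideal_quot I}) _)) /=; split=> /eqP.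
Qed.

End IdealQuotient.

Section QuotientRing.
Variables (A : comNzRingType) (I : set A).
Hypotheses (iI : ideal I) (I1 : ~ I 1).

Lemma quot_ring : exists (B : comNzRingType) (f : {rmorphism A -> B}),
  (forall y, exists x, f x = y) /\ forall x, f x = 0 <-> I x.
Proof.
pose M := isIdealr.Build A [in I] (ideal_idealr_closed iI I1).
pose J : idealr A := HB.pack ([in I] : A -> bool) M.
have [f [fs fk]] := ideal_quotP J; exists {ideal_quot J}, f; split=> // x.
by rewrite fk; split=> [/set_mem|/mem_set].
Qed.

End QuotientRing.

Lemma factor_surj (A B C : comNzRingType) (f : {rmorphism A -> B}) (g : {rmorphism A -> C}) :
  (forall y, exists x, f x = y) -> (forall x, f x = 0 -> g x = 0) ->
  exists h : {rmorphism B -> C}, forall x, h (f x) = g x.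
Proof.
move=> fs fg; have [s sP] := choice fs; pose h y := g (s y).
have hf x : h (f x) = g x.
  by apply/eqP; rewrite -subr_eq0 -rmorphB; apply/eqP/fg; rewrite rmorphB sP subrr.
have hB : zmod_morphism h.
  by move=> x y; rewrite -(sP x) -(sP y) -rmorphB !hf rmorphB.
have hM : monoid_morphism h.
  split; first by rewrite -(rmorph1 f) hf rmorph1.
  by move=> x y; rewrite -(sP x) -(sP y) -rmorphM !hf rmorphM.
pose M1 := GRing.isZmodMorphism.Build B C h hB.
pose M2 := GRing.isMonoidMorphism.Build B C h hM.
pose H : {rmorphism B -> C} := HB.pack h M1 M2.
by exists H.
Qed.

(** The right side depends on [B] alone, so surjections onto [B] from two local rings carry their
    maximal ideals to the same ideal. *)
Lemma loc_im (A B : comNzRingType) (f : {rmorphism A -> B}) (m : set A) :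
  (forall y, exists x, f x = y) -> loc m ->
  f @` m = [set b | ~ exists c, b * c = 1].
Proof.
move=> fs [im m1 mU]; apply/seteqP; split.
  move=> _ [x mx <-] [c]; have [y <-] := fs c => fxy.
  have [|z xyz] := mU (1 - x * y).
    by move=> h; apply: m1; rewrite -(subrK (x * y) 1); apply: idlD => //; exact: idlMr.
  have /eqP := congr1 f xyz; rewrite rmorphM rmorphB rmorphM fxy rmorph1 subrr mul0r eq_sym.
  by rewrite oner_eq0.
move=> b nb; have [x xb] := fs b; exists x => //; apply: contrapT => /mU[y xy].
by apply: nb; exists (f y); rewrite -xb -rmorphM xy rmorph1.
Qed.

Lemma loc_surj (A B : comNzRingType) (f : {rmorphism A -> B}) (m : set A) :
  (forall y, exists x, f x = y) -> loc m -> loc (f @` m).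
Proof.
move=> fs lm; have [im m1 mU] := lm; split; first exact: ideal_im.
  by rewrite (loc_im fs lm) /=; apply; exists 1; rewrite mulr1.
by rewrite (loc_im fs lm) /= => x; apply: contrapT.
Qed.

Lemma antisym_sum (B : comNzRingType) (ys : seq B) (k : nat -> nat -> B) :
  (forall i j, k i j = - k j i) -> (forall i, k i i = 0) ->
  \sum_(i < size ys) (\sum_(l < size ys) k i l * ys`_l) * ys`_i = 0.
Proof.
move=> kA k0.
have -> : \sum_(i < size ys) (\sum_(l < size ys) k i l * ys`_l) * ys`_i =
   \sum_(i < size ys) \sum_(l < size ys) k i l * ys`_l * ys`_i.
  by apply: eq_bigr => i _; rewrite mulr_suml.
rewrite pair_big /= (bigID (fun p : 'I_(size ys) * 'I_(size ys) => (p.1 < p.2)%N)) /=.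
rewrite [X in _ + X](bigID (fun p : 'I_(size ys) * 'I_(size ys) => p.1 == p.2)) /=.
rewrite [X in _ + (X + _)]big1 ?add0r => [|[i j] /= /andP[_ /eqP ->]]; last by rewrite k0 !mul0r.
rewrite [X in _ + X](reindex (fun p : 'I_(size ys) * 'I_(size ys) => (p.2, p.1))) /=; last first.
  by exists (fun p => (p.2, p.1)) => -[].
rewrite [X in _ + X](eq_bigl (fun p : 'I_(size ys) * 'I_(size ys) => (p.1 < p.2)%N)); last first.
  by move=> [i j] /=; rewrite -val_eqE /= -leqNgt leq_eqVlt; case: ltngtP.
rewrite -big_split big1 //= => -[i j] _ /=.
by rewrite kA; ring.
Qed.

Section Regular.
Variables (A : comNzRingType) (m : set A).
Hypotheses (nA : noetherian A) (lm : loc m).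
Implicit Types (I : set A) (ys zs : seq A).

Fixpoint regseq I ys : Prop := if ys is y :: ys' then
  (forall a, I (a * y) -> I a) /\ regseq (sadd I (princ y)) ys' else True.

Lemma growth_princ_regular I y h : ideal I -> m y ->
  growth m (sadd I (princ y)) 1 h -> growth m I 1 h.+1.
Proof.
move=> iI my [C CP]; exists C => N.
have iIN : ideal (sadd I (ideal_exp m N)) := ideal_sadd iI (iexp_ideal _ _).
have iIyN : ideal (sadd (sadd I (princ y)) (ideal_exp m N)).
  by apply: (ideal_sadd _ (iexp_ideal _ _)); exact: (ideal_sadd _ (ideal_princ _)).
have [n /(col_ile iIyN) fin] := ile_sadd_iexp nA lm N (ideal_sadd iI (ideal_princ y)).
have le : (col (sadd I (ideal_exp m N)) <= N * col (sadd (sadd I (princ y)) (ideal_exp m N)))%N.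
  apply: col_le; apply: (@ile_sub _ _ _ (sadd (sadd I (ideal_exp m N)) (princ (y ^+ N))) setT) => //.
    apply: (isadd_min iIN) => //; apply: princ_sub => //; apply: (isadd_r iI).
    exact: iexpX.
  apply: ile_pow => //; apply: ile_sub fin => //.
  by rewrite -!isaddA [sadd (princ y) _]isaddC.
rewrite expn1 expnS; move: (CP N); rewrite expn1; move: (col _) (col _) (N ^ h)%N le => u v w; nia.
Qed.

Lemma growth_artin I r h : ideal I -> ideal_exp m r `<=` I -> growth m I 1 h.+1.
Proof.
move=> iI rI; have [n fin] := ile_iexp nA lm r; exists n => N.
have le : (col (sadd I (ideal_exp m N)) <= n)%N.
  apply: col_le; apply: ile_sub fin => //; apply: subset_trans rI _.
  exact: (isadd_l (iexp_ideal _ _)).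
rewrite expn1 expnS; have [->|N0] := posnP N; first by rewrite muln0.
by apply: leq_mul le _; rewrite leq_pmulr // expn_gt0 N0.
Qed.

(** [~ growth m I 1 h] says that [A / I] has dimension at least [h], in a form that passes to
    [I + (y)] by [growth_princ_regular]. The new [y] is outside [I + m^2], so it can replace one of
    the [zs], and outside the primes of a cover of [I] other than [m]. By induction [I + (y)] is
    prime; it contains a prime [p] above [I] without [y]. Then [i + t y] in [p] forces [t] in [p],
    so [p] lies in [I + m p] and equals [I] by Nakayama. *)
Lemma regular_seq h I zs : ideal I -> size zs = h -> m = sadd I (ideal_gen [set` zs]) ->
  ~ growth m I 1 h ->
  prime_ideal I /\ exists ys, [/\ size ys = h, m = sadd I (ideal_gen [set` ys]) & regseq I ys].
Proof.
have [im m1 mU] := lm.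
elim: h I zs => [|h IHh] I zs iI sz mE ngr.
  have -> : I = m.
    rewrite mE (size0nil sz) gen_nil; apply/seteqP; split=> [x Ix|_ [x [_ [Ix -> ->]]]].
      by exists x, 0; rewrite addr0.
    by rewrite addr0.
  split; first exact: loc_prime.
  exists [::]; split=> //; rewrite gen_nil; apply/seteqP; split=> [x Ix|_ [x [_ [Ix -> ->]]]].
    by exists x, 0; rewrite addr0.
  by rewrite addr0.
have Im : I `<=` m by rewrite mE; exact: (isadd_l (idl_gen_ideal _)).
pose J := sadd I (ideal_exp m 2).
have iJ : ideal J := ideal_sadd iI (iexp_ideal _ _).
have nmJ : ~ m `<=` J.
  move=> mJ; apply: ngr; apply: (@growth_artin _ 1) => //; rewrite iexp1 //.
  by apply: (nakayama nA lm) => //; move: mJ; rewrite /J iexpS iexp1.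
have [ps sub psP] := prime_cover nA iI.
have [|p|y [my nJy yps]] := @prime_avoid _ m J [seq p <- ps | `[< ~ m `<=` p >]] im iJ _ nmJ.
- by apply: isadd_min => //; exact: iexp_sub.
- rewrite mem_filter => /andP[/asboolP nmp /psP[pp Ip]]; split=> // Jp; apply: nmp.
  by apply: prime_sq => //; apply: subset_trans Jp; exact: isadd_r.
have [zs' sz' mE'] : exists2 zs', size zs' = h & m = sadd (sadd I (princ y)) (ideal_gen [set` zs']).
  move: (my); rewrite {1}mE => -[i [g [Ii /gen_seqP[c gE] yE]]].
  have [l [lt_l ncl]] : exists l, (l < size zs)%N /\ ~ m (c l).
    apply: contrapT => nl; apply: nJy; exists i, g; split=> //.
    rewrite gE; apply: idl_sum => [|j _]; first exact: iexp_ideal.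
    rewrite iexpS iexp1 //; apply: imulP.
      by apply: contrapT => ncl; apply: nl; exists j.
    by rewrite mE; apply: (isadd_r iI); apply: idl_gen_sub => /=; exact: mem_nth.
  exists (take l zs ++ drop l.+1 zs).
    by rewrite size_cat size_take size_drop lt_l sz; move: lt_l; rewrite sz; lia.
  set zs' := _ ++ _; have iIy := ideal_sadd iI (ideal_princ y).
  have iR := ideal_sadd iIy (idl_gen_ideal [set` zs']).
  have zsE : zs = take l zs ++ zs`_l :: drop l.+1 zs by rewrite -drop_nth // cat_take_drop.
  have zsP j : (j < size zs)%N -> j != l -> zs`_j \in zs'.
    move=> lt_j; rewrite neq_ltn mem_cat => /orP[lt_jl|lt_lj].
      by rewrite -(nth_take 0 lt_jl) mem_nth // size_take lt_l.
    by rewrite -(subnKC lt_lj) -nth_drop mem_nth ?orbT // size_drop ltn_sub2r // (leq_ltn_trans lt_lj).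
  apply/seteqP; split; last first.
    apply: isadd_min => //; first by apply: isadd_min => //; exact: princ_sub.
    rewrite mE; apply: subset_trans (isadd_r iI); apply: idl_genS => x /=.
    by rewrite mem_cat => /orP[/mem_take|/mem_drop].
  rewrite mE; apply: isadd_min => //.
    by apply: subset_trans (isadd_l (idl_gen_ideal _)); exact: (isadd_l (ideal_princ _)).
  apply: idl_gen_min => // x /= /(nthP 0)[j lt_j <-].
  have [->|ne_jl] := eqVneq j l; last first.
    by apply: (isadd_r iIy); apply: idl_gen_sub; exact: zsP.
  have [u clu] := mU _ ncl.
  have -> : zs`_l = u * (y - i - \sum_(j < size zs | j != Ordinal lt_l) c j * zs`_j).
    have -> : y - i = g by rewrite yE addrC addKr.
    rewrite gE (bigD1 (Ordinal lt_l)) //= addrK mulrA [u * _]mulrC clu mul1r //.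
  apply: (idlM _ iR); apply: (idlB iR).
    apply: (isadd_l (idl_gen_ideal _)); exists (- i), y; split; [exact: idlN|exact: princ_id|].
    by rewrite addrC.
  apply: (isadd_r iIy); apply: idl_sum => [|j' ne_j]; first exact: idl_gen_ideal.
  by apply: (idlM _ (idl_gen_ideal _)); apply: idl_gen_sub; exact: zsP.
have iIy := ideal_sadd iI (ideal_princ y).
have [|pIy [ys [sy myE reg]]] := IHh _ _ iIy sz' mE'.
  by move/(growth_princ_regular iI my).
have [p [pps pIy' npy]] : exists p, [/\ p \in ps, p `<=` sadd I (princ y) & ~ p y].
  have [|p pps pIy'] := @prime_iprod _ ps _ pIy.
    by apply: subset_trans sub _; exact: (isadd_l (ideal_princ _)).
  have [mp|nmp] := pselect (m `<=` p); last first.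
    by exists p; split=> //; apply: yps; rewrite mem_filter pps andbT; exact/asboolP.
  have [p' p'ps nmp'] : exists2 p', p' \in ps & ~ m `<=` p'.
    apply: contrapT => np'.
    have [|q qps|r rI] := only_prime_m lm sub.
    - by move=> q /psP[].
    - by apply: contrapT => nmq; apply: np'; exists q.
    - by apply: ngr; exact: growth_artin rI.
  have [[ip' p'1 _] Ip'] := psP _ p'ps.
  exists p'; split=> //; last by apply: yps; rewrite mem_filter p'ps andbT; exact/asboolP.
  by apply: subset_trans (loc_sub lm ip' p'1) _; exact: subset_trans pIy'.
have [pp Ip] := psP _ pps; have [ip p1 pP] := pp.
have pI : p `<=` I.
  apply: (nakayama nA lm) => // a pa; have [i [_ [Ii [t ->] aE]]] := pIy' _ pa.
  exists i, (t * y); split=> //; rewrite mulrC; apply: imulP => //.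
  have : p (t * y) by rewrite -[t * y](addKr i) -aE; apply: (idlD ip) => //; apply: idlN => //; exact: Ip.
  by case/pP.
have IE : I = p by apply/seteqP.
split; first by rewrite IE.
exists (y :: ys); split; first by rewrite /= sy.
  by rewrite gen_cons isaddA.
by split=> // a; rewrite IE => /pP[].
Qed.

(** Modulo [I + (y)] the relation on the tail is Koszul by induction. The leftover multiples
    [t i * y] form the new row and column of the antisymmetric matrix, and the condition on [r 0]
    follows by cancelling [y] modulo [I]. *)
Lemma koszul_syzygies I ys (r : nat -> A) : ideal I -> regseq I ys ->
  I (\sum_(i < size ys) r i * ys`_i) ->
  exists k : nat -> nat -> A, [/\ (forall i j, k i j = - k j i), (forall i, k i i = 0) &
    forall i, (i < size ys)%N -> I (r i - \sum_(l < size ys) k i l * ys`_l)].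
Proof.
elim: ys I r => [|y ys IHys] I r iI /=.
  by move=> _ _; exists (fun _ _ => 0); split=> // i j; rewrite oppr0.
move=> [nzd reg]; rewrite big_ord_recl /= => Ir.
have iIy := ideal_sadd iI (ideal_princ y).
have [|k [kA k0 kP]] := IHys _ (fun i => r i.+1) iIy reg.
  exists (r 0%N * y + \sum_(i < size ys) r i.+1 * ys`_i), (- (r 0%N) * y); split=> //.
    by exists (- r 0%N).
  by rewrite addrC mulNr addKr.
have [t tP] : exists t : nat -> A, forall i, (i < size ys)%N ->
    I (r i.+1 - \sum_(l < size ys) k i l * ys`_l - t i * y).
  have H i : exists t, (i < size ys)%N -> I (r i.+1 - \sum_(l < size ys) k i l * ys`_l - t * y).
    have [lt_i|_] := boolP (i < size ys)%N; last by exists 0.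
    by have [x [_ [Ix [t ->] ->]]] := kP _ lt_i; exists t; rewrite addrK.
  by have [t tP] := choice H; exists t.
have kk0 := antisym_sum ys kA k0.
exists (fun i j => match i, j with
  | 0, 0 => 0 | 0, j.+1 => - t j | i.+1, 0 => t i | i.+1, j.+1 => k i j end).
split=> [[|i] [|j]|[|i]|[|i]] //=; rewrite ?oppr0 ?opprK //.
- move=> _; rewrite big_ord_recl /= mul0r add0r; apply: nzd.
  have -> : (r 0%N - \sum_(i < size ys) - t i * ys`_i) * y =
      (r 0%N * y + \sum_(i < size ys) r i.+1 * ys`_i)
      - \sum_(i < size ys) (r i.+1 - \sum_(l < size ys) k i l * ys`_l - t i * y) * ys`_i.
    have -> : \sum_(i < size ys) (r i.+1 - \sum_(l < size ys) k i l * ys`_l - t i * y) * ys`_i =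
        \sum_(i < size ys) r i.+1 * ys`_i
        - \sum_(i < size ys) (\sum_(l < size ys) k i l * ys`_l) * ys`_i
        - (\sum_(i < size ys) t i * ys`_i) * y.
      rewrite mulr_suml -!sumrB; apply: eq_bigr => i _.
      by move: (\sum_(l < _) _) => u; ring.
    rewrite kk0 (eq_bigr (fun i : 'I__ => - (t i * ys`_i))) => [|i _]; last by rewrite mulNr.
    by rewrite sumrN; move: (\sum_(i < _) _) (\sum_(i < _) _) => u v; ring.
  apply: idlB => //; apply: idl_sum => // i _; apply: idlMr => //; exact: tP.
- by rewrite ltnS => lt_i; rewrite big_ord_recl /= opprD addrA addrAC; exact: tP.
Qed.

End Regular.

(** * Completion *)

Lemma imul_gen_split (A : comNzRingType) (z : seq A) (J : set A) a : ideal J ->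
  imul (ideal_gen [set` z]) J a ->
  exists r : nat -> A, (forall i, J (r i)) /\ a = \sum_(i < size z) r i * z`_i.
Proof.
move=> iJ; apply: (@imul_min _ _ _ [set a | exists r : nat -> A,
  (forall i, J (r i)) /\ a = \sum_(i < size z) r i * z`_i]).
  apply: mk_ideal => /=.
  - by exists (fun=> 0); split=> [i|]; [exact: idl0|rewrite big1 // => i _; rewrite mul0r].
  - move=> _ _ [r [Jr ->]] [t [Jt ->]]; exists (fun i => r i + t i); split=> [i|]; first exact: idlD.
    by rewrite -big_split; apply: eq_bigr => i _; rewrite mulrDl.
  - move=> b _ [r [Jr ->]]; exists (fun i => b * r i); split=> [i|]; first exact: idlM.
    by rewrite mulr_sumr; apply: eq_bigr => i _; rewrite mulrA.
move=> x y /gen_seqP[c ->] Jy; exists (fun i => c i * y); split=> [i|]; first exact: idlM.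
by rewrite mulr_suml; apply: eq_bigr => i _; rewrite mulrAC.
Qed.

Section CompletionQuotient.
Variable R : comNzRingType.
Hypothesis locR : noeth_local R.
Let m := max_ideal R.
Let Rh := completion (@max_idealr R).
Let C := @coherent_seq R (@max_idealr R).

Let IsetE : [set x | x \in (@max_idealr R : {pred R})] = m.
Proof. by apply/seteqP; split=> x; [move/set_mem|move/mem_set]. Qed.

Let im : ideal m. Proof. by have [_ []] := noeth_local_loc locR. Qed.
Let nR : noetherian R. Proof. by case: locR. Qed.
Let lm : loc m. Proof. by have [] := noeth_local_loc locR. Qed.

Let mk_coherent (u : nat -> R) : (forall n, ideal_exp m n (u n.+1 - u n)) ->
  exists v : C, v = u :> (nat -> R).
Proof.
move=> cu; have h : u \in coherent (@max_idealr R) by apply/asboolP; rewrite IsetE.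
by exists (CoherentSeq h).
Qed.

Let coherentP (u : C) n : ideal_exp m n (u n.+1 - u n).
Proof. by case: u => u /= /asboolP; rewrite IsetE; apply. Qed.

Let coherent_le (u : C) n k : (n <= k)%N -> ideal_exp m n (u k - u n).
Proof.
move=> /subnK <-; elim: (k - n)%N => [|j IHj].
  by rewrite add0n subrr; exact: (idl0 (iexp_ideal _ _)).
rewrite addSn; have -> : u (j + n).+1 - u n = (u (j + n).+1 - u (j + n)%N) + (u (j + n)%N - u n) by ring.
apply: (idlD (iexp_ideal _ _)) => //.
by apply: (iexp_le (leq_addl j n)); exact: coherentP.
Qed.

Let pi_ex : exists pi : {rmorphism C -> Rh}, (forall y, exists u, pi u = y) /\
  forall u : C, pi u = 0 <-> forall n, ideal_exp m n (u n).
Proof.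
have [f [fs fk]] := ideal_quotP (@null_seq R (@max_idealr R) : idealr C).
exists f; split=> // u; rewrite fk; split=> [/asboolP|h]; first by rewrite IsetE.
by apply/asboolP; rewrite IsetE.
Qed.

Variables (Q : comNzRingType) (mQ : set Q) (F : set Q) (phi : {rmorphism Q -> Rh}).
Hypotheses (lQ : loc mQ) (phis : forall y, exists x, phi x = y)
  (phik : forall x, phi x = 0 <-> F x).

(** [B] is [R / m^(N+1)], a quotient of the completion and hence of [Q]. The point is the kernel on
    the side of [Q]: an element of the completion that vanishes modulo [m^(N+1)] comes from
    [mQ^(N+1)], because [m] is finitely generated. *)
Lemma completion_quot N : exists (B : comNzRingType) (pR : {rmorphism R -> B}) (pQ : {rmorphism Q -> B}),
  [/\ forall y, exists x, pR x = y, forall y, exists x, pQ x = y,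
      forall x, pR x = 0 <-> ideal_exp m N.+1 x &
      forall x, pQ x = 0 <-> sadd F (ideal_exp mQ N.+1) x].
Proof.
have [iQ _ uQ] := lQ; have [_ m1 _] := lm.
have nN1 : ~ ideal_exp m N.+1 1 by move=> /(iexp_sub im (ltn0Sn N)).
have [B [pR [pRs pRk]]] := quot_ring (iexp_ideal m N.+1) nN1.
have [pi [pis pik]] := pi_ex.
pose ev (u : C) := pR (u N.+1).
have evB : zmod_morphism ev by move=> u v; rewrite /ev -rmorphB.
have evM : monoid_morphism ev.
  by split=> [|u v]; rewrite /ev; [rewrite -(rmorph1 pR)|rewrite -rmorphM].
pose M1 := GRing.isZmodMorphism.Build C B ev evB.
pose M2 := GRing.isMonoidMorphism.Build C B ev evM.
pose E : {rmorphism C -> B} := HB.pack ev M1 M2.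
have [h hE] : exists h : {rmorphism Rh -> B}, forall u, h (pi u) = E u.
  by apply: factor_surj => // u /pik h; apply/pRk; exact: (h N.+1).
pose pQ : {rmorphism Q -> B} := GRing.RMorphism.clone _ _ (h \o phi) _.
have cst r : exists v : C, v = (fun=> r) :> (nat -> R).
  by apply: mk_coherent => n; rewrite subrr; exact: (idl0 (iexp_ideal _ _)).
have pQs y : exists x, pQ x = y.
  have [r <-] := pRs y; have [v vE] := cst r; have [x xE] := phis (pi v).
  by exists x; rewrite /= xE hE /= /ev vE.
exists B, pR, pQ; split=> // x.
have imE : pQ @` mQ = pR @` m by rewrite (loc_im pQs lQ) (loc_im pRs lm).
have [z zE] := nR im.
have [xs xsP] : exists xs : nat -> Q, forall i, exists v : C,
    [/\ v = (fun=> z`_i) :> (nat -> R), phi (xs i) = pi v & (i < size z)%N -> mQ (xs i)].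
  have H i : exists x, exists v : C,
    [/\ v = (fun=> z`_i) :> (nat -> R), phi x = pi v & (i < size z)%N -> mQ x].
    have [v vE] := cst z`_i; have [y yE] := phis (pi v); exists y, v; split=> // lt_i.
    have : (pR @` m) (pQ y).
      by exists z`_i; [rewrite zE; apply: idl_gen_sub; exact: mem_nth|rewrite /= yE hE /= /ev vE].
    rewrite (loc_im pRs lm) /= => ny; apply: contrapT => /uQ[c yc]; apply: ny.
    by exists (pQ c); rewrite -!rmorphM yc !rmorph1.
  by have [xs xsP] := choice H; exists xs.
(* Induction on [k]: [u] is rewritten as a combination of the generators [z_i] with coherent
   coefficients [v i] lying in [m^k] at level [k], and these lift to [mQ^k]. *)
have fil k (u : C) : ideal_exp m k (u k) -> exists2 y, ideal_exp mQ k y & phi y = pi u.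
  elim: k u => [|k IHk] u muk; first by have [y yE] := phis (pi u); exists y.
  (* [w] represents the same element as [u]: early terms are cleared and the index is shifted, so
     that the first possibly nonzero increment is [u k.+1], which lies in [m^(k+1)]. *)
  pose w j := if (k <= j)%N then u j.+1 else 0.
  pose d j := if j is i.+1 then w i.+1 - w i else w 0%N.
  have dP j : ideal_exp m (maxn j k.+1) (d j).
    rewrite /d /w; case: j => [|j].
      rewrite max0n; case: ifP => [|_]; last exact: (idl0 (iexp_ideal _ _)).
      by rewrite leqn0 => /eqP k0; move: muk; rewrite k0.
    case: ifPn => [le_k|]; last first.
      rewrite -ltnNge => lt_k; rewrite leqNgt (ltnW lt_k) /= subrr; exact: (idl0 (iexp_ideal _ _)).
    move: le_k; rewrite leq_eqVlt ltnS => /predU1P[kE|le_k].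
      rewrite kE ltnn subr0 (maxn_idPr (leqnSn _)) in muk *.
      rewrite -(subrK (u j.+2) (u j.+2)) in muk *.
      have := coherent_le u (leqnSn j.+2).
      by rewrite subrr add0r in muk *.
    rewrite le_k (maxn_idPl _) ?ltnS //; exact: coherentP.
  have [r rP] : exists r : nat -> nat -> R, forall j,
      (forall i, ideal_exp m (maxn j k.+1).-1 (r j i)) /\ d j = \sum_(i < size z) r j i * z`_i.
    have H j : exists r : nat -> R,
      (forall i, ideal_exp m (maxn j k.+1).-1 (r i)) /\ d j = \sum_(i < size z) r i * z`_i.
      apply: imul_gen_split; first exact: iexp_ideal.
      by rewrite -zE -iexpS prednK ?leq_max ?ltn0Sn ?orbT //; exact: dP.
    by have [r rP] := choice H; exists r.
  have [v vP] : exists v : nat -> C, forall i, v i = (fun j => \sum_(l < j.+1) r l i) :> (nat -> R).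
    have H i : exists v : C, v = (fun j => \sum_(l < j.+1) r l i) :> (nat -> R).
      apply: mk_coherent => j; rewrite [X in X - _]big_ord_recr /= addrAC subrr add0r.
      by apply: (@iexp_le _ _ j (maxn j.+1 k.+1).-1); [rewrite /maxn; case: ifP; lia|apply: (rP j.+1).1].
    by have [v vP] := choice H; exists v.
  have vk i : ideal_exp m k (v i k).
    rewrite vP; apply: idl_sum => [|l _]; first exact: iexp_ideal.
    by apply: (@iexp_le _ _ k (maxn l k.+1).-1); [rewrite /maxn; case: ifP; lia|apply: (rP l).1].
  have [ys ysP] : exists ys : nat -> Q, forall i, ideal_exp mQ k (ys i) /\ phi (ys i) = pi (v i).
    have H i : exists y, ideal_exp mQ k y /\ phi y = pi (v i).
      by have [y yk yE] := IHk _ (vk i); exists y.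
    by have [ys ysP] := choice H; exists ys.
  exists (\sum_(i < size z) xs i * ys i).
    apply: idl_sum => [|i _]; first exact: iexp_ideal.
    by rewrite iexpS; apply: imulP; [have [? [_ _]] := xsP i; exact|exact: (ysP i).1].
  have [c cE] := choice xsP.
  have -> : phi (\sum_(i < size z) xs i * ys i) = pi (\sum_(i < size z) c i * v i).
    rewrite !rmorph_sum; apply: eq_bigr => i _; rewrite !rmorphM (ysP i).2.
    by have [_ -> _] := cE i.
  apply/eqP; rewrite -subr_eq0 -rmorphB; apply/eqP/pik => j.
  have -> : (\sum_(i < size z) c i * v i - u : C) j = w j - u j.
    have cB (a b : C) : (a - b) j = a j - b j by [].
    rewrite cB; congr (_ - _).
    have -> : (\sum_(i < size z) c i * v i : C) j = \sum_(i < size z) z`_i * v i j.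
      have cD : {morph (fun a : C => a j) : a b / a + b} by [].
      rewrite (big_morph _ cD (erefl _)); apply: eq_bigr => i _.
      have cM (a b : C) : (a * b) j = a j * b j by [].
      by rewrite cM; have [-> _ _] := cE i.
    rewrite (eq_bigr (fun i : 'I_(size z) => \sum_(l < j.+1) r l i * z`_i)) => [|i _]; last first.
      by rewrite vP mulr_sumr; apply: eq_bigr => l _; rewrite mulrC.
    rewrite exchange_big /= (eq_bigr (fun l : 'I_j.+1 => d l)) => [|l _]; last by rewrite (rP l).2.
    elim: (j) => [|i IHi]; first by rewrite big_ord1.
    by rewrite big_ord_recr /= IHi addrC subrK.
  rewrite /w; case: ifPn => [le_kj|]; first exact: coherentP.
  rewrite -ltnNge sub0r => lt_jk; apply: (idlN (iexp_ideal _ _)).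
  rewrite -(subKr (u k.+1) (u j)); apply: (idlB (iexp_ideal _ _)).
    by apply: iexp_le muk; rewrite ltnW // ltnS ltnW.
  by apply: coherent_le; rewrite ltnW // ltnS ltnW.
split.
  have [u uE] := pis (phi x); rewrite /= -uE hE /= /ev => /pRk /fil[y my yE].
  exists (x - y), y; rewrite subrK; split=> //.
  by apply/phik; rewrite rmorphB yE uE subrr.
case=> f [y [/phik ff my ->]]; rewrite rmorphD /= ff rmorph0 add0r.
have : ideal_exp (pR @` m) N.+1 (pQ y) by apply: iexp_preim my => a ma; rewrite -imE; exists a.
by rewrite -iexp_im // => -[r /pRk r0 e]; rewrite -[LHS]/(pQ y) -e.
Qed.

End CompletionQuotient.

(** * Dimension of complete intersections *)

Lemma ideal_set0 (A : comNzRingType) : ideal [set (0 : A)].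
Proof. by rewrite -gen_nil; exact: idl_gen_ideal. Qed.

Lemma sadd0 (A : comNzRingType) (I : set A) : sadd [set 0] I = I.
Proof.
apply/seteqP; split=> [_ [x [y [-> Iy ->]]]|x Ix]; first by rewrite add0r.
by exists 0, x; rewrite add0r.
Qed.

Lemma pchain0P (A : comNzRingType) l : pchain [set (0 : A)] l <->
  exists c : nat -> set A, (forall i, (i <= l)%N -> prime_ideal (c i)) /\
    (forall i, (i < l)%N -> c i `<` c i.+1).
Proof.
split=> -[c [cP cS]]; exists c; split=> // i /cP; first by case.
by move=> pc; split=> // _ ->; have [ic _ _] := pc; exact: idl0.
Qed.

(** A positive value cannot be the default of [max_nat], so it is an attained maximum. *)
Lemma krull_dim_max (A : comNzRingType) : (0 < krull_dim A)%N ->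
  pchain [set (0 : A)] (krull_dim A) /\
  forall l, pchain [set (0 : A)] l -> (l <= krull_dim A)%N.
Proof.
rewrite /krull_dim /max_chain /max_nat; case: xgetP => // n _ [nP nmax] _.
by split=> [|l]; [exact/pchain0P|move=> /pchain0P/nmax].
Qed.

(** If the value is 0, possibly by default, the chain consisting of [m] alone serves. *)
Lemma pchain_krull_dim (A : comNzRingType) (m : set A) : loc m -> pchain [set (0 : A)] (krull_dim A).
Proof.
move=> lm; have [|/krull_dim_max[]//] := posnP (krull_dim A) => ->.
apply/pchain0P; exists (fun=> m); split=> // i _; exact: loc_prime.
Qed.

Lemma regular_local_seq (Q : comNzRingType) : regular_local Q ->
  exists ys, [/\ size ys = krull_dim Q, max_ideal Q = ideal_gen [set` ys] & regseq [set 0] ys].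
Proof.
case=> locQ [s [sz mE]]; have [nQ lQ] := noeth_local_loc locQ.
have [||_ [ys [sy myE reg]]] := regular_seq nQ lQ (@ideal_set0 Q) sz.
- by rewrite sadd0.
- move/(growth_chain nQ lQ (@ideal_set0 Q)) => /(_ _ (pchain_krull_dim lQ)).
  by rewrite addn1 ltnn.
by exists ys; split=> //; rewrite -(sadd0 (ideal_gen _)).
Qed.

Lemma growth_regular_sequence (A : comNzRingType) (m : set A) (f : seq A) c h : noetherian A -> loc m ->
  (forall i x, (i < size f)%N ->
    ideal_gen [set` take i f] (f`_i * x) -> ideal_gen [set` take i f] x) ->
  growth m [set 0] c h -> growth m (ideal_gen [set` f]) (size f + c) h.
Proof.
move=> nA lm reg g0; rewrite -{1}[f]take_size.
suff H i : (i <= size f)%N -> growth m (ideal_gen [set` take i f]) (i + c) h by exact: H.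
elim: i => [|i IHi] lt_i; first by rewrite take0 gen_nil.
have {}IHi := IHi (ltnW lt_i).
rewrite (take_nth 0 lt_i) -cats1 gen_cat gen_cons gen_nil.
have -> : sadd (princ f`_i) [set 0] = princ f`_i by rewrite isaddC sadd0.
rewrite addSn; apply: growth_drop => //; first exact: idl_gen_ideal.
by move=> a; rewrite mulrC; exact: reg.
Qed.

Section CompleteIntersection.
Variables (R Q : comNzRingType) (f : seq Q)
  (phi : {rmorphism Q -> completion (@max_idealr R)}).
Hypotheses (locR : noeth_local R) (regQ : regular_local Q) (regf : regular_sequence f)
  (phis : forall y, exists x, phi x = y)
  (phik : forall x, phi x = 0 <-> ideal_gen [set` f] x)
  (dimR : (0 < krull_dim R)%N).

Let nR : noetherian R. Proof. by case: locR. Qed.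
Let lR : loc (max_ideal R). Proof. by have [] := noeth_local_loc locR. Qed.
Let nQ : noetherian Q. Proof. by case: regQ => -[]. Qed.
Let lQ : loc (max_ideal Q). Proof. by case: regQ => /noeth_local_loc[]. Qed.

(** Dimensions are compared through colengths. Each member of [f] lowers the order of growth over
    [Q] by one, and [R] has the colengths of [Q / (f)], which bounds chains in [R]. Conversely,
    parameters of [R] lifted to [Q] and joined to [f] bound chains in [Q]. *)
Lemma complete_intersection_dim : (krull_dim R + size f)%N = krull_dim Q.
Proof.
have [[iR _ _] [iQ _ uQ]] := (lR, lQ).
have [ys [sy myE _]] := regular_local_seq regQ.
have [chR maxR] := krull_dim_max dimR.
have fm : ideal_gen [set` f] `<=` max_ideal Q.
  apply: (loc_sub lQ); first exact: idl_gen_ideal.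
  by move=> f1; apply: regf.2; apply: idl1 => //; exact: idl_gen_ideal.
apply/eqP; rewrite eqn_leq; apply/andP; split.
  apply: (growth_chain nR lR (@ideal_set0 R)) chR.
  have g0 : growth (max_ideal Q) [set 0] 0 (krull_dim Q).
    rewrite -sy; apply: (@growth_params _ _ nQ lQ _ _ 1) => //; first exact: ideal_set0.
      by move=> y yys; rewrite myE; exact: idl_gen_sub.
    by rewrite sadd0 iexp1 // myE.
  have [C CP] := growth_regular_sequence nQ lQ regf.1 g0; exists C => -[|N].
    rewrite /=; have -> : sadd [set 0] (ideal_exp (max_ideal R) 0) = setT by rewrite sadd0.
    by have /eqP -> : col [set: R] == 0%N by rewrite -leqn0; exact/col_le/ile_setT.
  have [B [pR [pQ [pRs pQs pRk pQk]]]] := completion_quot locR lQ phis phik N.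
  have -> : col (sadd [set 0] (ideal_exp (max_ideal R) N.+1)) =
            col (sadd (ideal_gen [set` f]) (ideal_exp (max_ideal Q) N.+1)).
    rewrite sadd0 (@col_surj _ _ _ pRs (ideal_exp _ N.+1)); last by move=> x /pRk.
    rewrite (@col_surj _ _ _ pQs (sadd _ _)); last by move=> x /pQk.
    have i1 : ideal (pR @` ideal_exp (max_ideal R) N.+1) := ideal_im pRs (iexp_ideal _ _).
    have i2 := ideal_im pQs (ideal_sadd (idl_gen_ideal [set` f]) (iexp_ideal (max_ideal Q) N.+1)).
    congr col; apply/seteqP; split=> _ [x xk <-].
      by have /pRk -> := xk; exact: idl0.
    by have /pQk -> := xk; exact: idl0.
  by have := CP N.+1; rewrite addn0.
have [zs [sz zsm [r rI]]] := params nR lR (@ideal_set0 R) maxR.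
have [B [pR [pQ [pRs pQs pRk pQk]]]] := completion_quot locR lQ phis phik r.
have mE : pQ @` max_ideal Q = pR @` max_ideal R by rewrite (loc_im pQs lQ) (loc_im pRs lR).
have [t tP] := choice (fun z => pQs (pR z)).
pose zs' := map t zs.
have szE : (krull_dim R + size f)%N = size (f ++ zs') by rewrite size_cat size_map sz addnC.
rewrite szE -[krull_dim Q]addn0.
apply: (growth_chain nQ lQ (@ideal_set0 Q)) (pchain_krull_dim lQ).
have zm y : y \in zs' -> max_ideal Q y.
  case/mapP=> z /zsm mz ->; apply: contrapT => /uQ[u tu].
  have : (pR @` max_ideal R) (pQ (t z)) by exists z.
  by rewrite (loc_im pRs lR) /=; apply; exists (pQ u); rewrite -rmorphM tu rmorph1.
apply: (@growth_params _ _ nQ lQ _ _ r); first exact: ideal_set0.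
  by move=> y; rewrite mem_cat => /orP[yf|/zm //]; apply: fm; exact: idl_gen_sub.
rewrite sadd0 gen_cat; apply: (nakayama nQ lQ) => [||x mx].
- exact: (ideal_sadd (idl_gen_ideal _) (idl_gen_ideal _)).
- exact: iexp_ideal.
have [y my yx] : (pR @` ideal_exp (max_ideal R) r) (pQ x).
  by rewrite iexp_im // -mE -iexp_im //; exists x.
have := rI _ my; rewrite sadd0 => /gen_seqP[a yE].
have [b bE] := choice (fun i => pQs (pR (a i))).
pose w := \sum_(i < size zs') b i * zs'`_i.
have : pQ (x - w) = 0.
  rewrite rmorphB -yx yE !rmorph_sum /= size_map -sumrB big1 // => i _.
  by rewrite !rmorphM bE (nth_map 0) // tP subrr.
move/pQk => [g [v [fg mv xw]]].
exists (g + w), v; split=> //; last by rewrite addrAC -xw subrK.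
by exists g, w; split=> //; apply/gen_seqP; exists b.
Qed.

End CompleteIntersection.

(** * Coefficient fields *)

Section SubringSets.
Variable E : comNzRingType.
Implicit Types (H : set E) (x y t : E).

Definition is_subring H := [/\ H 1, forall x y, H x -> H y -> H (x - y) & forall x y, H x -> H y -> H (x * y)].

Lemma subring0 H : is_subring H -> H 0.
Proof. by move=> [H1 hB _]; rewrite -(subrr 1); exact: hB. Qed.

Lemma subringD H x y : is_subring H -> H x -> H y -> H (x + y).
Proof.
move=> sH Hx Hy; have [_ hB _] := sH; have h0 := subring0 sH.
by rewrite -[y]opprK; apply: (hB) => //; rewrite -[- y]add0r; exact: hB.
Qed.

Lemma subring_sum H n (F : 'I_n -> E) : is_subring H -> (forall i, H (F i)) -> H (\sum_(i < n) F i).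
Proof.
move=> sH HF; apply: (big_ind H) => //; first exact: subring0.
by move=> x y; exact: subringD.
Qed.

Lemma srX H x n : is_subring H -> H x -> H (x ^+ n).
Proof. by move=> [H1 _ hM] Hx; elim: n => [|n IHn] //; rewrite exprS; exact: hM. Qed.

Definition subring_adjoin p H t : set E :=
  [set x | exists h : nat -> E, (forall i, H (h i)) /\ x = \sum_(i < p) h i * t ^+ i].

Lemma subring_adj_sub p H t : (0 < p)%N -> is_subring H -> H `<=` subring_adjoin p H t.
Proof.
case: p => // p _ sH x Hx; exists (fun i => if i is 0%N then x else 0); split.
  by case=> // _; exact: subring0.
by rewrite big_ord_recl big1 ?addr0 ?mulr1 // => i _; rewrite mul0r.
Qed.

Lemma subring_adj_gen p H t : (1 < p)%N -> is_subring H -> subring_adjoin p H t t.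
Proof.
case: p => [|[|p]] // _ sH; have [H1 _ _] := sH; exists (fun i => if i is 1%N then 1 else 0); split.
  by case=> [|[|i]] //; exact: subring0.
by rewrite !big_ord_recl big1 ?addr0 ?mul0r ?add0r ?mul1r // => i _; rewrite mul0r.
Qed.

Lemma subring_adj_sr p H t : (0 < p)%N -> is_subring H -> H (t ^+ p) -> is_subring (subring_adjoin p H t).
Proof.
move=> p0 sH Ht; have [H1 hB hM] := sH.
have aB x y : subring_adjoin p H t x -> subring_adjoin p H t y -> subring_adjoin p H t (x - y).
  move=> [h [Hh ->]] [g [Hg ->]]; exists (fun i => h i - g i); split=> [i|]; first exact: hB.
  by rewrite -sumrB; apply: eq_bigr => i _; rewrite mulrBl.
have aM b x : H b -> subring_adjoin p H t x -> subring_adjoin p H t (b * x).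
  move=> Hb [h [Hh ->]]; exists (fun i => b * h i); split=> [i|]; first exact: hM.
  by rewrite mulr_sumr; apply: eq_bigr => i _; rewrite mulrA.
have aT x : subring_adjoin p H t x -> subring_adjoin p H t (x * t).
  case: p p0 Ht {aB aM} => // p _ Ht [h [Hh ->]].
  exists (fun i => if i is j.+1 then h j else h p * t ^+ p.+1); split=> [[|i] //|]; first exact: hM.
  rewrite big_ord_recr big_ord_recl /= mulr1 mulrDl mulr_suml -mulrA -exprSr addrC.
  by congr (_ + _); apply: eq_bigr => i _; rewrite -mulrA -exprSr.
split=> //; first exact: subring_adj_sub.
move=> x _ ax [h [Hh ->]]; rewrite mulr_sumr.
have a0 : subring_adjoin p H t 0 by apply: subring_adj_sub => //; exact: subring0.
apply: (big_ind (subring_adjoin p H t)) => // [u v au av|i _].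
  by rewrite -[v]opprK; apply: (aB) => //; rewrite -[- v]add0r; exact: aB.
rewrite mulrCA; apply: aM => //; elim: (nat_of_ord i) => [|n IHn]; first by rewrite mulr1.
by rewrite exprSr mulrA; exact: aT.
Qed.

End SubringSets.

Section Independence.
Variables (k : fieldType) (p : nat) (L : set k) (a : k).
Hypotheses (pk : p \in [pchar k]) (sL : is_subring L) (LV : forall x, L x -> L x^-1)
  (Lap : L (a ^+ p)) (nLa : ~ L a).

Let Lp (f : {poly k}) := forall i, L f`_i.

Let LpM f g : Lp f -> Lp g -> Lp (f * g).
Proof.
move=> Lf Lg i; rewrite coefM; apply: subring_sum => // j.
by have [_ _ LM] := sL; exact: LM.
Qed.

Let LpB f g : Lp f -> Lp g -> Lp (f - g).
Proof. by move=> Lf Lg i; rewrite coefB; have [_ LB _] := sL; exact: LB. Qed.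

Let Lnat n : L n%:R.
Proof.
elim: n => [|n IHn]; first exact: subring0.
by rewrite -addn1 natrD; apply: subringD => //; case: sL.
Qed.

Let Ldiv h f : h \is monic -> Lp h -> Lp f ->
  exists q r, [/\ Lp r, f = q * h + r & (size r < size h)%N].
Proof.
move=> mh Lh; elim: {f}(size f) {-2}f (leqnn (size f)) => [|n IHn] f sf Lf.
  exists 0, 0; move: sf; rewrite leqn0 size_poly_eq0 => /eqP ->.
  by rewrite mul0r addr0; split=> [i||]; rewrite ?coef0 ?size_poly0 ?size_poly_gt0 ?monic_neq0 //; exact: subring0.
have [lt_fh|le_hf] := ltnP (size f) (size h).
  by exists 0, f; rewrite mul0r add0r.
pose g : {poly k} := lead_coef f *: 'X^(size f - size h).
have Lg : Lp g.
  move=> i; rewrite coefZ coefXn; have [_ _ LM] := sL; apply: LM; first exact: Lf.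
  exact: Lnat.
have sh : (0 < size h)%N by rewrite size_poly_gt0 monic_neq0.
have [||q [r [Lr fE is_subring]]] := IHn (f - g * h); last first.
- exists (g + q), r; split=> //; rewrite mulrDl -addrA -fE addrC subrK //.
- by apply: LpB => //; exact: LpM.
apply/leq_sizeP => j le_nj; have [f0|f0] := eqVneq f 0.
  by rewrite /g f0 lead_coef0 scale0r mul0r subr0 coef0.
have sf0 : (0 < size f)%N by rewrite size_poly_gt0.
have sgh : (size (g * h)%R <= size f)%N.
  rewrite -scalerAl; apply: leq_trans (size_scale_leq _ _) _.
  by apply: leq_trans (size_polyMleq _ _) _; rewrite size_polyXn; lia.
rewrite coefB; have [le_fj|lt_jf] := leqP (size f) j.
  by rewrite !nth_default ?subrr //; exact: leq_trans le_fj.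
have -> : j = (size f).-1 by lia.
rewrite -scalerAl coefZ mulrC -[X in X - _]mul1r /lead_coef -mulrBl.
have -> : ('X^(size f - size h) * h)`_(size f).-1 = lead_coef h.
  by rewrite coefXnM /lead_coef; case: ifP => [|_]; [lia|congr (h`__); lia].
by rewrite (monicP mh) subrr mul0r.
Qed.

(** A polynomial [h] of least degree over [L] vanishing at [a] divides [('X - a)^p], so it is
    [('X - a)^j] with [j < p]. If [j = 1], then [a] is in [L]; if [j > 1], the derivative vanishes
    by minimality, although its top coefficient [j] is nonzero in [k]. *)
Lemma insep_independent (b : nat -> k) : (forall i, L (b i)) ->
  \sum_(i < p) b i * a ^+ i = 0 -> forall i, (i < p)%N -> b i = 0.
Proof.
move=> Lb b0 i lt_ip; apply/eqP; apply: contrapT => /negP nbi.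
have p_pr : prime p := pcharf_prime pk.
pose ok n := `[< exists h, [/\ h != 0, Lp h, h.[a] = 0 & size h = n] >].
have exn : exists n, ok n && (n <= p)%N.
  exists (size (\poly_(i < p) b i)); rewrite size_poly andbT; apply/asboolP.
  exists (\poly_(i < p) b i); split=> //.
  - by apply/eqP => /(congr1 (fun f : {poly k} => f`_i)); rewrite coef_poly lt_ip coef0; exact/eqP.
  - by move=> j; rewrite coef_poly; case: ifP => // _; exact: subring0.
  - by rewrite horner_poly.
have [_ /andP[/asboolP[h [h0 Lh ha <-]] hp] hmin] := ex_minnP exn.
have {}hmin f : Lp f -> f.[a] = 0 -> (size f < size h)%N -> f = 0.
  move=> Lf fa sf; apply/eqP; apply: contraTT sf => f0; rewrite -leqNgt.
  have [le_fp|lt_pf] := leqP (size f) p; last exact: leq_trans hp (ltnW lt_pf).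
  by apply: hmin; rewrite le_fp andbT; apply/asboolP; exists f.
wlog mh : h h0 Lh ha hp hmin / h \is monic.
  move=> H; have lh0 : (lead_coef h)^-1 != 0 by rewrite invr_eq0 lead_coef_eq0.
  apply: (H ((lead_coef h)^-1 *: h)) => //.
  - by rewrite scaler_eq0 negb_or lh0.
  - move=> j; rewrite coefZ; have [_ _ LM] := sL; apply: LM => //; apply: LV; exact: Lh.
  - by rewrite hornerZ ha mulr0.
  - by rewrite size_scale.
  - by rewrite size_scale.
  - by rewrite monicE lead_coefZ mulVf // lead_coef_eq0.
have hD : h %| ('X - a%:P) ^+ p.
  have pP : p \in [pchar {poly k}] by rewrite pchar_poly.
  have -> : ('X - a%:P) ^+ p = 'X^p - (a ^+ p)%:P.
    by rewrite -!(pFrobenius_autE pP) rmorphB /= !pFrobenius_autE rmorphXn.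
  have [|q [r [Lr E is_subring]]] := @Ldiv h ('X^p - (a ^+ p)%:P) mh Lh.
    move=> j; rewrite coefB coefXn coefC; have [_ LB _] := sL; apply: LB; first exact: Lnat.
    by case: eqP => _ //; exact: subring0.
  rewrite E (hmin r) ?addr0 ?dvdp_mull //.
  have := congr1 (fun f => f.[a]) E; rewrite /= [RHS]hornerD hornerM ha mulr0 add0r => <-.
  by rewrite hornerD hornerN hornerXn hornerC subrr.
have [j _ hE] := dvdp_exp_XsubCP hD.
have {}hE : h = ('X - a%:P) ^+ j.
  by apply/eqP; rewrite -eqp_monic // monic_exp // monicXsubC.
have sh : size h = j.+1 by rewrite hE size_exp_XsubC.
case: j hE sh => [|[|j]] hE sh.
- by move: ha; rewrite hE expr0 hornerC => /eqP; rewrite oner_eq0.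
- apply: nLa; have := Lh 0%N; rewrite hE expr1 coefB coefX coefC sub0r /= => La.
  by rewrite -[a]opprK -[- - a]add0r; have [_ LB _] := sL; apply: LB => //; exact: subring0.
have h'0 : h^`() = 0.
  apply: hmin; last by apply: lt_size_deriv.
    by move=> i'; rewrite coef_deriv -mulr_natr; have [_ _ LM] := sL; apply: LM => //; exact: Lnat.
  by rewrite hE deriv_exp hornerMn hornerM horner_exp hornerXsubC subrr expr0n mulr0 mul0rn.
have := congr1 (fun f : {poly k} => f`_j.+1) h'0.
rewrite coef_deriv coef0; have -> : h`_j.+2 = 1.
  by have := monicP mh; rewrite lead_coefE sh.
move/eqP; rewrite -(dvdn_pcharf pk) => /dvdn_leq; rewrite leqNgt => /(_ isT).
by rewrite sh in hp; rewrite leqNgt hp.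
Qed.

End Independence.

Section CoefficientField.
Variables (R : comNzRingType) (m : set R) (k : fieldType) (p : nat) (pi : {rmorphism R -> k}).
Hypotheses (lm : loc m) (pR : p \in [pchar R]) (pk : p \in [pchar k])
  (pis : forall y, exists x, pi x = y) (pik : forall x, pi x = 0 <-> m x).

Let im : ideal m. Proof. by case: lm. Qed.
Let E : comNzRingType := (k * R)%type.
Let pE : p \in [pchar E].
Proof.
rewrite inE (pcharf_prime pk) /=; apply/eqP.
have -> : p%:R = (p%:R, p%:R) :> E by elim: p => // n IHn; rewrite -addn1 !natrD IHn.
by rewrite !pcharf0.
Qed.

(** A ring section of [R / m^N -> k], encoded by its graph in [k x R] saturated under [0 x m^N]. As
    a subring, a graph can be enlarged by Zorn's lemma. *)
Let lift N (G : set E) := [/\ is_subring G, forall a, exists y, G (a, y),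
  forall a y, G (a, y) -> pi y = a, forall y, G (0, y) -> ideal_exp m N y &
  forall y, ideal_exp m N y -> G (0, y)].

(** The [p]-th powers of the section modulo [m^N] are well defined modulo [m^(N+1)], as [(m^N)^p]
    lies there; for imperfect [k] this gives a graph [F] over [k^p] only. A maximal graph [H]
    between [F] and [G] is defined on all of [k]: a missing [a] could be adjoined through
    [t = (a, y)], whose [p]-th power is in [F]. *)
Let lift_step N (G : set E) : (0 < N)%N -> lift N G -> exists G', lift N.+1 G'.
Proof.
move=> N0 [sG Gd Gpi G0 G0m]; have p_pr : prime p := pcharf_prime pk.
have p0 := prime_gt0 p_pr; have p1 := prime_gt1 p_pr.
have [G1 GB GM] := sG.
pose F : set E := [set x | exists2 t, G t & exists2 w, ideal_exp m N.+1 w & x = t ^+ p + (0, w)].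
have iN := iexp_ideal m N.+1.
have sF : is_subring F.
  split.
  - by exists 1 => //; exists 0; [exact: idl0|rewrite expr1n addr0].
  - move=> _ _ [t Gt [w mw ->]] [t' Gt' [w' mw' ->]]; exists (t - t'); first exact: GB.
    exists (w - w'); first exact: (idlB iN).
    rewrite -!(pFrobenius_autE pE) rmorphB /= opprD addrACA; congr (_ + _).
    by apply/pair_equal_spec; rewrite /= subr0.
  - move=> _ _ [t Gt [w mw ->]] [t' Gt' [w' mw' ->]]; exists (t * t'); first exact: GM.
    exists ((t ^+ p).2 * w' + w * (t' ^+ p).2 + w * w').
      exact: (idlD iN (idlD iN (idlM _ iN mw') (idlMr _ iN mw)) (idlMr _ iN mw)).
    rewrite exprMn; case: (t ^+ p) (t' ^+ p) => [a b] [a' b'].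
    by apply/pair_equal_spec; split=> /=; ring.
have FG : F `<=` G.
  move=> _ [t Gt [w mw ->]]; apply: (subringD sG); first exact: (srX _ sG).
  by apply: G0m; exact: iexp_le mw.
have F0 y : F (0, y) -> ideal_exp m N.+1 y.
  case=> -[a z] Gt [w mw]; rewrite -(pFrobenius_autE pE) => e.
  have [/eqP a0 ->] : 0 = a ^+ p /\ y = z ^+ p + w.
    have pairX n : ((a, z) : E) ^+ n = (a ^+ n, z ^+ n).
      by elim: n => // n IHn; rewrite !exprS IHn.
    by move: e; rewrite pFrobenius_autE pairX => -[-> ->]; rewrite addr0.
  apply: (idlD iN) => //; move: a0; rewrite eq_sym expf_eq0 => /andP[_ /eqP a0].
  rewrite a0 in Gt; apply: (iexp_le _ (@iexpMX _ _ _ p _ (G0 _ Gt))).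
  by apply: leq_trans (_ : N * 2 <= _)%N; [lia|rewrite leq_mul2l p1 orbT].
pose good (H : set E) := [/\ is_subring H, F `<=` H, H `<=` G & forall y, H (0, y) -> ideal_exp m N.+1 y].
(* The alternative [set0] makes the property hold for the union of the empty chain. *)
have [H [HP Hmax]] : exists H, (H = set0 \/ good H) /\
    forall B, H `<` B -> ~ (B = set0 \/ good B).
  apply: (@Zorn_bigcup E (fun H => H = set0 \/ good H)) => C CP Ctot.
  have [[X CX gX]|nX] := pselect (exists2 X, C X & good X); last first.
    left; apply/seteqP; split=> // x [X CX Xx].
    by have [X0|gX] := CP _ CX; [rewrite X0 in Xx|case: nX; exists X].
  have gC Y y : C Y -> Y y -> good Y by move=> CY Yy; have [Y0|//] := CP _ CY; rewrite Y0 in Yy.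
  right; have [sX FX XG X0] := gX; split.
  - split; first by exists X => //; case: sX.
      move=> x y [Y CY Yx] [Z CZ Zy].
      have [[sY _ _ _] [sZ _ _ _]] := (gC _ _ CY Yx, gC _ _ CZ Zy).
      have [YZ|ZY] := Ctot _ _ CY CZ.
        by exists Z => //; have [_ ZB _] := sZ; apply: ZB => //; exact: YZ.
      by exists Y => //; have [_ YB _] := sY; apply: YB => //; exact: ZY.
    move=> x y [Y CY Yx] [Z CZ Zy].
    have [[sY _ _ _] [sZ _ _ _]] := (gC _ _ CY Yx, gC _ _ CZ Zy).
    have [YZ|ZY] := Ctot _ _ CY CZ.
      by exists Z => //; have [_ _ ZM] := sZ; apply: ZM => //; exact: YZ.
    by exists Y => //; have [_ _ YM] := sY; apply: YM => //; exact: ZY.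
  - by move=> x Fx; exists X => //; exact: FX.
  - by move=> x [Y CY Yx]; have [_ _ YG _] := gC _ _ CY Yx; exact: YG.
  - by move=> y [Y CY Yy]; have [_ _ _ Y0] := gC _ _ CY Yy; exact: Y0.
have gF : good F by split.
have [sH FH HG H0] : good H.
  case: HP => // H0; case: (Hmax F); last by right.
  by rewrite H0; split=> // /(_ 1); apply; case: sF.
exists H; split=> //.
- move=> a; apply: contrapT => na.
  have [y Gay] := Gd a; pose t : E := (a, y).
  have Htp : H (t ^+ p).
    by apply: FH; exists t => //; exists 0; [exact: idl0|rewrite addr0].
  case: (Hmax (subring_adjoin p H t)).
    split; first exact: subring_adj_sub.
    by move=> /(_ t (subring_adj_gen t p1 sH)) Ht; apply: na; exists y.
  right; split.
  + exact: subring_adj_sr.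
  + by apply: subset_trans FH _; exact: subring_adj_sub.
  + move=> _ [h [Hh ->]]; apply: (subring_sum sG) => i; apply: GM; first exact: HG.
    exact: (srX _ sG).
  move=> w [h [Hh hE]].
  pose L : set k := [set b | exists z, H (b, z)].
  have [H1 HB' HM'] := sH.
  have sL : is_subring L.
    split; first by exists 1.
      by move=> b c [z Hz] [z' Hz']; exists (z - z'); exact: (HB' _ _ Hz Hz').
    by move=> b c [z Hz] [z' Hz']; exists (z * z'); exact: (HM' _ _ Hz Hz').
  have pairX (b : k) (z : R) n : ((b, z) : E) ^+ n = (b ^+ n, z ^+ n).
    by elim: n => // n IHn; rewrite !exprS IHn.
  have Lp b : L (b ^+ p).
    have [z Gz] := Gd b; exists (z ^+ p); rewrite -pairX; apply: FH; exists (b, z) => //.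
    by exists 0; [exact: idl0|rewrite addr0].
  have LV b : L b -> L b^-1.
    move=> Lb; have [->|b0] := eqVneq b 0; first by rewrite invr0; exact: subring0.
    have -> : b^-1 = b ^+ p.-1 * b^-1 ^+ p.
      have -> : b^-1 ^+ p = b^-1 ^+ p.-1 * b^-1 by rewrite -exprSr prednK.
      by rewrite mulrA -exprMn mulfV // expr1n mul1r.
    by have [_ _ LM] := sL; apply: LM => //; exact: srX.
  have sum1 n (x : 'I_n -> E) : (\sum_i x i).1 = \sum_i (x i).1.
    by apply: (big_morph (fun x : E => x.1)).
  have sum2 n (x : 'I_n -> E) : (\sum_i x i).2 = \sum_i (x i).2.
    by apply: (big_morph (fun x : E => x.2)).
  (* The first coordinates give a relation between the powers of [a] over [L]; independence forces
     every coefficient into [0 x R], where [H] is controlled. *)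
  have h0 i : (i < p)%N -> (h i).1 = 0.
    move: i; apply: (@insep_independent _ _ L a pk sL LV _ _ (fun i => (h i).1)) => [||j|].
    - exact: Lp.
    - by case=> z Hz; apply: na; exists z.
    - by exists (h j).2; have := Hh j; case: (h j).
    - have := congr1 (fun x : E => x.1) hE; rewrite /= sum1 => e; apply: etrans (esym e).
      by apply: eq_bigr => j _; rewrite /t pairX.
  have -> : w = \sum_(i < p) (h i).2 * y ^+ i.
    have := congr1 (fun x : E => x.2) hE; rewrite /= sum2 => ->.
    by apply: eq_bigr => j _; rewrite /t pairX.
  apply: idl_sum => // i _; apply: (idlMr _ iN); apply: H0.
  by have := Hh i; rewrite -(h0 i) //; case: (h i).
- by move=> a z /HG/Gpi.
- move=> z mz; apply: FH; exists 0; first exact: subring0.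
  by exists z => //; rewrite expr0n -[p]prednK //= add0r.
Qed.

Lemma coefficient_field N (B : comNzRingType) (f : {rmorphism R -> B}) :
  (forall x, f x = 0 <-> ideal_exp m N.+1 x) ->
  exists s : {rmorphism k -> B}, forall a, exists2 y, pi y = a & s a = f y.
Proof.
move=> fk; have [G [sG Gd Gpi G0 G0m]] : exists G, lift N.+1 G.
  elim: N {fk} => [|n [G lG]]; last exact: (lift_step _ lG).
  exists [set x | pi x.2 = x.1]; split.
  - split=> [|x y /= <- <-|x y /= <- <-]; first exact: rmorph1.
      exact: rmorphB.
    exact: rmorphM.
  - by move=> a; have [y ya] := pis a; exists y.
  - by move=> a y.
  - by move=> y /pik; rewrite iexp1.
  - by move=> y; rewrite iexp1 // => /pik.
have [_ GB GM] := sG; have [y yP] := choice Gd; pose s a := f (y a).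
have sE a z : G (a, z) -> s a = f z.
  move=> Gz; have Gyz : G (0, y a - z).
    by have := GB _ _ (yP a) Gz; rewrite (_ : _ - _ = (0, y a - z)) //; apply/pair_equal_spec; rewrite subrr.
  by have /fk/eqP := G0 _ Gyz; rewrite rmorphB subr_eq0 => /eqP.
have sB : zmod_morphism s.
  by move=> b c; rewrite (sE (b - c) (y b - y c)) ?rmorphB //; exact: (GB _ _ (yP b) (yP c)).
have sM : monoid_morphism s.
  split; first by rewrite (sE 1 1) ?rmorph1 //; case: sG.
  by move=> b c; rewrite (sE (b * c) (y b * y c)) ?rmorphM //; exact: (GM _ _ (yP b) (yP c)).
pose M1 := GRing.isZmodMorphism.Build k B s sB.
pose M2 := GRing.isMonoidMorphism.Build k B s sM.
pose S : {rmorphism k -> B} := HB.pack s M1 M2.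
by exists S => b; exists (y b) => //; exact: Gpi (yP b).
Qed.

End CoefficientField.

(** * Polynomial presentations *)

Section PolynomialRing.
Variables (k : fieldType) (n : nat).
Local Notation P := (ipoly k n).

Definition pmax : set P := ideal_gen [set` ivars k n].

Lemma ideal_pmax : ideal pmax. Proof. exact: idl_gen_ideal. Qed.

Lemma pmax_ivar i : pmax (ivars k n)`_i.
Proof.
have [lt_i|le_i] := ltnP i n; last by rewrite nth_default ?size_ivars //; exact: (idl0 ideal_pmax).
by apply: idl_gen_sub; rewrite /= mem_nth ?size_ivars.
Qed.

Lemma ipoly_split (x : P) : exists a, pmax (x - ipC k n a).
Proof.
have iM := ideal_pmax.
move: x; apply: (@ipoly_ind _ _ [set x | exists a, pmax (x - ipC k n a)]) => /=.
- by move=> a; exists a; rewrite subrr; exact: (idl0 iM).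
- by move=> i _; exists 0; rewrite rmorph0 subr0; exact: pmax_ivar.
- move=> x y [a xa] [b yb]; exists (a + b); rewrite rmorphD opprD addrACA.
  exact: (idlD iM).
- move=> x y [a xa] [b yb]; exists (a * b); rewrite rmorphM.
  have -> : x * y - ipC k n a * ipC k n b = x * (y - ipC k n b) + (x - ipC k n a) * ipC k n b by ring.
  by apply: (idlD iM); [exact: (idlM _ iM)|exact: (idlMr _ iM)].
Qed.

Lemma pmax_sum (x : P) : pmax x <-> exists g : nat -> P, x = \sum_(i < n) g i * (ivars k n)`_i.
Proof. by rewrite /pmax gen_seqP size_ivars. Qed.

Lemma ile_pmax : ile pmax setT 1.
Proof.
case=> [|[|m]] // [c [cP cS]].
have [ic mc _] := cP 1%N isT; have [ic0 mc0 _] := cP 0%N isT.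
have [_ nc1] := cS 1%N isT; have [_ nc0] := cS 0%N isT.
have /existsNP[x /not_implyP[cx ncx]] := nc0.
have [a xa] := ipoly_split x.
have a0 : a != 0.
  by apply/eqP => a0; apply: ncx; apply: mc0; move: xa; rewrite a0 rmorph0 subr0.
have c1 : c 1%N 1.
  have -> : 1 = ipC k n a^-1 * (x - (x - ipC k n a)) by rewrite subKr -rmorphM mulVf ?rmorph1.
  by apply: (idlM _ ic); apply: (idlB ic) => //; exact: mc.
by case: nc1 => z _; rewrite (idl1 ic c1).
Qed.

Lemma ile_pmax_exp N : exists l, ile (ideal_exp pmax N) setT l.
Proof.
exists (N ^ n * 1)%N.
have i0 : ideal [set (0 : P)] := @ideal_set0 P.
have := @ile_pows _ [set 0] (ivars k n) N 1 i0; rewrite !sadd0 size_ivars => /(_ ile_pmax).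
apply: ile_sub => //; apply: idl_gen_min; first exact: iexp_ideal.
by move=> _ /= /mapP[x xz ->]; apply: iexpX; exact: idl_gen_sub.
Qed.

End PolynomialRing.
Arguments pmax : clear implicits.

(** Substitute for Nakayama's lemma in polynomial rings, which are not local: the hypothesis is
    iterated [j] times. *)
Lemma iterated_sub (A : comNzRingType) (J K M : set A) j : ideal J -> ideal K ->
  K `<=` sadd J (imul M K) -> K `<=` sadd J (ideal_exp M j).
Proof.
move=> iJ iK sub; have: K `<=` sadd J (imul (ideal_exp M j) K).
  elim: j => [|j IHj].
    by apply: subset_trans (isadd_r iJ) => x Kx; rewrite -(mul1r x); exact: imulP.
  have iJj : ideal (sadd J (imul (ideal_exp M j.+1) K)) := ideal_sadd iJ (ideal_imul _ _).
  apply: subset_trans IHj _; apply: (isadd_min iJj); first exact: (isadd_l (ideal_imul _ _)).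
  apply: (imul_min iJj) => x y Mx /sub[u [v [Ju Kv ->]]]; rewrite mulrDr.
  apply: (idlD iJj); first by apply: (isadd_l (ideal_imul _ _)); exact: idlM.
  apply: (isadd_r iJ); move: Kv; apply: (@imul_min _ _ _ [set v | imul (ideal_exp M j.+1) K (x * v)]).
    apply: mk_ideal => /=; first by rewrite mulr0; exact: (idl0 (ideal_imul _ _)).
      by move=> a b Ha Hb; rewrite mulrDr; exact: (idlD (ideal_imul _ _)).
    by move=> a b Hb; rewrite mulrCA; exact: (idlM _ (ideal_imul _ _)).
  move=> a b Ma Kb /=; rewrite mulrA; apply: imulP => //; rewrite mulrC; exact: imulP.
move/subset_trans; apply; apply: isaddS => //; exact: imul_subl (iexp_ideal _ _).
Qed.

Section Presentation.
Variables (R Q : comNzRingType) (f : seq Q)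
  (phi : {rmorphism Q -> completion (@max_idealr R)}) (k : fieldType) (p : nat).
Hypotheses (locR : noeth_local R) (regQ : regular_local Q) (regf : regular_sequence f)
  (phis : forall y, exists x, phi x = y)
  (phik : forall x, phi x = 0 <-> ideal_gen [set` f] x)
  (pR : p \in [pchar R]) (pk : p \in [pchar k])
  (resR : has_residue_field R k).

Let lR : loc (max_ideal R). Proof. by have [] := noeth_local_loc locR. Qed.
Let lQ : loc (max_ideal Q). Proof. by case: regQ => /noeth_local_loc[]. Qed.
Let n := krull_dim Q.
Local Notation P := (ipoly k n).
Local Notation M := (pmax k n).

(** The relations [F] lift expressions of [f] in the regular parameters [ys] of [Q]. That they
    generate the kernel [K] of [rho] up to [M^(N+1)] is reduced to [K] lying in [J + M K]: a
    relation between the images of the [ys] is carried to [Q], becomes an exact relation after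
    correction by [f] and [mQ^(N+1)], is therefore Koszul, and is carried back to [P]. *)
Lemma presentation N : exists (B : comNzRingType) (f1 : {rmorphism R -> B})
    (rho : {rmorphism P -> B}) (F : seq P),
  [/\ [/\ forall y, exists x, f1 x = y, forall x, f1 x = 0 <-> ideal_exp (max_ideal R) N.+1 x &
      forall y, exists x, rho x = y],
      rho @` M = f1 @` max_ideal R, size F = size f, [set` F] `<=` M &
      forall x, rho x = 0 <-> sadd (ideal_gen [set` F]) (ideal_exp M N.+1) x].
Proof.
have [B [f1 [pQ [f1s pQs f1k pQk]]]] := completion_quot locR lQ phis phik N.
have [pi [pis pik]] := resR.
have [s sP] := coefficient_field lR pR pk pis pik f1k.
have [ys [sy myE reg]] := regular_local_seq regQ.
have [rho [rhoC rhoX]] := ipoly_eval s (fun i => pQ ys`_i) n.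
have [iR _ uR] := lR; have [iQ q1 uQ] := lQ.
have mE : pQ @` max_ideal Q = f1 @` max_ideal R by rewrite (loc_im pQs lQ) (loc_im f1s lR).
pose mB := f1 @` max_ideal R; have imB : ideal mB := ideal_im f1s iR.
have mB1 : ~ mB 1 by have [] := loc_surj f1s lR.
have mBy i : mB (pQ ys`_i).
  rewrite /mB -mE; exists ys`_i => //; rewrite myE.
  have [lt_i|le_i] := ltnP i (size ys); first by apply: idl_gen_sub => /=; exact: mem_nth.
  by rewrite nth_default //; exact: (idl0 (idl_gen_ideal _)).
have mBP b : mB b -> exists c : nat -> Q, b = \sum_(i < n) pQ (c i) * pQ ys`_i.
  rewrite /mB -mE myE => -[q /gen_seqP[c ->] <-]; exists c.
  by rewrite rmorph_sum sy; apply: eq_bigr => i _; rewrite rmorphM.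
have mBN b : ideal_exp mB N.+1 b -> b = 0.
  by rewrite /mB -iexp_im // => -[x /f1k x0 <-].
have rhos y : exists x, rho x = y.
  have H j : forall b, exists a, ideal_exp mB j (b - rho a).
    elim: j => [|j IHj] b; first by exists 0.
    have [r rb] := f1s b; have [y' yr sy'] := sP (pi r).
    have : mB (b - rho (ipC k n (pi r))).
      rewrite rhoC sy' -rb -rmorphB; exists (r - y') => //; apply/pik.
      by rewrite rmorphB yr subrr.
    move=> /mBP[c cE]; have [a aP] := choice (fun i => IHj (pQ (c i))).
    exists (ipC k n (pi r) + \sum_(i < n) a i * (ivars k n)`_i).
    rewrite rmorphD opprD addrA cE rmorph_sum -sumrB; apply: idl_sum => [|i _]; first exact: iexp_ideal.
    rewrite rmorphM rhoX // -mulrBl mulrC iexpS; apply: imulP => //; exact: mBy.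
  by have [a /mBN/eqP] := H N.+1 y; rewrite subr_eq0 => /eqP ->; exists a.
have rhoM : rho @` M = mB.
  apply/seteqP; split.
    move=> _ [x /pmax_sum[g ->] <-]; rewrite rmorph_sum; apply: idl_sum => // i _.
    by rewrite rmorphM rhoX //; apply: (idlM _ imB); exact: mBy.
  move=> b /mBP[c ->]; have [a aP] := choice (fun i => rhos (pQ (c i))).
  exists (\sum_(i < n) a i * (ivars k n)`_i); first by apply/pmax_sum; exists a.
  by rewrite rmorph_sum; apply: eq_bigr => i _; rewrite rmorphM rhoX // aP.
have fm : ideal_gen [set` f] `<=` max_ideal Q.
  apply: (loc_sub lQ); first exact: idl_gen_ideal.
  by move=> f1'; apply: regf.2; apply: idl1 => //; exact: idl_gen_ideal.
have [g gP] : exists g : nat -> nat -> Q, forall j, f`_j = \sum_(i < n) g j i * ys`_i.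
  have H j : exists g : nat -> Q, f`_j = \sum_(i < n) g i * ys`_i.
    have : max_ideal Q f`_j.
      have [lt_j|le_j] := ltnP j (size f); first by apply: fm; apply: idl_gen_sub => /=; exact: mem_nth.
      by rewrite nth_default //; exact: idl0.
    by rewrite myE => /gen_seqP[g gE]; exists g; rewrite gE sy.
  by have [g gP] := choice H; exists g.
have [tau tauP] := choice (fun q => rhos (pQ q)).
have [la laP] := choice (fun a => pQs (rho a)).
pose F := mkseq (fun j => \sum_(i < n) tau (g j i) * (ivars k n)`_i) (size f).
exists B, f1, rho, F; split => //; first by rewrite size_mkseq.
  by move=> _ /= /mapP[j _ ->]; apply/pmax_sum; exists (fun i => tau (g j i)).
have Fj j : (j < size f)%N -> F`_j = \sum_(i < n) tau (g j i) * (ivars k n)`_i.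
  by move=> lt_j; rewrite nth_mkseq.
have rhoF j : (j < size f)%N -> rho F`_j = 0.
  move=> lt_j; rewrite Fj // rmorph_sum; transitivity (pQ f`_j).
    by rewrite gP rmorph_sum; apply: eq_bigr => i _; rewrite !rmorphM rhoX // tauP.
  by apply/pQk; apply: (isadd_l (iexp_ideal _ _)); apply: idl_gen_sub => /=; exact: mem_nth.
have rhoN x : ideal_exp M N.+1 x -> rho x = 0.
  move=> Mx; apply: mBN; apply: iexp_preim Mx => a Ma; rewrite -rhoM; exact: imageP.
pose J := sadd (ideal_gen [set` F]) (ideal_exp M N.+1).
have iJ : ideal J := ideal_sadd (idl_gen_ideal _) (iexp_ideal _ _).
pose K : set P := [set x | rho x = 0].
have iK : ideal K.
  apply: mk_ideal; rewrite /K /=; first exact: rmorph0.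
    by move=> x y; rewrite rmorphD => -> ->; rewrite addr0.
  by move=> a x; rewrite rmorphM => ->; rewrite mulr0.
have JK : J `<=` K.
  apply: (isadd_min iK) => //; apply: (idl_gen_min iK) => x /= /(nthP 0)[j + <-].
  by rewrite size_mkseq => /rhoF.
move=> x; split; last exact: JK.
suff : K `<=` sadd J (imul M K).
  move=> /(@iterated_sub _ J K M N.+1 iJ iK) sub /sub; apply: (isadd_min iJ) => //.
  exact: (isadd_r (idl_gen_ideal _)).
move=> {}x Kx.
have [gx xE] : exists g : nat -> P, x = \sum_(i < n) g i * (ivars k n)`_i.
  apply/pmax_sum; have [a xa] := ipoly_split x.
  suff a0 : a = 0 by move: xa; rewrite a0 rmorph0 subr0.
  apply/eqP; apply: contrapT => /negP a0; apply: mB1.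
  have : mB (rho (x - ipC k n a)) by rewrite -rhoM; exact: imageP.
  rewrite rmorphB (_ : rho x = 0) // sub0r rhoC => /(idlN imB); rewrite opprK => /(idlM (s a^-1) imB).
  by rewrite -rmorphM mulVf // rmorph1.
have [b [mu [muP E]]] : exists b : nat -> Q, exists mu : nat -> Q,
    (forall i, ideal_exp (max_ideal Q) N (mu i)) /\
    \sum_(i < n) la (gx i) * ys`_i = \sum_(j < size f) b j * f`_j + \sum_(i < n) mu i * ys`_i.
  have : pQ (\sum_(i < n) la (gx i) * ys`_i) = 0.
    have <- : rho x = 0 by [].
    by rewrite xE !rmorph_sum; apply: eq_bigr => i _; rewrite !rmorphM laP rhoX.
  move/pQk => [u [v [/gen_seqP[b ->] mv ->]]]; move: mv.
  rewrite iexpS {1}myE => /(imul_gen_split (iexp_ideal _ _))[mu [muP ->]].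
  by exists b, mu; rewrite sy.
pose r i := la (gx i) - \sum_(j < size f) b j * g j i - mu i.
have r0 : [set 0] (\sum_(i < size ys) r i * ys`_i).
  rewrite /= sy (eq_bigr (fun i : 'I_n => la (gx i) * ys`_i -
      (\sum_(j < size f) b j * g j i) * ys`_i - mu i * ys`_i)) => [|i _]; last by rewrite /r !mulrBl.
  rewrite !sumrB E (eq_bigr (fun j : 'I_(size f) => \sum_(i < n) b j * g j i * ys`_i)) => [|j _]; last first.
    by rewrite gP mulr_sumr; apply: eq_bigr => i _; rewrite mulrA.
  rewrite exchange_big /= [X in _ - X - _](eq_bigr (fun i : 'I_n => \sum_(j < size f) b j * g j i * ys`_i)) => [|i _]; last first.
    by rewrite mulr_suml.
  by rewrite [X in X - _ - _]addrC addrK subrr.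
have [kap [kA k0 kP]] := koszul_syzygies (@ideal_set0 Q) reg r0.
have [nu nuP] : exists nu : nat -> P, forall i, ideal_exp M N (nu i) /\ rho (nu i) = pQ (mu i).
  have H i : exists u, ideal_exp M N u /\ rho u = pQ (mu i).
    have : (rho @` ideal_exp M N) (pQ (mu i)).
      by rewrite iexp_im // rhoM /mB -mE -iexp_im //; exists (mu i).
    by case=> u Mu uE; exists u.
  by have [nu nuP] := choice H; exists nu.
(* [tau] is only a set-theoretic lift, so antisymmetry has to be imposed on the lifted Koszul matrix
   for its contribution to cancel. *)
pose T i l := if (i < l)%N then tau (kap i l) else if (l < i)%N then - tau (kap l i) else 0.
have TA i l : T i l = - T l i.
  by rewrite /T; case: ltngtP => //=; rewrite ?opprK ?oppr0.
have T0 i : T i i = 0 by rewrite /T ltnn.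
have rhoT i l : rho (T i l) = pQ (kap i l).
  rewrite /T; case: ltngtP => [||->]; rewrite ?rmorphN ?tauP //.
    by rewrite [in RHS]kA rmorphN.
  by rewrite k0 !rmorph0.
pose h i := gx i - \sum_(j < size f) tau (b j) * tau (g j i) - nu i - \sum_(l < n) T i l * (ivars k n)`_l.
have Kh i : (i < n)%N -> K (h i).
  move=> lt_i; have := kP i; rewrite sy => /(_ lt_i) /eqP; rewrite subr_eq0 => /eqP rE.
  rewrite /K /= /h !rmorphB !rmorph_sum (nuP i).2 -laP.
  rewrite (eq_bigr (fun j : 'I_(size f) => pQ (b j * g j i))) => [|j _]; last by rewrite !rmorphM !tauP.
  rewrite [X in _ - X](eq_bigr (fun l : 'I_n => pQ (kap i l * ys`_l))) => [|l _]; last first.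
    by rewrite !rmorphM rhoT rhoX.
  by rewrite -!rmorph_sum -!rmorphB -/(r i) rE subrr rmorph0.
have TT := antisym_sum (ivars k n) TA T0; rewrite size_ivars in TT.
exists (\sum_(j < size f) tau (b j) * F`_j + \sum_(i < n) nu i * (ivars k n)`_i),
  (\sum_(i < n) h i * (ivars k n)`_i); split.
- exists (\sum_(j < size f) tau (b j) * F`_j), (\sum_(i < n) nu i * (ivars k n)`_i); split=> //.
    by apply/gen_seqP; exists (fun j => tau (b j)); rewrite size_mkseq.
  apply: idl_sum => [|i _]; first exact: iexp_ideal.
  by rewrite mulrC iexpS; apply: imulP; [exact: pmax_ivar|exact: (nuP i).1].
- apply: idl_sum => [|i _]; first exact: ideal_imul.
  by rewrite mulrC; apply: imulP; [exact: pmax_ivar|exact: Kh].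
rewrite [X in _ = _ + X](eq_bigr (fun i : 'I_n => gx i * (ivars k n)`_i -
    (\sum_(j < size f) tau (b j) * tau (g j i)) * (ivars k n)`_i - nu i * (ivars k n)`_i -
    (\sum_(l < n) T i l * (ivars k n)`_l) * (ivars k n)`_i)) => [|i _]; last by rewrite /h !mulrBl.
rewrite !sumrB TT subr0 -xE.
have -> : \sum_(j < size f) tau (b j) * F`_j =
    \sum_(i < n) (\sum_(j < size f) tau (b j) * tau (g j i)) * (ivars k n)`_i.
  rewrite (eq_bigr (fun j : 'I_(size f) => \sum_(i < n) tau (b j) * tau (g j i) * (ivars k n)`_i)) => [|j _].
    by rewrite exchange_big; apply: eq_bigr => i _; rewrite mulr_suml.
  by rewrite Fj // mulr_sumr; apply: eq_bigr => i _; rewrite mulrA.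
by rewrite -[x - _ - _]addrA -opprD [RHS]addrC subrK.
Qed.

End Presentation.

Lemma gen_exchange (A : comNzRingType) (zs : seq A) (c : nat -> A) l u :
  (l < size zs)%N -> c l * u = 1 ->
  ideal_gen [set` \sum_(j < size zs) c j * zs`_j :: take l zs ++ drop l.+1 zs] = ideal_gen [set` zs].
Proof.
move=> lt_l clu; set y := \sum_(j < _) _; set zs' := _ ++ _.
have zsP j : (j < size zs)%N -> j != l -> zs`_j \in zs'.
  move=> lt_j; rewrite neq_ltn mem_cat => /orP[lt_jl|lt_lj].
    by rewrite -(nth_take 0 lt_jl) mem_nth // size_take lt_l.
  by rewrite -(subnKC lt_lj) -nth_drop mem_nth ?orbT // size_drop ltn_sub2r // (leq_ltn_trans lt_lj).
have iG := idl_gen_ideal [set` y :: zs'].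
apply/seteqP; split; apply: idl_gen_min; try exact: idl_gen_ideal.
  move=> x /=; rewrite inE => /orP[/eqP ->|].
    by apply/gen_seqP; exists c.
  by rewrite mem_cat => xz; apply: idl_gen_sub => /=; move: xz => /orP[/mem_take|/mem_drop].
move=> x /= /(nthP 0)[j lt_j <-].
have [->|ne_jl] := eqVneq j l; last first.
  by apply: idl_gen_sub => /=; rewrite inE zsP // orbT.
have -> : zs`_l = u * (y - \sum_(j < size zs | j != Ordinal lt_l) c j * zs`_j).
  by rewrite /y (bigD1 (Ordinal lt_l)) //= addrK mulrA [u * _]mulrC clu mul1r.
apply: (idlM _ iG); apply: (idlB iG); first by apply: idl_gen_sub; rewrite /= mem_head.
apply: idl_sum => // j' ne_j; apply: (idlM _ iG); apply: idl_gen_sub => /=.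
by rewrite inE zsP // orbT.
Qed.

Section QuadraticRelation.
Variables (R : comNzRingType) (k : fieldType) (n N : nat) (B : comNzRingType)
  (f1 : {rmorphism R -> B}) (rho : {rmorphism ipoly k n -> B}) (F : seq (ipoly k n)).
Hypotheses (locR : noeth_local R) (nregR : ~ regular_local R)
  (f1s : forall y, exists x, f1 x = y)
  (f1k : forall x, f1 x = 0 <-> ideal_exp (max_ideal R) N.+2 x)
  (rhoM : rho @` pmax k n = f1 @` max_ideal R) (FM : [set` F] `<=` pmax k n)
  (rhok : forall x, rho x = 0 <-> sadd (ideal_gen [set` F]) (ideal_exp (pmax k n) N.+2) x)
  (nE : n = (krull_dim R + size F)%N).
Local Notation P := (ipoly k n).
Local Notation M := (pmax k n).
Local Notation M2 := (ideal_exp M 2).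

Let x_ (i : nat) : P := (ivars k n)`_i.
Let lin (r : 'rV[k]_n) : P := \sum_(i < n) ipC k n (r 0 i) * x_ i.

Let linD a r t : lin (a *: r + t) = ipC k n a * lin r + lin t.
Proof.
rewrite /lin mulr_sumr -big_split; apply: eq_bigr => i _.
by rewrite !mxE /= rmorphD rmorphM mulrDl mulrA.
Qed.

Let lin0 : lin 0 = 0.
Proof. by rewrite /lin big1 // => i _; rewrite mxE rmorph0 mul0r. Qed.

Let lin_mul c (u : 'rV[k]_c) (W : 'M[k]_(c, n)) :
  lin (u *m W) = \sum_(l < c) ipC k n (u 0 l) * lin (row l W).
Proof.
rewrite /lin (eq_bigr (fun l : 'I_c => \sum_(i < n) ipC k n (u 0 l * W l i) * x_ i)) => [|l _].
  rewrite exchange_big; apply: eq_bigr => i _ /=.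
  by rewrite mxE rmorph_sum mulr_suml.
by rewrite mulr_sumr; apply: eq_bigr => i _; rewrite mxE rmorphM mulrA.
Qed.

Let linear_part x : M x -> exists r : 'rV[k]_n, M2 (x - lin r).
Proof.
move=> /pmax_sum[g ->]; have [a aP] := choice (fun i => ipoly_split (g i)).
exists (\row_i a i); rewrite /lin -sumrB; apply: idl_sum => [|i _]; first exact: iexp_ideal.
rewrite mxE -mulrBl mulrC iexpS iexp1; last exact: ideal_pmax.
by apply: imulP; [exact: pmax_ivar|exact: aP].
Qed.

(** The linear parts of the relations form a matrix over [k]. If its rows are dependent, some
    combination of relations has no linear part and can replace one of them. If they are
    independent, a complement of their span provides [krull_dim R] linear forms that generate the
    maximal ideal of [R] modulo its square, and [R] would be regular. *)
Lemma quadratic_relation : exists (F0 : P) (Fs : seq P),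
  [/\ M2 F0, [set` Fs] `<=` M, (size Fs).+1 = size F &
      ideal_gen [set` F0 :: Fs] = ideal_gen [set` F]].
Proof.
have [nR lR] := noeth_local_loc locR; have [iR R1 uR] := lR.
have iM := ideal_pmax k n; have i2 := iexp_ideal M 2.
pose c := size F.
have [a aP] : exists a : nat -> 'rV[k]_n, forall j, M2 (F`_j - lin (a j)).
  have H j : exists r, M2 (F`_j - lin r).
    apply: linear_part; have [lt_j|le_j] := ltnP j c; first by apply: FM; rewrite /= mem_nth.
    by rewrite nth_default //; exact: (idl0 iM).
  by have [a aP] := choice H; exists a.
pose A : 'M[k]_(c, n) := \matrix_(j < c) a j.
have rowA j : row j A = a j by rewrite rowK.
have linA (u : 'rV_c) : M2 (\sum_(j < c) ipC k n (u 0 j) * F`_j - lin (u *m A)).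
  rewrite lin_mul -sumrB; apply: idl_sum => // j _; rewrite rowA -mulrBr.
  exact: (idlM _ i2).
have [freeA|nfreeA] := boolP (row_free A); last first.
  have /rowV0Pn[u /sub_kermxP uA u0] : kermx A != 0 by rewrite kermx_eq0.
  have [j0 uj0] : exists j0, u 0 j0 != 0.
    apply/existsP; apply: contraR u0; rewrite negb_exists => /forallP u0.
    by apply/eqP/rowP => j; rewrite mxE; apply/eqP; have := u0 j; rewrite negbK.
  pose cf j := if insub j is Some j' then ipC k n (u 0 (j' : 'I_c)) else 0.
  have cfE (j : 'I_c) : cf j = ipC k n (u 0 j) by rewrite /cf valK.
  have lt_j0 : (j0 < size F)%N := ltn_ord j0.
  have cu : cf j0 * ipC k n (u 0 j0)^-1 = 1 by rewrite cfE -rmorphM mulfV ?rmorph1.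
  exists (\sum_(j < size F) cf j * F`_j), (take j0 F ++ drop j0.+1 F); split.
  - rewrite (eq_bigr (fun j : 'I_c => ipC k n (u 0 j) * F`_j)) => [|j _]; last by rewrite cfE.
    by have := linA u; rewrite uA lin0 subr0.
  - by move=> x /= xF; apply: FM => /=; move: xF; rewrite mem_cat => /orP[/mem_take|/mem_drop].
  - by rewrite size_cat size_take size_drop lt_j0; lia.
  - exact: gen_exchange cu.
exfalso; apply: nregR; split=> //.
pose W := row_base (A^C)%MS.
have rW : \rank (A^C)%MS = krull_dim R.
  by rewrite mxrank_compl; move: freeA; rewrite /row_free => /eqP ->; rewrite nE addnK.
pose w := [seq lin (row l W) | l <- enum 'I_(\rank (A^C)%MS)].
have sw : size w = krull_dim R by rewrite size_map size_enum_ord.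
have Mlin r : M (lin r).
  apply/pmax_sum; exists (fun i => if insub i is Some i' then ipC k n (r 0 (i' : 'I_n)) else 0).
  by apply: eq_bigr => i _; rewrite valK.
pose J := sadd (ideal_gen [set` F]) (sadd (ideal_gen [set` w]) M2).
have iJ : ideal J := ideal_sadd (idl_gen_ideal _) (ideal_sadd (idl_gen_ideal _) i2).
have MJ : M `<=` J.
  apply: (idl_gen_min iJ) => x /= /(nthP 0)[i]; rewrite size_ivars => lt_i <-.
  have -> : (ivars k n)`_i = lin (delta_mx 0 (Ordinal lt_i)).
    rewrite /lin (bigD1 (Ordinal lt_i)) //= mxE !eqxx rmorph1 mul1r big1 ?addr0 // => j ne_j.
    by rewrite mxE (negPf ne_j) andbF rmorph0 mul0r.
  have sub : ((delta_mx 0 (Ordinal lt_i) : 'rV[k]_n) <= A + W)%MS.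
    have full : row_full (A + W)%MS.
      rewrite -sub1mx; apply: submx_trans (addsmxS (submx_refl A) _ : (A + A^C <= _)%MS).
        by rewrite sub1mx addsmx_compl_full.
      by rewrite eq_row_base.
    exact: submx_full.
  have [[u v] /= ->] := sub_addsmxP sub.
  have := linD 1 (u *m A) (v *m W); rewrite scale1r rmorph1 mul1r => ->.
  apply: (idlD iJ).
    rewrite -(subKr (\sum_(j < c) ipC k n (u 0 j) * F`_j) (lin (u *m A))); apply: (idlB iJ).
      apply: (isadd_l (ideal_sadd (idl_gen_ideal _) i2)).
      apply: idl_sum => [|j _]; first exact: idl_gen_ideal.
      by apply: (idlM _ (idl_gen_ideal _)); apply: idl_gen_sub => /=; exact: mem_nth.
    by apply: (isadd_r (idl_gen_ideal _)); apply: (isadd_r (idl_gen_ideal _)); exact: linA.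
  apply: (isadd_r (idl_gen_ideal _)); apply: (isadd_l i2).
  rewrite lin_mul; apply: idl_sum => [|l _]; first exact: idl_gen_ideal.
  by apply: (idlM _ (idl_gen_ideal _)); apply: idl_gen_sub => /=; apply: map_f; rewrite mem_enum.
have [t tP] := choice (fun b => f1s (rho b)).
exists (map t w); split; first by rewrite size_map.
apply/seteqP; split; last first.
  apply: (idl_gen_min iR) => _ /= /mapP[_ /mapP[l _ ->] ->].
  have [y my yE] : (f1 @` max_ideal R) (rho (lin (row l W))) by rewrite -rhoM; exact: imageP.
  rewrite -(subrK y (t _)); apply: (idlD iR) => //.
  by apply: (@iexp_sub _ _ N.+2) => //; apply/f1k; rewrite rmorphB tP yE subrr.
apply: (nakayama nR lR) => //; first exact: idl_gen_ideal.
move=> x mx; have [y My yE] : (rho @` M) (f1 x) by rewrite rhoM; exact: imageP.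
have [g [_ [Fg [h [q [/gen_seqP[e hE] q2 ->]] yE']]]] := MJ _ My.
pose h' := \sum_(i < size w) t (e i) * (map t w)`_i.
have [q' m2q' qE] : (f1 @` ideal_exp (max_ideal R) 2) (rho q).
  by rewrite iexp_im // -rhoM; apply: iexp_preim q2 => b Mb; exact: imageP.
have g0 : rho g = 0 by apply/rhok; apply: (isadd_l (iexp_ideal _ _)).
have hh : f1 h' = rho h.
  rewrite /h' hE !rmorph_sum; apply: eq_bigr => i _.
  by rewrite (nth_map 0) // !rmorphM !tP.
exists h', (x - h'); split; last by rewrite addrC subrK.
  by apply/gen_seqP; exists (fun i => t (e i)); rewrite size_map.
have -> : imul (max_ideal R) (max_ideal R) = ideal_exp (max_ideal R) 2 by rewrite iexpS iexp1.
rewrite -(subrK q' (x - h')); apply: (idlD (iexp_ideal _ _)) => //.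
apply: (@iexp_le _ _ 2 N.+2) => //; apply/f1k.
by rewrite !rmorphB hh qE -yE yE' !rmorphD g0 add0r; ring.
Qed.

End QuadraticRelation.

(** * Semicontinuity of colength *)

Section PolynomialIdeals.
Variable A : comNzRingType.
Implicit Types (I J : set A) (f g : {poly A}).

Definition polyI I : set {poly A} := [set f | forall i, I f`_i].

Lemma ideal_polyI I : ideal I -> ideal (polyI I).
Proof.
move=> iI; apply: mk_ideal => /=; first by move=> i; rewrite coef0; exact: idl0.
  by move=> f g If Ig i; rewrite coefD; exact: idlD.
by move=> f g Ig i; rewrite coefM; apply: idl_sum => // j _; exact: idlM.
Qed.

Lemma polyI_C I a : ideal I -> I a -> polyI I a%:P.
Proof. by move=> iI Ia [|i]; rewrite coefC //=; exact: idl0. Qed.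

Lemma polyIM I J K f g : ideal K -> (forall x y, I x -> J y -> K (x * y)) ->
  polyI I f -> polyI J g -> polyI K (f * g).
Proof. by move=> iK IJ If Jg i; rewrite coefM; apply: idl_sum => // j _; exact: IJ. Qed.

Lemma polyI_split (z : seq A) J f : ideal J -> polyI (imul (ideal_gen [set` z]) J) f ->
  exists e : nat -> {poly A}, (forall i, polyI J (e i)) /\ f = \sum_(i < size z) (z`_i)%:P * e i.
Proof.
move=> iJ Pf; have H j := imul_gen_split iJ (Pf j).
have [r rP] := choice H.
exists (fun i => \poly_(j < size f) r j i); split=> [i j|].
  by rewrite coef_poly; case: ifP => _; [exact: (rP j).1|exact: idl0].
apply/polyP => j; rewrite coef_sum.
have [lt_j|le_j] := ltnP j (size f); last first.
  rewrite nth_default // big1 // => i _.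
  by rewrite coefCM coef_poly ltnNge le_j mulr0.
rewrite {1}(rP j).2; apply: eq_bigr => i _.
by rewrite coefCM coef_poly lt_j mulrC.
Qed.

(** Each of the [m] layers between ['X^(j+1)] and ['X^j] is a copy of [A / I]. *)
Lemma poly_ige I t m : ideal I -> ige I setT t ->
  ige (sadd (princ 'X^m) (polyI I)) setT (m * t).
Proof.
move=> iI It; have ipI := ideal_polyI iI.
pose Y j := sadd (princ ('X^j : {poly A})) (polyI I).
have iY j : ideal (Y j) := ideal_sadd (ideal_princ _) ipI.
have Y1P f : Y 1%N f <-> I f`_0.
  split=> [[_ [g [[q ->] Ig ->]]]|If].
    by rewrite coefD coefMXn add0r; exact: Ig.
  exists (drop_poly 1 f * 'X^1), (take_poly 1 f); rewrite addrC poly_take_drop.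
  split=> //; first by exists (drop_poly 1 f).
  by move=> i; rewrite coef_take_poly; case: i => //= i; exact: idl0.
have base : ige (Y 1%N) setT t.
  pose ev : {rmorphism {poly A} -> A} := GRing.RMorphism.clone _ _ (horner_eval 0) _.
  have evE f : ev f = f`_0 by rewrite /= /horner_eval horner_coef0.
  have evs a : exists f, ev f = a by exists a%:P; rewrite evE coefC.
  have kI f : ev f = 0 -> Y 1%N f by rewrite evE => f0; apply/Y1P; rewrite f0; exact: idl0.
  apply/(@ige_surj _ _ ev evs (Y 1%N) kI).
  have -> // : ev @` Y 1%N = I.
  apply/seteqP; split=> [_ [f /Y1P If <-]|a Ia]; first by rewrite evE.
  by exists a%:P; [apply/Y1P; rewrite coefC|rewrite evE coefC].
elim: m => [|m IHm].
  exact: (@lenge0 _ {poly A}^o _ _ (iY 0%N) (@subsetT _ _)).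
rewrite mulSn; apply: (@ige_cat _ _ (Y m)) => //.
have := ige_colon (x := 'X^m) (iY m.+1) _ base.
move=> h; apply: (@lenge_sub _ {poly A}^o _ _ _ _ _ _ _ (h _)) => //.
  apply: (isadd_min (iY m)); last exact: isadd_l.
  apply: (isadd_min (iY m)); last exact: (isadd_r (ideal_princ _)).
  by move=> _ [f ->]; apply: (isadd_l ipI); exists (f * 'X); rewrite exprS mulrA.
move=> f [_ [g [[q ->] Ig E]]]; apply/Y1P.
have := congr1 (fun u : {poly A} => u`_m) E; rewrite coefD !coefMXn ltnn subnn ltnSn add0r => ->.
exact: Ig.
Qed.

End PolynomialIdeals.

(* Modulo the family [G_j + 'X F_j], a polynomial with leading coefficient in
   [(F, I)] can be lowered in degree, so each degree below [m] contributes at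
   most [u]. *)
Lemma semicontinuity (A : comNzRingType) (I : set A) (G F : nat -> A) c m K u l0 : ideal I ->
  ile I setT l0 -> ile (sadd (ideal_gen [set` mkseq F c]) I) setT u ->
  ige (sadd (princ 'X^m) (sadd (ideal_gen [set` mkseq (fun j => (G j)%:P + 'X * (F j)%:P) c])
    (polyI I))) setT K -> (K <= m * u + l0)%N.
Proof.
move=> iI fI fF; set J := sadd (princ _) _ => gK.
have ipI := ideal_polyI iI.
pose N i : set {poly A} := [set f | (size f <= i)%N].
have smN i : submodule (N i).
  split; first by rewrite /N /= size_poly0.
  move=> a f g Nf Ng; apply: leq_trans (size_polyD _ _) _; rewrite geq_max.
  by rewrite (leq_trans (size_scale_leq _ _) Nf).
pose comb h := \sum_(j < c) h j * ((G j)%:P + 'X * (F j)%:P) : {poly A}.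
(* The bound on the multipliers [h j] keeps their combinations in degree at most [m], where the
   family is an [A]-submodule and lengths are counted over [A]. *)
pose W := [set f | N m.+1 f /\ exists h : nat -> {poly A}, (forall j, (size (h j) <= m)%N) /\ polyI I (f - comb h)].
have subW : submodule W.
  split.
    split; first exact: sub0 (smN _).
    exists (fun=> 0); rewrite size_poly0; split=> // i; rewrite /comb big1 ?subr0 ?coef0 => [|j _].
      exact: idl0.
    by rewrite mul0r.
  move=> a f g [Nf [h [sh If]]] [Ng [h' [sh' Ig]]]; split; first exact: (smN m.+1).2.
  exists (fun j => a *: h j + h' j); split=> [j|].
    apply: leq_trans (size_polyD _ _) _; rewrite geq_max sh' andbT.
    exact: leq_trans (size_scale_leq _ _) (sh j).
  have -> : a *: f + g - comb (fun j => a *: h j + h' j) = a%:P * (f - comb h) + (g - comb h').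
    rewrite /comb (eq_bigr (fun j : 'I_c => a%:P * (h j * ((G j)%:P + 'X * (F j)%:P)) +
       h' j * ((G j)%:P + 'X * (F j)%:P))) => [|j _]; last by rewrite -mul_polyC mulrDl mulrA.
    rewrite big_split -mulr_sumr /= -mul_polyC.
    by move: (\sum_(j < c) _) (\sum_(j < c) _) => U V; ring.
  by apply: (idlD ipI) => //; exact: (idlM _ ipI).
pose Y i := sadd W (N i).
have subY i : submodule (Y i) := submodule_sadd subW (smN i).
(* The constant layer is bounded only by [l0], because lowering a leading term by a member of the
   family requires positive degree. This error is independent of [m]. *)
have up i : (i <= m)%N -> @lenle A {poly A} W (Y i.+1) (i * u + l0).
  elim: i => [|i IHi] lt_im.
    rewrite mul0n add0n.
    apply: (@lenle_sub A {poly A} W (Y 1%N) W (sadd W ((fun a : A => a%:P : {poly A}) @` setT))) => //.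
      move=> _ [f [g [Wf Ng ->]]]; exists f, g; split=> //; exists g`_0 => //.
      by rewrite -size1_polyC.
    apply: (@lenle_image A A^o {poly A} (fun a : A => a%:P)) fI => //.
      by move=> a x y; rewrite polyCD -mul_polyC -polyCM.
    move=> a Ia; split; first by apply: leq_trans (size_polyC_leq1 _) _.
    exists (fun=> 0); rewrite size_poly0; split=> //; rewrite /comb big1 ?subr0 => [|j _].
      exact: polyI_C.
    by rewrite mul0r.
  rewrite mulSn -addnA addnC.
  have sYY j : Y j `<=` Y j.+1.
    by move=> _ [f [g [Wf Ng ->]]]; exists f, g; split=> //; exact: leqW.
  apply: (@lenle_add A {poly A} W (Y i.+1) (Y i.+2)) => //.
  - exact: sadd_l.
  - by apply: IHi; exact: ltnW.
  apply: (@lenle_sub A {poly A} (Y i.+1) (Y i.+2) (Y i.+1) (sadd (Y i.+1) ((fun a : A => a *: 'X^(i.+1) : {poly A}) @` setT))) => //.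
    move=> _ [f [g [Wf Ng ->]]]; exists (f + take_poly i.+1 g), (g`_i.+1 *: 'X^(i.+1)); split.
    - by exists f, (take_poly i.+1 g); split=> //; exact: size_take_poly.
    - by exists g`_i.+1.
    rewrite -addrA; congr (_ + _); apply/polyP => j; rewrite coefD coef_take_poly coefZ coefXn.
    case: ltngtP => [_|lt_j|->]; rewrite ?mulr0 ?addr0 ?mulr1 ?add0r //.
    by rewrite nth_default //; exact: leq_trans Ng _.
  apply: (@lenle_image A A^o {poly A} (fun a : A => a *: 'X^(i.+1))) fF => //.
  - by move=> a x y; rewrite scalerDl scalerA.
  - by apply: ideal_sadd => //; exact: idl_gen_ideal.
  move=> _ [_ [y [/gen_seqP[b ->] Iy ->]]]; rewrite size_mkseq.
  pose h j := b j *: 'X^i : {poly A}.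
  (* ['X^i] times the combination of the family with coefficients [b] has [\sum_j b_j F_j] in degree
     [i + 1]; its term in degree [i] is absorbed by the lower layers. *)
  exists (comb h + y *: 'X^(i.+1)), (- \sum_(j < c) (b j * G j) *: 'X^i).
  have hE (j : 'I_c) : h j * ((G j)%:P + 'X * (F j)%:P) = (b j * G j) *: 'X^i + (b j * F j) *: 'X^(i.+1).
    by rewrite /h exprS -!mul_polyC !polyCM; ring.
  have sX (a : A) j : (size (a *: 'X^j : {poly A}) <= j.+1)%N.
    by apply: leq_trans (size_scale_leq _ _) _; rewrite size_polyXn.
  split.
  - split.
      apply: (subD (smN _)); last exact: leq_trans (sX _ _) _.
      rewrite /comb; apply: sub_sum => [|j _]; first exact: smN.
      rewrite hE; apply: (subD (smN _)).
        exact: leq_trans (sX _ _) (leqW lt_im).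
      exact: leq_trans (sX _ _) _.
    exists h; split=> [j|]; first exact: leq_trans (sX _ _) lt_im.
    by rewrite addrAC subrr add0r -mul_polyC; apply: (idlMr _ ipI); exact: polyI_C.
  - apply: (@subN _ _ _ _ (smN _)); apply: sub_sum => [|j _]; [exact: smN|exact: sX].
  rewrite /comb (eq_bigr _ (fun j _ => hE j)) big_split /= scalerDl.
  rewrite scaler_suml (eq_bigr (fun j : 'I_c => (b j * F j) *: 'X^(i.+1))) => [|j _].
    by move: (\sum_(j < c) _) (\sum_(j < c) _) (y *: _) => U V Z; ring.
  by rewrite nth_mkseq.
suff H : lenge W (N m.+1) K.
  apply: (up m (leqnn m)); apply: lenge_sub H => //.
  by apply: sadd_r.
have iJ : ideal J := ideal_sadd (ideal_princ _) (ideal_sadd (idl_gen_ideal _) ipI).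
(* Restricting to degree at most [m] loses no strictness, since the ideals contain all multiples of
   ['X^m]. *)
move: gK; apply: (@lenge_transfer {poly A} A {poly A}^o {poly A} (fun X => X `&` N m.+1)).
- move=> X iX JX _; split.
  + apply: submodule_setI => //; split; first exact: (idl0 iX).
    move=> a f g Xf Xg; rewrite -mul_polyC; apply: (idlD iX) => //; exact: (idlM _ iX).
  + move=> f [Nf [h [_ If]]]; split=> //; apply: JX.
    rewrite -(subrK (comb h) f); apply: (idlD iJ).
      by apply: (isadd_r (ideal_princ _)); apply: (isadd_r (idl_gen_ideal _)).
    apply: (isadd_r (ideal_princ _)); apply: (isadd_l ipI).
    apply: idl_sum => [|j _]; first exact: idl_gen_ideal.
    apply: (idlM _ (idl_gen_ideal _)); apply: idl_gen_sub => /=.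
    by apply/mapP; exists (nat_of_ord j) => //; rewrite mem_iota ltn_ord.
  + by move=> f [].
- by move=> X Y' _ _ _ XY _; exact: setSI.
move=> X Y' iX iY' JX XY _ h f Yf; rewrite -(poly_take_drop m f).
have XX q : X (q * 'X^m) by apply: JX; apply: (isadd_l (ideal_sadd (idl_gen_ideal _) ipI)); exists q.
apply: (idlD iX) => //.
have [] // := h (take_poly m f); split; last exact: leq_trans (size_take_poly _ _) _.
have -> : take_poly m f = f - drop_poly m f * 'X^m by rewrite -{2}(poly_take_drop m f) addrK.
by apply: (idlB iY') => //; exact: XY.
Qed.

(** * Deformation to the quadric *)

Lemma expr_sum_pchar (A : comNzRingType) p e (I : Type) (r : seq I) (F : I -> A) :
  p \in [pchar A] -> (\sum_(i <- r) F i) ^+ (p ^ e) = \sum_(i <- r) F i ^+ (p ^ e).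
Proof.
move=> pA; elim: e => [|e IHe]; first by under [RHS]eq_bigr do rewrite expr1; rewrite expr1.
rewrite expnSr exprM IHe -(pFrobenius_autE pA) rmorph_sum; apply: eq_bigr => i _.
by rewrite /= pFrobenius_autE exprM.
Qed.

Lemma polyI_iexp (A : comNzRingType) (M : set A) N : ideal M ->
  ideal_exp (polyI M) N `<=` polyI (ideal_exp M N).
Proof.
move=> iM; elim: N => [|N IHN]; first by move=> f _ i.
have iP := ideal_polyI (iexp_ideal M N.+1).
apply: (imul_min iP) => f g Mf /IHN; apply: polyIM Mf; first exact: iexp_ideal.
by move=> x y; exact: imulP.
Qed.

Lemma polyI_frob (A : comNzRingType) (M : set A) p e : p \in [pchar A] ->
  frob (p ^ e) (polyI M) `<=` polyI (frob (p ^ e) M).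
Proof.
move=> pA; have iP := ideal_polyI (frob_ideal (p ^ e) M).
apply: (frob_min iP) => f Mf.
have pA' : p \in [pchar {poly A}] by rewrite pchar_poly.
rewrite -[f]coefK poly_def expr_sum_pchar //; apply: idl_sum => // i _.
rewrite -mul_polyC exprMn -polyC_exp; apply: (idlMr _ iP).
by apply: polyI_C; [exact: frob_ideal|exact: frobP].
Qed.

Section Comparison.
Variables (k : fieldType) (p d c : nat).
Hypotheses (pk : p \in [pchar k]) (p_gt2 : (2 < p)%N).
Local Notation n := (d.+1 + c)%N.
Local Notation P := (ipoly k n).
Local Notation M := (pmax k n).
Local Notation M2 := (ideal_exp M 2).
Let x_ (i : nat) : P := (ivars k n)`_i.

Definition squares : P := \sum_(i < d.+1) x_ i ^+ 2.

Variables (F0 : P) (Fs : nat -> P).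
Hypotheses (F0M : M2 F0) (FsM : forall l, M (Fs l)).

Let iM : ideal M := ideal_pmax k n.
Let iPM : ideal (polyI M) := ideal_polyI iM.
Let iPM2 : ideal (polyI M2) := ideal_polyI (iexp_ideal M 2).

Let PM2 f g : polyI M f -> polyI M g -> polyI M2 (f * g).
Proof.
apply: polyIM; first exact: iexp_ideal.
by move=> x y Mx My; rewrite iexpS iexp1 //; exact: imulP.
Qed.

Let XI j (K : set P) : set {poly P} := [set f | exists2 w, polyI K w & f = 'X^j * w].

Let ideal_XI j K : ideal K -> ideal (XI j K).
Proof.
move=> iK; have iPK := ideal_polyI iK; apply: mk_ideal.
- by exists 0; [exact: (idl0 iPK)|rewrite mulr0].
- by move=> _ _ [u Ku ->] [v Kv ->]; exists (u + v); [exact: (idlD iPK)|rewrite mulrDr].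
- by move=> a _ [u Ku ->]; exists (a * u); [exact: (idlM _ iPK)|rewrite mulrCA].
Qed.

Let agree (T T' : {rmorphism P -> {poly P}}) j :
  (forall a, T (ipC k n a) = T' (ipC k n a)) ->
  (forall i, (i < n)%N -> XI j M (T (x_ i) - T' (x_ i))) -> forall a, XI j M (T a - T' a).
Proof.
move=> TC TX; have iX := ideal_XI j iM.
apply: (@ipoly_ind _ _ [set a | XI j M (T a - T' a)]) => //=.
- by move=> a; rewrite TC subrr; exact: (idl0 iX).
- by move=> x y Hx Hy; rewrite !rmorphD opprD addrACA; exact: (idlD iX).
- move=> x y Hx Hy; rewrite !rmorphM.
  have -> : T x * T y - T' x * T' y = T x * (T y - T' y) + T' y * (T x - T' x) by ring.
  by apply: (idlD iX); exact: (idlM _ iX).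
Qed.

Let maps_M (T : {rmorphism P -> {poly P}}) :
  (forall i, (i < n)%N -> polyI M (T (x_ i))) -> forall a, M a -> polyI M (T a).
Proof.
move=> TX a /pmax_sum[g ->]; rewrite rmorph_sum; apply: idl_sum => // i _.
by rewrite rmorphM; apply: (idlM _ iPM); exact: TX.
Qed.

(** In a difference of products of elements of [M], each term keeps one factor in [M], so congruence
    modulo ['X^j M] improves to ['X^j M2] on [M2]. *)
Let agree2 (T T' : {rmorphism P -> {poly P}}) j :
  (forall a, M a -> polyI M (T a)) -> (forall a, M a -> polyI M (T' a)) ->
  (forall a, XI j M (T a - T' a)) -> forall a, M2 a -> XI j M2 (T a - T' a).
Proof.
move=> TM TM' TT; have iX := ideal_XI j (iexp_ideal M 2).
have XM f g : polyI M f -> XI j M g -> XI j M2 (f * g).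
  by move=> Mf [w Mw ->]; exists (f * w); [exact: PM2|rewrite mulrCA].
have iS : ideal [set a | [/\ polyI M (T a), polyI M (T' a) & XI j M2 (T a - T' a)]].
  apply: mk_ideal => /=.
  - by rewrite !rmorph0 subrr; split; [exact: (idl0 iPM)|exact: (idl0 iPM)|exact: (idl0 iX)].
  - move=> x y [Tx T'x Hx] [Ty T'y Hy]; rewrite !rmorphD opprD addrACA.
    by split; [exact: (idlD iPM)|exact: (idlD iPM)|exact: (idlD iX)].
  - move=> b x [Tx T'x Hx]; rewrite !rmorphM; split; try exact: (idlM _ iPM).
    have -> : T b * T x - T' b * T' x = T b * (T x - T' x) + T' x * (T b - T' b) by ring.
    by apply: (idlD iX); [exact: (idlM _ iX)|exact: XM].
suff sub : M2 `<=` [set a | [/\ polyI M (T a), polyI M (T' a) & XI j M2 (T a - T' a)]].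
  by move=> a /sub[].
rewrite -[X in X `<=` _]/(imul M (ideal_exp M 1)) iexp1 //; apply: (imul_min iS) => x y Mx My; split.
- by rewrite rmorphM; apply: (idlM _ iPM); exact: TM.
- by rewrite rmorphM; apply: (idlM _ iPM); exact: TM'.
rewrite !rmorphM.
have -> : T x * T y - T' x * T' y = T x * (T y - T' y) + T' y * (T x - T' x) by ring.
by apply: (idlD iX); apply: XM => //; [exact: TM|exact: TM'].
Qed.

(* Newton iteration: a change of coordinates congruent to the identity modulo
   the parameter ['X] undoes the deformation of [squares] by [F0] and of the
   remaining variables by the [Fs], to any given order in ['X]. *)
Let hensel j : exists T : {rmorphism P -> {poly P}},
  [/\ forall a, T (ipC k n a) = (ipC k n a)%:P,
      forall i, (i < n)%N -> XI 1 M (T (x_ i) - (x_ i)%:P),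
      exists la : nat -> {poly P}, exists2 e, polyI M2 e &
        T squares + 'X * T F0 = squares%:P + \sum_(l < c) (x_ (d.+1 + l))%:P * la l + 'X^(j.+1) * e
    & forall l, (l < c)%N -> exists2 e, polyI M e &
        T (x_ (d.+1 + l)) + 'X * T (Fs l) = (x_ (d.+1 + l))%:P + 'X^(j.+1) * e].
Proof.
elim: j => [|j [T [TC TX [la [e Me TE]] TFs]]].
  exists (@polyC P : {rmorphism P -> {poly P}}); split=> //.
  - by move=> i _; rewrite subrr; exact: (idl0 (ideal_XI 1 iM)).
  - exists (fun=> 0), F0%:P; first exact: polyI_C (iexp_ideal _ _) F0M.
    by rewrite big1 ?addr0 // => l _; rewrite mulr0.
  - by move=> l _; exists (Fs l)%:P => //; exact: polyI_C.
(* Odd characteristic enters here: the derivative of a square has to be divided by 2. *)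
have two0 : (2%:R : k) != 0 by rewrite -(dvdn_pcharf pk) gtnNdvd.
pose h : {poly P} := (ipC k n 2%:R^-1)%:P.
have hh : h + h = 1 by rewrite -rmorphD -rmorphD -[_^-1]mul1r -mulrDl divff // !rmorph1.
have [ee [eeM eE]] : exists ee : nat -> {poly P}, (forall i, polyI M (ee i)) /\
    e = \sum_(i < n) (x_ i)%:P * ee i.
  move: Me; rewrite iexpS iexp1 // => /(polyI_split iM)[ee [eeM ->]].
  by exists ee; rewrite size_ivars.
have [ep epP] : exists ep : nat -> {poly P}, forall l, (l < c)%N -> polyI M (ep l) /\
    T (x_ (d.+1 + l)) + 'X * T (Fs l) = (x_ (d.+1 + l))%:P + 'X^(j.+1) * ep l.
  have H l : exists ep, (l < c)%N -> polyI M ep /\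
    T (x_ (d.+1 + l)) + 'X * T (Fs l) = (x_ (d.+1 + l))%:P + 'X^(j.+1) * ep.
    have [lt_l|_] := boolP (l < c)%N; last by exists 0.
    by have [ep Mep epE] := TFs _ lt_l; exists ep.
  by have [ep epP] := choice H; exists ep.
have [w wP] : exists w : nat -> {poly P}, forall i, (i < n)%N -> polyI M (w i) /\
    T (x_ i) = (x_ i)%:P + 'X * w i.
  have H i : exists w, (i < n)%N -> polyI M w /\ T (x_ i) = (x_ i)%:P + 'X * w.
    have [lt_i|_] := boolP (i < n)%N; last by exists 0.
    have [w Mw E] := TX _ lt_i; exists w => _; split=> //.
    by rewrite -(subrK (x_ i)%:P (T (x_ i))) E expr1 addrC.
  by have [w wP] := choice H; exists w.
(* Newton correction: subtracting ['X^(j+1) * h * ee i] from the image of [x_i] lowers the sum of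
   squares by ['X^(j+1) * x_i * ee i] to first order, as [2 h = 1]. The error [e] has coefficients
   in [M2], so the corrections have coefficients in [M]. *)
pose de i := if (i < d.+1)%N then h * ee i else ep (i - d.+1)%N.
have deM i : (i < n)%N -> polyI M (de i).
  rewrite /de => lt_i; case: ifPn => [_|]; first exact: (idlM _ iPM).
  rewrite -leqNgt => le_i; have [|//] := epP (i - d.+1)%N.
  by rewrite ltn_subLR.
have [T' [T'C T'X]] := @ipoly_eval k {poly P} (@polyC P \o ipC k n) (fun i => T (x_ i) - 'X^(j.+1) * de i) n.
have {}T'C a : T' (ipC k n a) = (ipC k n a)%:P by rewrite T'C.
have TT' a : XI j.+1 M (T' a - T a).
  apply: agree => [b|i lt_i]; first by rewrite T'C TC.
  exists (- de i); first exact: (idlN iPM (deM _ lt_i)).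
  by rewrite T'X // addrAC subrr add0r mulrN.
have TM a : M a -> polyI M (T a).
  apply: maps_M => i lt_i; have [Mw ->] := wP _ lt_i.
  by apply: (idlD iPM); [apply: polyI_C => //; exact: pmax_ivar|exact: (idlM _ iPM)].
have T'M a : M a -> polyI M (T' a).
  move=> Ma; have [v Mv E] := TT' a; rewrite -(subrK (T a) (T' a)) E.
  by apply: (idlD iPM); [exact: (idlM _ iPM)|exact: TM].
exists T'; split=> //.
- move=> i lt_i; rewrite T'X //; have [Mw ->] := wP _ lt_i.
  exists (w i - 'X^j * de i).
    by apply: (idlB iPM) => //; apply: (idlM _ iPM); exact: deM.
  by rewrite expr1 exprS; ring.
- have [v Mv vE] := agree2 T'M TM TT' F0M.
  (* The part of the error along the last [c] variables is kept in the multipliers [la]. The rest,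
     of order [j + 2], comes from [F0], from the increments [w] of the variables and from the
     squares of the corrections. *)
  exists (fun l => la l + 'X^(j.+1) * ee (d.+1 + l)%N),
    (v - \sum_(i < d.+1) w i * ee i + 'X^j * h ^+ 2 * \sum_(i < d.+1) ee i ^+ 2).
    apply: (idlD iPM2); first apply: (idlB iPM2) => //.
      apply: idl_sum => // i _; apply: PM2 => //.
      by have [] := wP i (leq_trans (ltn_ord i) (leq_addr _ _)).
    apply: (idlM _ iPM2); apply: idl_sum => // i _; rewrite expr2; exact: PM2.
  have sqE : T' squares = T squares - 'X^(j.+1) * \sum_(i < d.+1) (x_ i)%:P * ee i
      - 'X^(j.+2) * \sum_(i < d.+1) w i * ee i
      + 'X^(j.+2) * ('X^j * h ^+ 2 * \sum_(i < d.+1) ee i ^+ 2).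
    rewrite /squares !rmorph_sum !mulr_sumr -!sumrB -big_split; apply: eq_bigr => i _ /=.
    have lt_i : (i < n)%N by apply: leq_trans (ltn_ord i) (leq_addr _ _).
    rewrite !rmorphXn T'X // /de ltn_ord; have [_ ->] := wP _ lt_i.
    have -> : 'X^(j.+1) * ((x_ i)%:P * ee i) = 'X^(j.+1) * ((x_ i)%:P * (h + h) * ee i) by rewrite hh mulr1.
    have -> : 'X^(j.+2) * (w i * ee i) = 'X^(j.+2) * (w i * (h + h) * ee i) by rewrite hh mulr1.
    rewrite !exprS; ring.
  have e1 : \sum_(i < n) (x_ i)%:P * ee i = \sum_(i < d.+1) (x_ i)%:P * ee i +
      \sum_(l < c) (x_ (d.+1 + l))%:P * ee (d.+1 + l)%N by rewrite big_split_ord.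
  have e2 : \sum_(l < c) (x_ (d.+1 + l))%:P * (la l + 'X^(j.+1) * ee (d.+1 + l)%N) =
      \sum_(l < c) (x_ (d.+1 + l))%:P * la l
      + 'X^(j.+1) * \sum_(l < c) (x_ (d.+1 + l))%:P * ee (d.+1 + l)%N.
    by rewrite mulr_sumr -big_split; apply: eq_bigr => l _ /=; ring.
  have e3 : 'X * T' F0 = 'X * T F0 + 'X^(j.+2) * v.
    by rewrite -(subrK (T F0) (T' F0)) vE mulrDr addrC mulrA -exprS.
  rewrite sqE e3 e2.
  have e4 : T squares = squares%:P + \sum_(l < c) (x_ (d.+1 + l))%:P * la l
     + 'X^(j.+1) * (\sum_(i < d.+1) (x_ i)%:P * ee i +
      \sum_(l < c) (x_ (d.+1 + l))%:P * ee (d.+1 + l)%N) - 'X * T F0.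
    by rewrite -e1 -eE -TE addrK.
  rewrite e4; move: (\sum_(l < c) _) (\sum_(l < c) _) (\sum_(i < d.+1) _) (\sum_(i < d.+1) _) => s1 s2 s3 s4.
  move: (\sum_(i < d.+1) _) => s5; ring.
move=> l lt_l; have [u Mu uE] := TT' (Fs l).
exists u => //; have lt_dl : (d.+1 + l < n)%N by rewrite ltn_add2l.
rewrite T'X // /de ltnNge leq_addr /= addKn.
rewrite -(subrK (T (Fs l)) (T' (Fs l))) uE.
have [_ E] := epP _ lt_l.
have -> : T (x_ (d.+1 + l)) = (x_ (d.+1 + l))%:P + 'X^(j.+1) * ep l - 'X * T (Fs l) by rewrite -E addrK.
rewrite !exprS; ring.
Qed.

Definition quadric_seq : seq P := squares :: mkseq (fun l => x_ (d.+1 + l)) c.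

(** The change of coordinates [TT] sends the pencil [G + 'X F] into the constant family [G] modulo
    ['X^(m+1)] and is surjective there, so the pencil has length at least [(m+1) * col GI].
    Semicontinuity bounds this length by [(m+1) * col FI + l0]. *)
Lemma colength_comparison a e :
  (col (sadd (ideal_gen [set` quadric_seq]) (mixpow M a (p ^ e))) <=
   col (sadd (ideal_gen [set` F0 :: mkseq Fs c]) (mixpow M a (p ^ e))))%N.
Proof.
set I := mixpow M a (p ^ e).
have iI : ideal I := ideal_mixpow _ _ _.
pose G j := if j is l.+1 then x_ (d.+1 + l) else squares.
pose F j := if j is l.+1 then Fs l else F0.
have GE : quadric_seq = mkseq G c.+1.
  by rewrite /quadric_seq /mkseq /= -(addn0 1%N) iotaDl -map_comp.
have FE : F0 :: mkseq Fs c = mkseq F c.+1 by rewrite /mkseq /= -(addn0 1%N) iotaDl -map_comp.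
rewrite GE FE.
set GI := sadd _ I; set FI := sadd _ I.
have iGI : ideal GI := ideal_sadd (idl_gen_ideal _) iI.
have iFI : ideal FI := ideal_sadd (idl_gen_ideal _) iI.
have [l0 fM] := ile_pmax_exp k n a.
have fI : ile I setT l0 by apply: ile_sub fM => //; exact: (isadd_l (frob_ideal _ _)).
have fGI : ile GI setT l0 by apply: ile_sub fI => //; exact: (isadd_r (idl_gen_ideal _)).
have fFI : ile FI setT l0 by apply: ile_sub fI => //; exact: (isadd_r (idl_gen_ideal _)).
suff H m : (m.+1 * col GI <= m.+1 * col FI + l0)%N.
  (* For [m = l0] a positive difference of colengths would exceed the error. *)
  by move: (H l0); move: (col GI) (col FI) => u v; nia.
apply: (semicontinuity (G := G) (F := F) (c := c.+1) iI fI (col_ile iFI fFI)).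
set JF := sadd _ _.
have ipI := ideal_polyI iI.
pose JG := sadd (princ ('X^(m.+1) : {poly P})) (polyI GI).
have iJG : ideal JG := ideal_sadd (ideal_princ _) (ideal_polyI iGI).
have gJG : ige JG setT (m.+1 * col GI) := poly_ige m.+1 iGI (col_ige iGI fGI).
have [T [TC TX [la [e0 _ TE]] TFs]] := hensel m.
have cT : commr_rmorph T 'X by move=> x; exact: mulrC.
pose TT : {rmorphism {poly P} -> {poly P}} := GRing.RMorphism.clone _ _ (horner_morph cT) _.
have TTC x : TT x%:P = T x by rewrite /= horner_morphC.
have TTX : TT 'X = 'X by rewrite /= horner_morphX.
have XJ f : JG ('X^(m.+1) * f).
  by apply: (isadd_l (ideal_polyI iGI)); exists f; rewrite mulrC.
have GIJ x : GI x -> JG x%:P.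
  by move=> Gx; apply: (isadd_r (ideal_princ _)); exact: polyI_C.
have Tid x : exists w, T x = x%:P + 'X * w.
  have [v _ E] := @agree T (@polyC P) 1 TC TX x.
  by exists v; rewrite -(subrK x%:P (T x)) E expr1 addrC.
have TM x : M x -> polyI M (T x).
  apply: maps_M => i lt_i; have [v Mv E] := TX _ lt_i.
  rewrite -(subrK (x_ i)%:P (T _)) E; apply: (idlD iPM); first exact: (idlM _ iPM).
  by apply: polyI_C => //; exact: pmax_ivar.
have TI x : I x -> polyI I (T x).
  case=> u [v [Mu Mv ->]]; rewrite rmorphD; apply: (idlD ipI).
    have := iexp_preim TM Mu; move/(polyI_iexp iM) => h i.
    by apply: (isadd_l (frob_ideal _ _)); exact: h.
  have := frob_preim TM Mv; move/polyI_frob => h i.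
  apply: (isadd_r (iexp_ideal _ _)); apply: h.
  have pkP : forall r, p \in [pchar ipoly k r] by elim=> [|r IHr] //=; rewrite pchar_poly.
  exact: pkP.
have JFJG f : JF f -> JG (TT f).
  have iP := ideal_preim TT iJG; move: f; apply: (isadd_min iP); last apply: (isadd_min iP).
  - apply: (princ_sub iP); rewrite /= rmorphXn TTX -[X in JG X]mulr1; exact: XJ.
  - apply: (idl_gen_min iP) => f /= /mapP[j]; rewrite mem_iota => /andP[_ lt_j] ->.
    rewrite rmorphD rmorphM TTX !TTC; case: j lt_j => [_|l lt_l] /=.
      rewrite TE; apply: (idlD iJG) => //; apply: (idlD iJG).
        apply: GIJ; apply: (isadd_l iI); apply: idl_gen_sub => /=.
        by rewrite -GE mem_head.
      apply: idl_sum => // l _; apply: (idlMr _ iJG); apply: GIJ; apply: (isadd_l iI).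
      apply: idl_gen_sub => /=; rewrite -GE inE; apply/orP; right.
      by apply/mapP; exists (nat_of_ord l) => //; rewrite mem_iota ltn_ord.
    have [ep _ ->] := TFs l lt_l; apply: (idlD iJG) => //.
    apply: GIJ; apply: (isadd_l iI); apply: idl_gen_sub => /=; rewrite -GE inE; apply/orP; right.
    by apply/mapP; exists l => //; rewrite mem_iota.
  - move=> f If; rewrite /= -[f]coefK poly_def rmorph_sum; apply: idl_sum => // i _.
    rewrite -mul_polyC rmorphM TTC; apply: (idlMr _ iJG).
    apply: (isadd_r (ideal_princ _)) => j.
    by apply: (isadd_r (idl_gen_ideal _)); exact: TI.
(* [TT] is the identity modulo ['X], so approximate preimages improve by one power of ['X] at a
   time. *)
have TTs f : exists g, JG (f - TT g).
  have H j : forall f, exists g, exists q, f - TT g = 'X^j * q.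
    elim: j => [|j IHj] f'; first by exists 0, f'; rewrite rmorph0 subr0 mul1r.
    have [g [q E]] := IHj f'; have [v vE] : exists v, TT q = q + 'X * v.
      elim/poly_ind: {E} q => [|q b [v vE]]; first by exists 0; rewrite rmorph0 mulr0 addr0.
      have [w wE] := Tid b; exists (v * 'X + w).
      by rewrite rmorphD rmorphM TTX TTC vE wE; ring.
    exists (g + 'X^j * q), (- v); rewrite rmorphD rmorphM rmorphXn TTX vE opprD addrA E exprS; ring.
  have [g [q E]] := H m.+1 f; exists g; rewrite E; exact: XJ.
move: gJG; apply: (@lenge_transfer {poly P} {poly P} {poly P}^o {poly P}^o (fun X => TT @^-1` X)).
- move=> X iX JX _; split=> //; first exact: (ideal_preim TT iX).
  by move=> f /JFJG /JX.
- by move=> X Y _ _ _ XY _ f; exact: XY.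
move=> X Y iX iY JX XY _ h y Yy; have [g yg] := TTs y.
rewrite -(subrK (TT g) y); apply: (idlD iX); first exact: JX.
apply: h; rewrite /= -(subKr y (TT g)); apply: (idlB iY) => //.
by apply: XY; exact: JX.
Qed.

End Comparison.

(** * Cartier operators *)

Section Cartier.
Variable p : nat.

(* [p^-1]-linear maps *)
Definition cartier (A : comNzRingType) (T : A -> A) :=
  (forall x y, T (x + y) = T x + T y) /\ forall g f, T (g ^+ p * f) = g * T f.

Lemma cartier0 (A : comNzRingType) (T : A -> A) : cartier T -> T 0 = 0.
Proof. by case=> TD _; have /eqP := TD 0 0; rewrite addr0 eq_sym -subr_eq0 addrK => /eqP. Qed.

(** The converse of the fact that Cartier operators map the Frobenius power of an ideal into the
    ideal. It replaces freeness of the ring over its [p]-th powers. *)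
Definition separated (A : comNzRingType) (M : set A) :=
  forall h, (forall T, cartier T -> M (T h)) -> frob p M h.

(** A Frobenius splitting: a maximal [k^p]-subspace [V] without 1 is a complement of [k^p] in [k],
    and [T x] is the [p]-th root of the component of [x] in [k^p]. *)
Lemma cartier_field (k : fieldType) : p \in [pchar k] ->
  exists2 T : k -> k, cartier T & T 1 = 1.
Proof.
move=> pk; have p_pr := pcharf_prime pk; have p0 := prime_gt0 p_pr.
have pD (a b : k) : (a + b) ^+ p = a ^+ p + b ^+ p by rewrite -!(pFrobenius_autE pk) rmorphD.
have pB (a b : k) : (a - b) ^+ p = a ^+ p - b ^+ p by rewrite -!(pFrobenius_autE pk) rmorphB.
pose good (V : set k) := [/\ V 0, forall x y, V x -> V y -> V (x + y),
  forall a x, V x -> V (a ^+ p * x) & ~ V 1].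
have [V [VP Vmax]] : exists V, (V = set0 \/ good V) /\ forall B, V `<` B -> ~ (B = set0 \/ good B).
  apply: (@Zorn_bigcup k (fun V => V = set0 \/ good V)) => C CP Ctot.
  have [[X CX gX]|nX] := pselect (exists2 X, C X & good X); last first.
    left; apply/seteqP; split=> // x [X CX Xx].
    by have [X0|gX] := CP _ CX; [rewrite X0 in Xx|case: nX; exists X].
  have gC Y y : C Y -> Y y -> good Y by move=> CY Yy; have [Y0|//] := CP _ CY; rewrite Y0 in Yy.
  right; split.
  - by exists X => //; case: gX.
  - move=> x y [Y CY Yx] [Z CZ Zy].
    have [[_ YD _ _] [_ ZD _ _]] := (gC _ _ CY Yx, gC _ _ CZ Zy).
    have [YZ|ZY] := Ctot _ _ CY CZ; first by exists Z => //; apply: ZD => //; exact: YZ.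
    by exists Y => //; apply: YD => //; exact: ZY.
  - by move=> a x [Y CY Yx]; exists Y => //; have [_ _ YM _] := gC _ _ CY Yx; exact: YM.
  - by move=> [Y CY Y1]; have [_ _ _] := gC _ _ CY Y1; exact.
have g0 : good [set 0].
  split=> //= [x y -> ->|a x ->|/eqP]; rewrite ?addr0 ?mulr0 //.
  by rewrite oner_eq0.
have [V0 VD VM V1] : good V.
  case: VP => // V0; case: (Vmax [set 0]); last by right.
  by rewrite V0; split=> // /(_ 0); apply.
have VN x : V x -> V (- x).
  move=> Vx; have -> : - x = (- 1) ^+ p * x; last exact: VM.
  by have := pB 0 1; rewrite !sub0r expr1n expr0n -[p in p == _]prednK //= sub0r => ->; rewrite mulN1r.
have rep x : exists a, V (x - a ^+ p).
  apply: contrapT => nx; case: (Vmax [set y | exists2 v, V v & exists b, y = v + b ^+ p * x]).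
    split; first by move=> v Vv; exists v => //; exists 0; rewrite expr0n -[p]prednK //= mul0r addr0.
    move=> /(_ x) h; apply: nx; exists 0; rewrite expr0n -[p]prednK //= subr0; apply: h.
    by exists 0 => //; exists 1; rewrite expr1n mul1r add0r.
  right; split.
  - by exists 0 => //; exists 0; rewrite expr0n -[p]prednK //= mul0r addr0.
  - move=> _ _ [v Vv [b ->]] [w Vw [e ->]]; exists (v + w); first exact: VD.
    by exists (b + e); rewrite pD; ring.
  - move=> a _ [v Vv [b ->]]; exists (a ^+ p * v); first exact: VM.
    by exists (a * b); rewrite exprMn; ring.
  - move=> [v Vv [b E]]; apply: nx; exists b^-1.
    have b0 : b != 0.
      by apply/eqP => b0; apply: V1; rewrite E b0 expr0n -[p]prednK //= mul0r addr0.
    have -> : x - b^-1 ^+ p = b^-1 ^+ p * - v; last by apply: VM; exact: VN.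
    rewrite -[X in _ - X]mulr1 E mulrDr mulrA -exprMn mulVf // expr1n mul1r mulrN; ring.
have uniq a b x : V (x - a ^+ p) -> V (x - b ^+ p) -> a = b.
  move=> Va Vb; apply/eqP; rewrite -subr_eq0; apply: contrapT => /negP ab; apply: V1.
  have -> : 1 = (a - b)^-1 ^+ p * (a - b) ^+ p by rewrite -exprMn mulVf // expr1n.
  apply: VM; have -> : (a - b) ^+ p = (x - b ^+ p) + - (x - a ^+ p) by rewrite pB; ring.
  by apply: VD => //; exact: VN.
have [T TP] := choice rep; exists T; last first.
  by apply: (uniq _ _ 1) => //; rewrite expr1n subrr.
split=> [x y|g f].
  apply: (uniq _ _ (x + y)) => //; rewrite pD opprD addrACA; exact: VD.
by apply: (uniq _ _ (g ^+ p * f)) => //; rewrite exprMn -mulrBr; exact: VM.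
Qed.

Lemma separated_field (k : fieldType) : p \in [pchar k] -> separated [set (0 : k)].
Proof.
move=> pk h hT; have [T cT T1] := cartier_field pk.
suff -> : h = 0 by exact: (idl0 (frob_ideal _ _)).
apply/eqP; apply: contrapT => /negP h0; have [TD TM] := cT.
have := hT (fun x => T (h^-1 * x)) _; rewrite mulVf // T1 => /(_ _)/eqP; rewrite oner_eq0.
suff cT' : cartier (fun x => T (h^-1 * x)) by move/(_ cT').
split=> [x y|g f]; first by rewrite mulrDr TD.
by rewrite mulrCA TM.
Qed.

Section Poly.
Variable (A : comNzRingType).
Hypothesis pA : p \in [pchar A].

Let p0 : (0 < p)%N. Proof. by rewrite prime_gt0 ?(pcharf_prime pA). Qed.

(** For [j < p], [T] is applied to the part of [f] in degrees congruent to [j] modulo [p], and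
    ['X^p] is replaced by ['X]. *)
Definition cartier_poly (T : A -> A) j (f : {poly A}) := \poly_(u < size f) T f`_(p * u + j).

Lemma coef_cartier_poly T j f u : cartier T -> (cartier_poly T j f)`_u = T f`_(p * u + j).
Proof.
move=> cT; rewrite coef_poly; case: ifPn => //; rewrite -leqNgt => le_u.
rewrite nth_default ?(cartier0 cT) //; apply: leq_trans le_u _.
by apply: leq_trans (leq_addr _ _); rewrite leq_pmull.
Qed.

Lemma cartier_polyP T j : cartier T -> (j < p)%N -> cartier (cartier_poly T j).
Proof.
move=> cT lt_j; have [TD TM] := cT; have cP f u := coef_cartier_poly j f u cT.
have pP : p \in [pchar {poly A}] by rewrite pchar_poly.
have D f g : cartier_poly T j (f + g) = cartier_poly T j f + cartier_poly T j g.
  by apply/polyP => u; rewrite coefD !cP coefD TD.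
split=> // g; elim/poly_ind: g => [|g c IHg] f.
  rewrite expr0n -[p]prednK // mul0r mul0r; apply/polyP => u.
  by rewrite cP !coef0 (cartier0 cT).
have -> : (g * 'X + c%:P) ^+ p = g ^+ p * 'X^p + (c ^+ p)%:P.
  by rewrite -!(pFrobenius_autE pP) rmorphD /= !pFrobenius_autE exprMn polyC_exp.
rewrite mulrDl D mulrDl -mulrA IHg; congr (_ + _).
  rewrite -mulrA; congr (_ * _); apply/polyP => u; rewrite cP coefXnM coefXM.
  case: u => [|u]; first by rewrite muln0 add0n lt_j (cartier0 cT).
  by rewrite mulnS -addnA ltnNge leq_addr /= addKn cP.
by apply/polyP => u; rewrite cP !coefCM TM cP.
Qed.

End Poly.

Lemma pmaxS (k : fieldType) n (f : ipoly k n.+1) : pmax k n.+1 f <-> pmax k n (f : {poly ipoly k n})`_0.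
Proof.
have iM := ideal_pmax k n; have iM' := ideal_pmax k n.+1.
pose ev : {rmorphism {poly ipoly k n} -> ipoly k n} := GRing.RMorphism.clone _ _ (horner_eval 0) _.
have evE (g : {poly ipoly k n}) : ev g = g`_0 by rewrite /= /horner_eval horner_coef0.
have CM a : pmax k n a -> pmax k n.+1 (a%:P : {poly ipoly k n}).
  have iP := ideal_preim (@polyC (ipoly k n)) iM'.
  apply: (idl_gen_min iP) => x xs /=; apply: idl_gen_sub => /=.
  by rewrite inE map_f ?orbT.
split=> [|f0].
  have iP := ideal_preim ev iM; rewrite -evE; move: f; apply: (idl_gen_min iP) => f /=.
  rewrite inE => /orP[/eqP ->|/mapP[x xs ->]].
    by rewrite -[horner_eval _ _]/(ev 'X) evE coefX; exact: (idl0 iM).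
  by rewrite -[horner_eval _ _]/(ev x%:P) evE coefC; exact: idl_gen_sub.
rewrite -(poly_take_drop 1 (f : {poly ipoly k n})); apply: (idlD iM').
  have -> : take_poly 1 (f : {poly ipoly k n}) = ((f : {poly ipoly k n})`_0)%:P.
    by apply/polyP => -[|i]; rewrite coef_take_poly coefC.
  exact: CM.
by apply: (idlM _ iM'); apply: idl_gen_sub; rewrite /= expr1 mem_head.
Qed.

Lemma pchar_ipoly (k : fieldType) n : p \in [pchar k] -> p \in [pchar ipoly k n].
Proof. by move=> pk; elim: n => [|n IHn] //=; rewrite pchar_poly. Qed.

(** The operators [cartier_poly T j] test the first [p] coefficients in the outer variable; what
    remains is a multiple of ['X^p]. *)
Lemma separated_pmax (k : fieldType) n : p \in [pchar k] -> separated (pmax k n).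
Proof.
move=> pk; elim: n => [|n IHn].
  by rewrite /pmax gen_nil; exact: separated_field.
move=> h hT; have pA := pchar_ipoly n pk.
have p0 := prime_gt0 (pcharf_prime pk).
have iF := frob_ideal p (pmax k n.+1).
pose h' : {poly ipoly k n} := h.
have hj j : (j < p)%N -> frob p (pmax k n) h'`_j.
  move=> lt_j; apply: IHn => T cT.
  have := hT _ (cartier_polyP pA cT lt_j); move/pmaxS.
  by rewrite coef_cartier_poly // muln0 add0n.
rewrite -[h]/h' -(poly_take_drop p h'); apply: (idlD iF).
  rewrite /take_poly poly_def; apply: idl_sum => // i _.
  rewrite -mul_polyC; apply: (idlMr _ iF).
  apply: (@frob_preim _ _ (@polyC (ipoly k n)) _ _ _ _ _ (hj i (ltn_ord i))) => x Mx.
  by apply/pmaxS; rewrite coefC.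
apply: (idlM _ iF); apply: frobP; apply/pmaxS; rewrite coefX; exact: (idl0 (ideal_pmax _ _)).
Qed.

Lemma ige_frob_pmax (k : fieldType) n : p \in [pchar k] -> ige (frob p (pmax k n)) setT (p ^ n).
Proof.
move=> pk; have p_pr := pcharf_prime pk; have p0 := prime_gt0 p_pr.
elim: n => [|n IHn].
  apply: (@lenge_rcons (ipoly k 0) (ipoly k 0)^o _ (frob p (pmax k 0))) => //.
    split=> // /(_ 1 Logic.I).
    have -> : frob p (pmax k 0) = [set 0].
      apply/seteqP; split; last by move=> _ ->; exact: (idl0 (frob_ideal _ _)).
      by rewrite -gen_nil; apply: frob_sub p0; exact: ideal_pmax.
    by move=> /eqP; rewrite oner_eq0.
  by apply: (@lenge0 (ipoly k 0) (ipoly k 0)^o) => //; exact: frob_ideal.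
have := poly_ige p (frob_ideal p (pmax k n)) IHn; rewrite -expnS.
have ipI := ideal_polyI (frob_ideal p (pmax k n)).
have iY : ideal (sadd (princ ('X^p : {poly ipoly k n})) (polyI (frob p (pmax k n)))).
  exact: (ideal_sadd (ideal_princ _) ipI).
apply: lenge_sub => //; apply: (frob_min iY) => f /pmaxS f0.
have pP : p \in [pchar {poly ipoly k n}] by rewrite pchar_poly; exact: pchar_ipoly.
have -> : (f : {poly ipoly k n}) ^+ p = drop_poly 1 (f : {poly ipoly k n}) ^+ p * 'X^p +
    take_poly 1 (f : {poly ipoly k n}) ^+ p.
  rewrite -[X in X ^+ p = _](poly_take_drop 1 (f : {poly ipoly k n})) -!(pFrobenius_autE pP) rmorphD /=.
  by rewrite !pFrobenius_autE addrC exprMn -exprM mul1n.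
eexists; eexists; split; [by eexists| |reflexivity].
have -> : take_poly 1 (f : {poly ipoly k n}) = ((f : {poly ipoly k n})`_0)%:P.
  by apply/polyP => -[|i]; rewrite coef_take_poly coefC.
by rewrite -polyC_exp; apply: polyI_C; [exact: frob_ideal|exact: frobP].
Qed.

(** * Lengths under the Frobenius power of an ideal *)

Section FrobeniusLength.
Variables (k : fieldType) (n N : nat).
Hypothesis pk : p \in [pchar k].
Local Notation P := (ipoly k n).
Local Notation M := (pmax k n).

(** This is the inclusion of [(c^[p] : w^p)] in [M^[p]], a trace of the flatness of Frobenius. If
    [a w^p] is in [c^[p]], every Cartier operator [T] gives [w T(a)] in [c]; a nonzero constant term
    of [T a] would put [w] in [c]. So all [T a] are in [M], and [separated_pmax] applies. *)
Let frob_step (c : set P) w : ideal c -> ~ c w -> (forall a, M a -> c (a * w)) ->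
  ige (frob p c) (sadd (frob p c) (princ (w ^+ p))) (p ^ n).
Proof.
move=> ic ncw Mw; apply: ige_colon (ige_frob_pmax n pk); first exact: frob_ideal.
move=> a faw; apply: (separated_pmax pk) => T cT; have [TD TM] := cT.
have cTa : c (w * T a).
  rewrite -TM mulrC.
  have iS : ideal [set f | forall b, c (T (b * f))].
    apply: mk_ideal => /=.
    - by move=> b; rewrite mulr0 (cartier0 cT); exact: idl0.
    - by move=> x y Hx Hy b; rewrite mulrDr TD; exact: idlD.
    - by move=> b x Hx e; rewrite mulrA; exact: Hx.
  suff sub : frob p c `<=` [set f | forall b, c (T (b * f))].
    by have := sub _ faw 1; rewrite mul1r.
  by apply: (frob_min iS) => x cx b; rewrite mulrC TM; exact: idlMr.
have [e eE] := ipoly_split (T a).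
have [e0|e0] := eqVneq e 0; first by move: eE; rewrite e0 rmorph0 subr0.
case: ncw; have -> : w = ipC k n e^-1 * (w * T a - (T a - ipC k n e) * w).
  have -> : w * T a - (T a - ipC k n e) * w = ipC k n e * w by ring.
  by rewrite mulrA -rmorphM mulVf // rmorph1 mul1r.
by apply: idlM => //; apply: idlB => //; exact: Mw.
Qed.

Lemma ige_frob (c : set P) l : ideal c -> ideal_exp M N `<=` c -> ige c setT l ->
  ige (frob p c) setT (l * p ^ n).
Proof.
move=> ic Mc [D [DP DS]].
have iF (i : nat) : ideal (frob p (D i)) := frob_ideal p (D i).
suff H i : (i <= l)%N -> ige (frob p (D 0%N)) (frob p (D i)) (i * p ^ n).
  have [_ cD _] := DP 0%N isT; apply: lenge_sub (H l (leqnn l)) => //; exact: frobS.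
elim: i => [|i IHi] lt_il.
  exact: (@lenge0 P P^o _ _ (iF 0%N) (@subset_refl _ _)).
rewrite mulSn addnC; apply: (@ige_cat _ _ (frob p (D i))) => //; first exact: IHi (ltnW lt_il).
have [iD cD _] := DP i (ltnW lt_il); have [iD' cD' _] := DP i.+1 lt_il.
have [DD /existsNP[x /not_implyP[D'x nDx]]] := DS i lt_il.
(* A socle element of the layer exists because [M^N] lies in [D i]: otherwise [x] could be
   multiplied by elements of every [M^r] without entering [D i]. *)
have [w [D'w nDw Mw]] : exists w, [/\ D i.+1 w, ~ D i w & forall a, M a -> D i (a * w)].
  apply: contrapT => nw.
  have H r : exists2 b, ideal_exp M r b & ~ D i (b * x).
    elim: r => [|r [b Mb nDb]]; first by exists 1 => //; rewrite mul1r.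
    apply: contrapT => nb; apply: nw; exists (b * x); split=> //; first exact: idlM.
    move=> a Ma; apply: contrapT => nDa; apply: nb; exists (a * b); first exact: imulP.
    by rewrite -mulrA.
  have [b Mb] := H N; apply; apply: idlMr => //; apply: cD; exact: Mc.
apply: lenge_sub (frob_step iD nDw Mw) => //.
apply: (isadd_min (iF _)); first exact: frobS.
by apply: (princ_sub (iF _)); exact: frobP.
Qed.

End FrobeniusLength.
End Cartier.

(** * Frobenius growth and the Hilbert function *)

Section Generators.
Variables (A : comNzRingType) (z : nat -> A) (n : nat).
Local Notation M := (ideal_gen [set` mkseq z n]).
Local Notation mon c := (\prod_(i < n) z i ^+ c (nat_of_ord i)).

Lemma gen_mkseqP x : M x -> exists c : nat -> A, x = \sum_(i < n) c i * z i.
Proof.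
move=> /gen_seqP[c ->]; exists c; rewrite size_mkseq.
by apply: eq_bigr => i _; rewrite nth_mkseq.
Qed.

Lemma gen_mkseq_mem i : (i < n)%N -> M (z i).
Proof. by move=> lt_i; apply: idl_gen_sub; rewrite /= -(nth_mkseq 0 z lt_i) mem_nth ?size_mkseq. Qed.

Lemma monomial_iexp (c : nat -> nat) : ideal_exp M (\sum_(i < n) c i) (mon c).
Proof.
apply: (big_ind2 (fun b x => ideal_exp M b x)) => // [b x b' x'|i _]; first exact: iexpD.
by apply: iexpX; exact: gen_mkseq_mem.
Qed.

Lemma iexp_min_monomial K b : ideal K ->
  (forall c : nat -> nat, (\sum_(i < n) c i)%N = b -> K (mon c)) -> ideal_exp M b `<=` K.
Proof.
elim: b K => [|b IHb] K iK Kc.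
  move=> x _; rewrite -(mulr1 x); apply: idlM => //.
  by have := Kc (fun=> 0%N); rewrite !big1 //; apply.
apply: (imul_min iK) => x y Mx; apply: (IHb (fun y => K (x * y))) => [|c cb].
  apply: mk_ideal => [|a a'|a a']; rewrite ?mulr0; first exact: idl0.
    by rewrite mulrDr; exact: idlD.
  by rewrite mulrCA; exact: idlM.
have [a ->] := gen_mkseqP Mx; rewrite mulr_suml; apply: idl_sum => // i _.
rewrite -mulrA; apply: idlM => //.
have := Kc (fun j => (c j + (j == i))%N); rewrite big_split /= cb.
rewrite (bigD1 i) //= eqxx big1 ?addn0 ?addn1 => [/(_ erefl)|j /negPf ji]; last first.
  by rewrite -val_eqE /= in ji; rewrite ji.
under eq_bigr do rewrite exprD; rewrite big_split /= mulrC (bigD1 i) //= eqxx expr1.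
by rewrite big1 ?mulr1 // => j /negPf ji; rewrite -val_eqE /= in ji; rewrite ji.
Qed.

(** A monomial of degree [b > n (j - 1)] in [n] variables has an exponent at least [j]. *)
Lemma iexp_min_pigeonhole K b j : ideal K -> (n * j.-1 < b)%N ->
  (forall i x, (i < n)%N -> ideal_exp M (b - j) x -> K (z i ^+ j * x)) -> ideal_exp M b `<=` K.
Proof.
move=> iK lt_b H; apply: (iexp_min_monomial iK) => c cb.
have [i lt_j] : exists i : 'I_n, (j <= c i)%N.
  apply/existsP; apply: contraLR lt_b; rewrite negb_exists -leqNgt => /forallP ltc.
  rewrite -cb -[n in (n * _)%N]card_ord -sum_nat_const; apply: leq_sum => i _.
  by have := ltc i; case: (j) => [|j'] //; rewrite -ltnNge ltnS.
have := monomial_iexp (fun l => (c l - (l == i) * j)%N).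
have -> : (\sum_(l < n) (c l - (l == i) * j))%N = (b - j)%N.
  rewrite -cb (bigD1 i) //= [in RHS](bigD1 i) //= eqxx mul1n.
  rewrite (eq_bigr (fun l : 'I_n => c l)) => [|l li]; first by rewrite addnBAC.
  by move: li; rewrite -val_eqE /= => /negPf ->; rewrite subn0.
move/(H _ _ (ltn_ord i)); congr (K _).
rewrite (bigD1 i) //= [in RHS](bigD1 i) //= eqxx mul1n mulrA -exprD subnKC //.
congr (_ * _); apply: eq_bigr => l; rewrite -val_eqE /= => /negPf ->.
by rewrite subn0.
Qed.

(** Dividing the exponents of a monomial by [p] leaves a remainder of at most [p - 1] in each of the
    [n] variables. This is the origin of the shift [n * p.-1] in the growth estimates. *)
Lemma iexp_frob p b : (0 < p)%N -> ideal_exp M (p * b + n * p.-1) `<=` frob p (ideal_exp M b).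
Proof.
move=> p0; apply: (iexp_min_monomial (frob_ideal _ _)) => c cb.
have -> : mon c = mon (fun i => (c i %% p)%N) * mon (fun i => (c i %/ p)%N) ^+ p.
  rewrite -prodrXl -big_split /=; apply: eq_bigr => i _.
  by rewrite -exprM -exprD addnC -divn_eq.
apply: (idlM _ (frob_ideal _ _)); apply: frobP.
apply: iexp_le (monomial_iexp (fun i => (c i %/ p)%N)).
rewrite -(leq_pmul2l p0) -(leq_add2r (n * p.-1)) -cb big_distrr /=.
rewrite -[n in (n * _)%N]card_ord -sum_nat_const -big_split /=; apply: leq_sum => i _.
by rewrite {1}(divn_eq (c i) p) mulnC leq_add2l -ltnS prednK // ltn_pmod.
Qed.

End Generators.

Lemma ile_muls (A : comNzRingType) (w : nat -> A) n (X' X Y : set A) l :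
  ideal X' -> ideal X -> X' `<=` X -> ideal Y ->
  (forall i x, (i < n)%N -> X' x -> Y (w i * x)) -> ile X' X l ->
  exists K, [/\ ideal K, Y `<=` K, forall i x, (i < n)%N -> X x -> K (w i * x) & ile Y K (n * l)].
Proof.
move=> iX' iX sX iY; elim: n => [|n IHn] H le.
  by exists Y; split=> //; exact: ile0.
have [i x lt_i|K [iK YK KX leK]] := IHn _ le; first by apply: H; exact: ltnW.
exists (sadd K [set w n * x | x in X]).
have iwX := mul_set_ideal (w n) iX.
have iK' := ideal_sadd iK iwX.
split=> //.
- by apply: subset_trans YK _; exact: isadd_l.
- move=> i x; rewrite ltnS leq_eqVlt => /orP[/eqP -> Xx|lt_i Xx].
    by apply: isadd_r => //; exists x.
  by apply: isadd_l => //; exact: KX.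
rewrite mulSn addnC; apply: (@ile_add _ _ K) => //; first exact: isadd_l.
by apply: (ile_mul iX' iX sX iK _ le) => x Xx; apply: YK; exact: H.
Qed.

Section HilbertFunction.
Variables (A : comNzRingType) (z : nat -> A) (n' q : nat).
Local Notation n := n'.+1.
Local Notation M := (ideal_gen [set` mkseq z n]).
Local Notation I b := (mixpow M b q).
Local Notation L b := (col (I b)).
Hypothesis fin : forall b, exists l, ile (ideal_exp M b) setT l.

Let finI b : exists l, ile (I b) setT l.
Proof. by have [l h] := fin b; exists l; apply: ile_sub h => //; exact: iexp_mixpow. Qed.

Let gap b : exists2 l, L b.+1 = (L b + l)%N & ile (I b.+1) (I b) l /\ forall l', ile (I b.+1) (I b) l' -> (l <= l')%N.
Proof.
have [l hl] := finI b.+1; have [l' hl'] := finI b.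
have le := @mixpow_le _ M q _ _ (leqnSn b).
have h : ile (I b.+1) (I b) l by apply: ile_sub hl.
exists (@len A A^o (I b.+1) (I b)); last split.
- rewrite addnC; apply: (@lenD A A^o _ (I b) _ l l') => //; exact: ideal_mixpow.
- by have [] := @len_ex A A^o _ _ _ (ideal_mixpow M q b.+1) le h.
- by move=> m; exact: len_le.
Qed.

(** Multiplication by the [z i ^+ j] maps [n] copies of [I (b - j) / I (b - j).+1] onto
    [I b / I b.+1], by the pigeonhole on exponents; the Frobenius part lies in [I b.+1] already. *)
Lemma hilbert_step b j : (n * j.-1 < b)%N -> (j <= b)%N ->
  (L b.+1 - L b <= n * (L (b - j).+1 - L (b - j)))%N.
Proof.
move=> lt_b le_jb; have [l -> [_ lmin]] := gap b; have [l' -> [le' _]] := gap (b - j).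
rewrite !addKn; apply: lmin.
have [] := @ile_muls A (fun i => z i ^+ j) n _ _ (I b.+1) _ (ideal_mixpow M q _) (ideal_mixpow M q _)
  (@mixpow_le _ M q _ _ (leqnSn _)) (ideal_mixpow M q _) _ le'.
  move=> i _ lt_i [x [y [Mx Fy ->]]]; rewrite mulrDr.
  apply: (idlD (ideal_mixpow M q _)); last by apply: (idlM _ (ideal_mixpow M q _)); exact: frob_mixpow.
  apply: iexp_mixpow; have -> : b.+1 = (j + (b - j).+1)%N by rewrite addnS subnKC.
  apply: iexpD => //; apply: iexpX; exact: gen_mkseq_mem.
move=> K [iK YK KX]; apply: ile_sub => //; apply: (isadd_min iK); last first.
  by apply: subset_trans YK; exact: frob_mixpow.
apply: (iexp_min_pigeonhole iK lt_b) => i x lt_i Mx; apply: KX => //; exact: iexp_mixpow.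
Qed.

Lemma mixpow_col_le b b' : (b <= b')%N -> (L b <= L b')%N.
Proof.
by move=> le_b; have [l] := finI b'; apply: col_mono (mixpow_le le_b) (ideal_mixpow _ _ _); exact: ideal_mixpow.
Qed.

(** The increment at [b] is at most [n] times each of about [b / n] preceding increments; their sum
    telescopes and is at most [L b]. The constant does not depend on [q]. *)
Lemma hilbert_bound b : (b * (L b.+1 - L b) <= n ^ 2 * L b)%N.
Proof.
case: b => [|b] //; set D := (L b.+2 - L b.+1)%N.
have H J : (J <= b %/ n + 1)%N -> (J * D <= n * (L b.+1 - L (b.+1 - J)))%N.
  elim: J => [|J IHJ] le_J; first by rewrite subn0 subnn muln0.
  have lt_J : (J <= b %/ n)%N by rewrite addn1 in le_J.
  have le1 : (n * J < b.+1)%N by rewrite ltnS mulnC -leq_divRL.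
  have le2 : (J.+1 <= b.+1)%N by rewrite ltnS (leq_trans lt_J) // leq_div.
  have h1 := IHJ (ltnW le_J).
  have h2 : (D <= n * (L (b.+1 - J.+1).+1 - L (b.+1 - J.+1)))%N by exact: hilbert_step.
  have E : (b.+1 - J.+1).+1 = (b.+1 - J)%N by rewrite subSS subSn // -ltnS.
  rewrite E in h2; rewrite mulSn.
  have m1 := @mixpow_col_le (b.+1 - J) b.+1 (leq_subr _ _).
  have m2 := @mixpow_col_le (b.+1 - J.+1) (b.+1 - J) _.
  have {}m2 := m2 (leq_sub2l _ (leqnSn _)).
  apply: leq_trans (leq_add h2 h1) _; rewrite -mulnDr leq_mul2l; apply/orP; right.
  by rewrite addnC addnBA // subnK.
have := H _ (leqnn _) => h.
have lt : (b.+1 <= n * (b %/ n + 1))%N.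
  by rewrite mulnDr muln1 mulnC {1}(divn_eq b n) -addnS leq_add2l ltn_pmod.
apply: (@leq_trans (n * (b %/ n + 1) * D)); first by rewrite leq_mul2r lt orbT.
rewrite -mulnA -mulnn -mulnA leq_mul2l /=; apply: leq_trans h _.
by rewrite leq_mul2l leq_subr orbT.
Qed.

End HilbertFunction.

(** For [C = F + M^b + M^[q]] the Frobenius power [C^[p]] contains the [p]-th powers of [F],
    [M^(p b + n (p - 1))] and [M^[p q]], and its colength is at least [p^n] times that of [C].
    Replacing the [p]-th powers of [F] by [F] costs the factor [p ^ size F]. *)
Lemma frobenius_growth (k : fieldType) n p (F : seq (ipoly k n)) b e (M := pmax k n)
    (L := fun b e => col (sadd (ideal_gen [set` F]) (mixpow M b (p ^ e)))) :
  p \in [pchar k] -> (p ^ n * L b e <= p ^ size F * L (p * b + n * p.-1) e.+1)%N.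
Proof.
move=> pk; have p0 := prime_gt0 (pcharf_prime pk); have pA := pchar_ipoly n pk.
have iS b' e' := ideal_sadd (@idl_gen_ideal _ [set` F]) (ideal_mixpow M (p ^ e') b').
set C := sadd (ideal_gen [set` F]) (mixpow M b (p ^ e)); have iC : ideal C := iS b e.
set b' := (p * b + n * p.-1)%N.
set C' := sadd (ideal_gen [set` [seq x ^+ p | x <- F]]) (mixpow M b' (p ^ e.+1)).
have iC' : ideal C' := ideal_sadd (@idl_gen_ideal _ _) (ideal_mixpow _ _ _).
have [l fin] := ile_pmax_exp k n b; have [l' fin'] := ile_pmax_exp k n b'.
have MC : ideal_exp M b `<=` C.
  by move=> x /(iexp_mixpow (p ^ e)); apply: isadd_r; exact: idl_gen_ideal.
have finC : ile C setT l by apply: ile_sub fin.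
have finC' : ile (sadd (ideal_gen [set` F]) (mixpow M b' (p ^ e.+1))) setT l'.
  apply: ile_sub fin' => // x /(iexp_mixpow (p ^ e.+1)); apply: isadd_r; exact: idl_gen_ideal.
have CC' : C' `<=` frob p C.
  have iF := frob_ideal p C; apply: (isadd_min iF).
    apply: (idl_gen_min iF) => _ /= /mapP[x xF ->]; apply: frobP.
    by apply: isadd_l; [exact: ideal_mixpow|exact: idl_gen_sub].
  apply: (isadd_min iF).
    have ME : M = ideal_gen [set` mkseq (nth 0 (ivars k n)) n].
      by have := mkseq_nth 0 (ivars k n); rewrite size_ivars => ->.
    move=> x; rewrite {1}ME => /(iexp_frob p0); rewrite -ME; apply: frobS; exact: MC.
  apply: (frob_min iF) => x Mx; rewrite expnSr exprM; apply: frobP.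
  apply: isadd_r; first exact: idl_gen_ideal.
  by apply: frob_mixpow; exact: frobP.
have h1 := ige_frob pk iC MC (col_ige iC finC).
have finC'' : ile C' setT (p ^ size F * L b' e.+1).
  rewrite /C' isaddC; apply: ile_pows; first exact: ideal_mixpow.
  by rewrite isaddC; exact: col_ile (iS _ _) finC'.
rewrite mulnC; apply: leq_trans (col_le finC'').
by apply: (col_ge iC' finC''); move: h1 => /(@lenge_sub _ (ipoly k n)^o _ _ _ _ _ CC' (@subset_refl _ _)).
Qed.

Section LocalGrowth.
Variable A : comNzRingType.
Hypotheses (nA : noetherian A) (lm : loc (max_ideal A)).
Local Notation m := (max_ideal A).

Lemma frob_colength : (0 < krull_dim A)%N ->
  exists C, forall q, ile (frob q m) setT (q ^ krull_dim A * C).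
Proof.
move=> /krull_dim_max[_ dimA]; have [im _ _] := lm.
have [ys [<- ysm [r sub]]] := params nA lm (@ideal_set0 A) dimA.
have [C fin] := ile_iexp nA lm r; exists C => q.
have {}fin : ile (sadd [set 0] (ideal_gen [set` ys])) setT C by apply: ile_sub fin.
apply: ile_sub (ile_pows (N := q) (@ideal_set0 A) fin) => //; rewrite sadd0.
by apply: idl_gen_min; [exact: frob_ideal|move=> _ /= /mapP[y /ysm my ->]; exact: frobP].
Qed.

Lemma mixpow_colength_bound : (0 < krull_dim A)%N ->
  exists C, forall b q, (col (mixpow m b q) <= C * q ^ krull_dim A)%N.
Proof.
move=> /frob_colength[C CP]; exists C => b q; apply: col_le; rewrite mulnC.
by apply: ile_sub (CP q) => //; exact: frob_mixpow.
Qed.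

Lemma mixpow_hilbert : exists C, forall b q,
  (b * (col (mixpow m b.+1 q) - col (mixpow m b q)) <= C * col (mixpow m b q))%N.
Proof.
have [im _ _] := lm; have [s sE] := nA im; exists ((size s).+1 ^ 2)%N => b q.
(* The extra generator 0 makes the number of generators positive. *)
have E : m = ideal_gen [set` mkseq (nth 0 (0 :: s)) (size s).+1].
  rewrite -[(size s).+1]/(size (0 :: s)) mkseq_nth gen_cons -sE.
  apply/seteqP; split; first by apply: isadd_r; exact: ideal_princ.
  by apply: (isadd_min im) => // _ [a ->]; rewrite mulr0; exact: idl0.
have := @hilbert_bound A (nth 0 (0 :: s)) (size s) q; rewrite -E; apply=> {}b.
exact: (ile_iexp nA lm).
Qed.

End LocalGrowth.

(** * Colengths of complete intersections *)

Section CompleteIntersection.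
Variables (R Q : comNzRingType) (f : seq Q)
  (phi : {rmorphism Q -> completion (@max_idealr R)}) (k : fieldType) (p : nat).
Hypotheses (locR : noeth_local R) (regQ : regular_local Q) (regf : regular_sequence f)
  (phis : forall y, exists x, phi x = y)
  (phik : forall x, phi x = 0 <-> ideal_gen [set` f] x)
  (dimR : (0 < krull_dim R)%N) (pR : p \in [pchar R]) (pk : p \in [pchar k])
  (resR : has_residue_field R k).
Local Notation m := (max_ideal R).
Local Notation L b e := (col (mixpow m b (p ^ e))).

Lemma colength_presentation n N (B : comNzRingType) (f1 : {rmorphism R -> B})
    (rho : {rmorphism ipoly k n -> B}) (F : seq (ipoly k n)) b e :
  (forall y, exists x, f1 x = y) -> (forall x, f1 x = 0 <-> ideal_exp m N x) ->
  (forall y, exists x, rho x = y) -> rho @` pmax k n = f1 @` m ->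
  (forall x, rho x = 0 <-> sadd (ideal_gen [set` F]) (ideal_exp (pmax k n) N) x) ->
  (b <= N)%N -> L b e = col (sadd (ideal_gen [set` F]) (mixpow (pmax k n) b (p ^ e))).
Proof.
move=> f1s f1k rhos rhoM rhok le_b.
have iF := @idl_gen_ideal _ [set` F]; have imix := ideal_mixpow (pmax k n) (p ^ e) b.
have iS := ideal_sadd iF imix.
have k1 x : f1 x = 0 -> mixpow m b (p ^ e) x by move=> /f1k /(iexp_le le_b); exact: iexp_mixpow.
have k2 x : rho x = 0 -> sadd (ideal_gen [set` F]) (mixpow (pmax k n) b (p ^ e)) x.
  by move=> /rhok; apply: isaddS => // y /(iexp_le le_b); exact: iexp_mixpow.
rewrite (@col_surj _ _ _ f1s _ k1) (@col_surj _ _ _ rhos _ k2).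
rewrite !sadd_im !iexp_im // !frob_im // rhoM; congr col.
have iM : ideal (mixpow (f1 @` m) b (p ^ e)) := ideal_mixpow _ _ _.
apply/seteqP; split; first by apply: isadd_r; exact: (ideal_im rhos iF).
apply: (isadd_min iM) => // _ [x Fx <-].
have -> : rho x = 0 by apply/rhok; apply: isadd_l => //; exact: iexp_ideal.
exact: idl0.
Qed.

Let dimE : (krull_dim R + size f = krull_dim Q)%N.
Proof. exact: (complete_intersection_dim locR regQ regf phis phik dimR). Qed.

(** Both colengths are read off one presentation, taken at a level above both exponents. Its numbers
    of variables and relations differ by [krull_dim R], which is the exponent left over from
    [frobenius_growth]. *)
Lemma complete_intersection_growth b e :
  (p ^ krull_dim R * L b e <= L (p * b + krull_dim Q * p.-1) e.+1)%N.
Proof.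
have p0 := prime_gt0 (pcharf_prime pk); set b' := (p * b + _)%N.
have [B [f1 [rho [F [[f1s f1k rhos] rhoM szF _ rhok]]]]] :=
  presentation locR regQ regf phis phik pR pk resR b'.
have le_b : (b <= b'.+1)%N by rewrite leqW // /b' (leq_trans (leq_pmull b p0)) // leq_addr.
rewrite (colength_presentation _ f1s f1k rhos rhoM rhok le_b).
rewrite (colength_presentation _ f1s f1k rhos rhoM rhok (leqnSn b')).
rewrite -(leq_pmul2l (_ : 0 < p ^ size f)%N) ?expn_gt0 ?p0 // mulnA -expnD addnC dimE -szF.
exact: frobenius_growth.
Qed.

(** The presentation changes with [b], but the number [c] of relations other than the quadratic one
    does not. *)
Lemma quadric_colength_le : (2 < p)%N -> ~ regular_local R ->
  exists c, forall b e, (col (sadd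
      (ideal_gen [set` quadric_seq k (krull_dim R) c])
      (mixpow (pmax k ((krull_dim R).+1 + c)) b (p ^ e))) <= L b e)%N.
Proof.
move=> p2 nregR; exists (size f).-1 => b e; set d := krull_dim R; set c := (size f).-1.
have [B [f1 [rho [F [[f1s f1k rhos] rhoM szF FM rhok]]]]] :=
  presentation locR regQ regf phis phik pR pk resR b.+1.
have nE : krull_dim Q = (krull_dim R + size F)%N by rewrite szF dimE.
have [F0 [Fs [F0M FsM szFs genE]]] := quadratic_relation locR nregR f1s f1k rhoM FM rhok nE.
have le_b : (b <= b.+2)%N by rewrite !leqW.
rewrite (colength_presentation _ f1s f1k rhos rhoM rhok le_b) -genE.
have sc : size Fs = c by rewrite /c -szF -szFs.
have {}nE : krull_dim Q = (d.+1 + c)%N by rewrite nE -szFs sc addnS.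
move: (krull_dim Q) nE rho F rhos rhoM szF FM rhok F0 Fs F0M FsM szFs genE sc => n nE.
rewrite nE => rho F rhos rhoM szF FM rhok F0 Fs F0M FsM szFs genE sc.
have := @colength_comparison k p d c pk p2 F0 (nth 0 Fs) F0M _ b e.
have -> : mkseq (nth 0 Fs) c = Fs by rewrite -[X in mkseq _ X]sc mkseq_nth.
apply=> l.
have [lt_l|le_l] := ltnP l (size Fs); first by apply: FsM; rewrite /= mem_nth.
by rewrite nth_default //; exact: (idl0 (ideal_pmax _ _)).
Qed.

End CompleteIntersection.

(** * Fiber products *)

Lemma loc_max_ideal (A : comNzRingType) (m : set A) : loc m -> max_ideal A = m.
Proof.
move=> lm; have [im m1 mU] := lm; rewrite /max_ideal; case: xgetP => [J -> [iJ J1 JU]|/(_ m) []].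
  by rewrite (JU m) //; exact: loc_sub.
by split=> // J iJ J1 mJ; apply/seteqP; split=> //; exact: loc_sub.
Qed.

Lemma max_nat_eq (X : set nat) n : X n -> (forall i, X i -> (i <= n)%N) -> max_nat X = n.
Proof.
move=> Xn le; apply/eqP; rewrite eqn_leq max_nat_le //.
by have [_ ->] := max_nat_ex Xn le.
Qed.

Lemma pchain_surj (A B : comNzRingType) (f : {rmorphism A -> B}) l :
  (forall y, exists x, f x = y) ->
  pchain [set x | f x = 0] l <-> pchain [set (0 : B)] l.
Proof.
move=> fs; split=> -[c [cP cS]].
  have key i x : (i <= l)%N -> (f @` c i) (f x) -> c i x.
    move=> /cP[[ic _ _] kc] [y cy fxy]; have -> : x = y + (x - y) by ring.
    by apply: idlD => //; apply: kc; rewrite /= rmorphB fxy subrr.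
  exists (fun i => f @` c i); split=> i lt_i.
    have [[ic c1 cM] kc] := cP i lt_i; have iI := ideal_im fs ic; split.
      split=> // [|y z]; first by rewrite -(rmorph1 f) => /(key _ _ lt_i).
      have [[x <-] [x' <-]] := (fs y, fs z); rewrite -rmorphM => /(key _ _ lt_i)/cM[]; last by right; exists x'.
      by left; exists x.
    by move=> _ ->; exact: idl0.
  have [sub ns] := cS i lt_i; split; first exact: image_subset.
  by move=> h; apply: ns => x cx; apply: key (ltnW lt_i) _; apply: h; exists x.
exists (fun i => f @^-1` c i); split=> i lt_i.
  have [[ic c1 cM] kc] := cP i lt_i; split; last by move=> x /= ->; exact: kc.
  split=> /= [||x y]; [exact: ideal_preim|by rewrite rmorph1|by rewrite rmorphM => /cM].
have [sub ns] := cS i lt_i; split; first by move=> x /sub.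
by move=> h; apply: ns => y; have [x <-] := fs y; exact: h.
Qed.

Section Pullback.
Variables (P R S T : comNzRingType).
Variables (epsR : {rmorphism R -> T}) (epsS : {rmorphism S -> T}).
Variables (pi1 : {rmorphism P -> R}) (pi2 : {rmorphism P -> S}).
Hypotheses (piE : forall x, epsR (pi1 x) = epsS (pi2 x))
  (pi_ex : forall r s, epsR r = epsS s -> exists x, pi1 x = r /\ pi2 x = s)
  (pi_inj : forall x y, pi1 x = pi1 y -> pi2 x = pi2 y -> x = y).
Hypotheses (locR : noeth_local R) (locS : noeth_local S).
Hypotheses (epsRs : forall t, exists r, epsR r = t) (epsSs : forall t, exists s, epsS s = t).
Hypotheses (dimSR : (krull_dim S < krull_dim R)%N) (dimS : (0 < krull_dim S)%N).
Local Notation mR := (max_ideal R).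
Local Notation mS := (max_ideal S).

Let nR : noetherian R. Proof. by case: locR. Qed.
Let nS : noetherian S. Proof. by case: locS. Qed.
Let lR : loc mR. Proof. by have [] := noeth_local_loc locR. Qed.
Let lS : loc mS. Proof. by have [] := noeth_local_loc locS. Qed.

Let pi1s r : exists x, pi1 x = r.
Proof. by have [s e] := epsSs (epsR r); have [x [<- _]] := pi_ex (esym e); exists x. Qed.

Let pi2s s : exists x, pi2 x = s.
Proof. by have [r e] := epsRs (epsS s); have [x [_ <-]] := pi_ex e; exists x. Qed.

Let unit_eps (A B : comNzRingType) (f : {rmorphism A -> B}) a b :
  (forall t, exists r, f r = t) -> loc (max_ideal A) -> f a * b = 1 -> ~ max_ideal A a.
Proof.
move=> fs lA fab ma; have [im m1 mU] := lA; have [c cE] := fs b.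
apply: m1; have -> : 1 = a * c + (1 - a * c) by ring.
apply: (idlD im); first exact: (idlMr _ im).
apply: contrapT => /mU[y /(congr1 f)/eqP].
by rewrite rmorphM rmorphB rmorph1 rmorphM cE fab subrr mul0r eq_sym oner_eq0.
Qed.

(** Both sides say that the common image in [T] is not a unit, since surjections from local rings
    reflect units. *)
Let max_pi x : mR (pi1 x) <-> mS (pi2 x).
Proof.
have [[_ _ uR] [_ _ uS]] := (lR, lS); split=> h; apply: contrapT.
  move=> /uS[y /(congr1 epsS)]; rewrite rmorphM rmorph1 -piE => e.
  exact: (unit_eps epsRs lR e).
move=> /uR[y /(congr1 epsR)]; rewrite rmorphM rmorph1 piE => e.
exact: (unit_eps epsSs lS e).
Qed.

Let max_pullback : max_ideal P = pi1 @^-1` mR.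
Proof.
have [[iR R1 uR] [_ _ uS]] := (lR, lS); apply: loc_max_ideal; split.
- exact: ideal_preim.
- by rewrite /= rmorph1.
move=> x nx; have [r' er] := uR _ nx; have [s' es] : exists s', pi2 x * s' = 1.
  by apply: uS => /max_pi.
have [|y [y1 y2]] := @pi_ex r' s'.
  rewrite -[epsS s']mulr1 -(rmorph1 epsR) -er [epsR (_ * _)]rmorphM piE mulrA -rmorphM [s' * _]mulrC es.
  by rewrite rmorph1 mul1r.
by exists y; apply: pi_inj; rewrite rmorphM ?y1 ?y2 ?er ?es rmorph1.
Qed.

(** The kernels of the two projections have product zero, so the smallest prime of a chain contains
    one of them and the chain descends to [R] or to [S]. *)
Lemma pullback_krull_dim : krull_dim P = krull_dim R.
Proof.
have [chR maxR] := krull_dim_max (leq_trans dimS (ltnW dimSR)).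
have [_ maxS] := krull_dim_max dimS.
apply: max_nat_eq => [|l].
  by apply/pchain0P; apply: pchain_sub (_ : pchain [set x | pi1 x = 0] _);
    [move=> _ -> /=; rewrite rmorph0|apply/pchain_surj].
move=> [c [cP cS]]; have cc i : (i <= l)%N -> c 0%N `<=` c i.
  elim: i => [_|i IHi lt_i]; first exact: subset_refl.
  apply: subset_trans (IHi (ltnW lt_i)) _.
  by case: (cS i lt_i).
have [ic c1 cM] := cP 0%N isT.
have [k1|/existsNP[a /not_implyP[/= a0 nca]]] := pselect ([set x | pi1 x = 0] `<=` c 0%N).
  apply: maxR; apply/(pchain_surj _ pi1s); exists c; split=> // i le_i; split; first exact: cP.
  by apply: subset_trans k1 _; exact: cc.
apply: leq_trans (ltnW dimSR); apply: maxS; apply/(pchain_surj _ pi2s).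
exists c; split=> // i le_i; split; first exact: cP.
move=> x /= x0; apply: cc => //; have [|//|//] := cM x a.
have -> : x * a = 0; last exact: idl0.
by apply: pi_inj; rewrite rmorphM ?x0 ?a0 ?mul0r ?mulr0 rmorph0.
Qed.

(** The kernel of [pi1] corresponds to the kernel of [epsS], an ideal of [S] generated by the finite
    list [t]. Modulo [I] each lifted generator spans a quotient of [S / mS^[q]], of length at most
    [C * q ^ krull_dim S]; hence the constant [size t * C]. *)
Lemma pullback_colength : exists C, forall b q,
  (col (mixpow mR b q) <= col (mixpow (max_ideal P) b q) <=
    col (mixpow mR b q) + C * q ^ krull_dim S)%N.
Proof.
have [C CP] := frob_colength nS lS dimS.
have [D DP] := frob_colength nR lR (leq_trans dimS (ltnW dimSR)).
have [iR _ _] := lR; have [iS _ _] := lS.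
have iK : ideal [set s | epsS s = 0].
  apply: mk_ideal => /= [|x y x0 y0|a x x0]; first exact: rmorph0.
    by rewrite rmorphD x0 y0 addr0.
  by rewrite rmorphM x0 mulr0.
have [t tE] := nS iK; pose ker1 := [set x | pi1 x = 0].
have tau s : exists x, epsS s = 0 -> pi1 x = 0 /\ pi2 x = s.
  have [es|] := pselect (epsS s = 0); last by exists 0.
  by have [|x xP] := @pi_ex 0 s; [rewrite rmorph0 es|exists x].
have [lift liftP] := choice tau.
exists (size t * C)%N => b q; set I := mixpow (max_ideal P) b q.
have iI : ideal I := ideal_mixpow _ _ _.
have imM : pi1 @` max_ideal P = mR.
  rewrite max_pullback; apply/seteqP; split; first by move=> _ [x mx <-].
  by move=> r mr; have [x e] := pi1s r; exists x => //=; rewrite e.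
have imI : pi1 @` I = mixpow mR b q.
  by rewrite /I /mixpow !sadd_im iexp_im // frob_im // imM.
have ik1 : ideal ker1.
  apply: mk_ideal => /= [|x y x0 y0|a x x0]; first exact: rmorph0.
    by rewrite /ker1 /= rmorphD x0 y0 addr0.
  by rewrite /ker1 /= rmorphM x0 mulr0.
have iJ := ideal_sadd iI ik1.
have kJ x : pi1 x = 0 -> sadd I ker1 x by move=> x0; exact: isadd_r.
have imJ : pi1 @` sadd I ker1 = mixpow mR b q.
  rewrite sadd_im // imI; apply/seteqP; split; last first.
    by apply: isadd_l; exact: ideal_im.
  apply: isadd_min => //; first exact: ideal_mixpow.
  by move=> _ [x x0 <-]; rewrite x0; apply: idl0; exact: ideal_mixpow.
have colJ : col (sadd I ker1) = col (mixpow mR b q) by rewrite (@col_surj _ _ _ pi1s _ kJ) imJ.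
have finJ : ile (sadd I ker1) setT (col (mixpow mR b q)).
  rewrite -colJ; apply: (@col_ile _ _ (q ^ krull_dim R * D)) => //.
  apply/(@ile_surj _ _ _ pi1s _ kJ); rewrite imJ.
  by apply: ile_sub (DP q) => //; exact: frob_mixpow.
have cyc Y s : ideal Y -> I `<=` Y -> epsS s = 0 -> ile Y (sadd Y (princ (lift s))) (q ^ krull_dim S * C).
  move=> iY IY es; have iF := frob_ideal q mS.
  apply: (@ile_cyclic _ _ (pi2 @^-1` frob q mS)) => //; first exact: ideal_preim.
    move=> a /= Fa; have [l1 l2] := liftP s es.
    (* The product [a * lift s] depends on [pi2 a] only; the condition is stated over [S] so that it
       can be checked on the generators of [mS^[q]]. *)
    have {Fa} : [set s' | forall x, pi1 x = 0 -> pi2 x = s' * s -> Y x] (pi2 a); last first.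
      by apply; rewrite rmorphM ?l1 ?l2 ?mulr0.
    move: (pi2 a) Fa; apply: idl_gen_min.
      apply: mk_ideal => /= [x x1|x y hx hy z z1|c x hx z z1].
      - rewrite mul0r => x2; have -> : x = 0 by apply: pi_inj; rewrite rmorph0.
        exact: (idl0 iY).
      - rewrite mulrDl => z2.
        have [|u [u1 u2]] := @pi_ex 0 (x * s); first by rewrite rmorph0 rmorphM es mulr0.
        have -> : z = u + (z - u) by ring.
        apply: (idlD iY); first exact: hx.
        by apply: hy; rewrite rmorphB ?z1 ?z2 ?u1 ?u2 ?subrr // addrC addKr.
      - move=> z2; have [u u2] := pi2s c.
        have [|v [v1 v2]] := @pi_ex 0 (x * s); first by rewrite rmorph0 rmorphM es mulr0.
        have -> : z = u * v by apply: pi_inj; rewrite rmorphM ?v1 ?v2 ?u2 ?mulr0 // z2 mulrA.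
        by apply: (idlM _ iY); exact: hx.
    move=> _ [y my <-] x x1 x2; have [u u2] := pi2s y.
    have -> : x = lift s * u ^+ q by apply: pi_inj; rewrite rmorphM rmorphXn ?l1 ?l2 ?u2 ?mul0r // x2 mulrC.
    apply: (idlM _ iY); apply: IY; apply: frob_mixpow; apply: frobP.
    by rewrite max_pullback; apply/max_pi; rewrite u2.
  have kF x : pi2 x = 0 -> (pi2 @^-1` frob q mS) x by move=> /= ->; exact: idl0.
  apply/(@ile_surj _ _ _ pi2s _ kF); apply: ile_sub (CP q) => // s' Fs.
  by have [x e] := pi2s s'; exists x => //=; rewrite e.
have steps (t' : seq S) : {subset t' <= t} ->
    ile I (sadd I (ideal_gen [set` [seq lift s | s <- t']])) (size t' * (q ^ krull_dim S * C)).
  elim: t' => [|s t' IHt] sub.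
    by apply: ile0; rewrite gen_nil; apply: (isadd_min iI) => // _ ->; exact: idl0.
  set Y := sadd I (ideal_gen [set` [seq lift s | s <- t']]).
  have iY : ideal Y := ideal_sadd iI (@idl_gen_ideal _ _).
  have IY : I `<=` Y by apply: isadd_l; exact: idl_gen_ideal.
  rewrite /= gen_cons [sadd (princ _) _]isaddC isaddA mulSn addnC.
  have ip := ideal_princ (lift s).
  apply: (@ile_add _ _ Y) => //; first exact: ideal_sadd.
  - exact: isadd_l.
  - by apply: IHt => x xt; apply: sub; rewrite inE xt orbT.
  apply: cyc => //; suff : [set s | epsS s = 0] s by [].
  by rewrite tE; apply: idl_gen_sub; apply: sub; rewrite inE eqxx.
have k1sub : ker1 `<=` ideal_gen [set` [seq lift s | s <- t]].
  have iG := @idl_gen_ideal P [set` [seq lift s | s <- t]].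
  move=> x x1; have /gen_seqP[c cE] : ideal_gen [set` t] (pi2 x).
    by rewrite -tE /= -piE x1 rmorph0.
  have [u uE] := choice (fun i => pi2s (c i)).
  have -> : x = \sum_(i < size t) u i * lift t`_i.
    apply: pi_inj; rewrite rmorph_sum /= ?x1 ?cE; [rewrite big1 //|apply: eq_bigr] => i _.
      have [|l1 _] := liftP t`_i; last by rewrite rmorphM l1 mulr0.
      suff : [set s | epsS s = 0] t`_i by [].
      by rewrite tE; apply: idl_gen_sub; rewrite /= mem_nth.
    have [|_ l2] := liftP t`_i; last by rewrite rmorphM l2 uE.
    suff : [set s | epsS s = 0] t`_i by [].
    by rewrite tE; apply: idl_gen_sub; rewrite /= mem_nth.
  apply: idl_sum => [|i _]; first exact: iG.
  by apply: (idlM _ iG); apply: idl_gen_sub; rewrite /= map_f // mem_nth.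
have finI : ile I setT (size t * C * q ^ krull_dim S + col (mixpow mR b q)).
  apply: (@ile_add _ _ (sadd I ker1)) => //; first exact: isadd_l.
  rewrite -mulnA [(C * _)%N]mulnC; apply: ile_sub (steps t (fun=> id)) => //.
  exact: isaddS.
apply/andP; split; last by rewrite addnC; exact: col_le.
rewrite -colJ; have IJ : I `<=` sadd I ker1 by exact: isadd_l.
exact: (col_mono iJ IJ iI finI).
Qed.

End Pullback.

Section FiberProduct.
Variables (R S T : comNzRingType).
Variables (epsR : {rmorphism R -> T}) (epsS : {rmorphism S -> T}).
Hypotheses (locR : noeth_local R) (locS : noeth_local S).
Hypotheses (epsRs : forall t, exists r, epsR r = t) (epsSs : forall t, exists s, epsS s = t).
Hypotheses (dimSR : (krull_dim S < krull_dim R)%N) (dimS : (0 < krull_dim S)%N).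
Local Notation P := (fiber_product epsR epsS).

Let pi1 : {rmorphism P -> R} := GRing.RMorphism.clone _ _ (fst \o val) _.
Let pi2 : {rmorphism P -> S} := GRing.RMorphism.clone _ _ (snd \o val) _.

Let piE (x : P) : epsR (pi1 x) = epsS (pi2 x).
Proof. by apply/eqP; exact: (valP x). Qed.

Let pi_ex r s : epsR r = epsS s -> exists x : P, pi1 x = r /\ pi2 x = s.
Proof. by move=> /eqP e; exists (FiberProduct (e : (r, s) \in fiber_pred epsR epsS)). Qed.

Let pi_inj (x y : P) : pi1 x = pi1 y -> pi2 x = pi2 y -> x = y.
Proof. by move=> e1 e2; apply: val_inj; exact: injective_projections. Qed.

Lemma fiber_krull_dim : krull_dim P = krull_dim R.
Proof. exact: (pullback_krull_dim pi_ex pi_inj). Qed.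

Lemma fiber_colength : exists C, forall b q,
  (col (mixpow (max_ideal R) b q) <= col (mixpow (max_ideal P) b q) <=
    col (mixpow (max_ideal R) b q) + C * q ^ krull_dim S)%N.
Proof. exact: (pullback_colength piE pi_ex pi_inj). Qed.

End FiberProduct.

(** * Power series and the quadric *)

Section PowerSeries.
Variables (n : nat) (k : fieldType).
Local Notation mon := {ffun 'I_n -> nat}.
Local Notation F := (fps n k).
Implicit Types (f g h : F) (m u : mon).

Definition mdeg m := (\sum_i m i)%N.

Lemma mdegD u m : mdeg (u + m) = (mdeg u + mdeg m)%N.
Proof. by rewrite /mdeg -big_split; apply: eq_bigr => i _; rewrite ffunE. Qed.

Lemma mdeg_eq0 m : (mdeg m == 0)%N = (m == 0).
Proof.
rewrite sum_nat_eq0; apply/forallP/eqP => [h|-> i]; last by rewrite ffunE.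
by apply/ffunP => i; rewrite ffunE; exact/eqP/h.
Qed.

Lemma fps_coefD f g m : fps_coef (f + g) m = fps_coef f m + fps_coef g m.
Proof. by []. Qed.

Lemma fps_coefN f m : fps_coef (- f) m = - fps_coef f m.
Proof. by []. Qed.

Lemma fps_coef_sum (I : Type) (r : seq I) (P : pred I) (G : I -> F) m :
  fps_coef (\sum_(i <- r | P i) G i) m = \sum_(i <- r | P i) fps_coef (G i) m.
Proof. exact: (big_morph (fun f => fps_coef f m)). Qed.

Lemma fps_coefM_eq0 f g m :
  (forall a b, a + b = m -> fps_coef f a * fps_coef g b = 0) -> fps_coef (f * g) m = 0.
Proof.
by move=> h; rewrite [LHS]/= /conv big1 // => a _; rewrite big1 // => b /eqP /h.
Qed.

Definition fps_mon u (a : k) : F := FPS (fun m => (m == u)%:R * a).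

Lemma fps_coef_monM u a g m : fps_coef (fps_mon u a * g) (u + m) = a * fps_coef g m.
Proof.
rewrite [LHS]/= /conv; set s := (\sum_i ((u + m)%R : mon) i)%N.
have le_s i : (((u + m)%R : mon) i <= s)%N by exact: mon_leq_sum.
pose G (v : mon) := \sum_(b : {ffun 'I_n -> 'I_s.+1} | v + mon_of b == u + m)
  (v == u)%:R * a * fps_coef g (mon_of b).
rewrite (eq_bigr (fun v => G (mon_of v))) // (bigID (fun v => mon_of v == u)) /=.
rewrite [X in _ + X]big1 ?addr0 => [|v /negPf nv]; last first.
  by rewrite /G big1 // => b _; rewrite nv !mul0r.
rewrite (@sum_mon_of1 _ _ s G) => [|i]; last first.
  by rewrite ltnS (leq_trans _ (le_s i)) // ffunE leq_addr.
rewrite /G eqxx mul1r -mulr_sumr; congr (_ * _).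
rewrite -[RHS](@sum_mon_of1 _ _ s) => [|i]; last first.
  by rewrite ltnS (leq_trans _ (le_s i)) // ffunE leq_addl.
apply: eq_bigl => b; apply/eqP/eqP => [/ffunP h|-> //].
by apply/ffunP => i; have := h i; rewrite !ffunE => /addnI.
Qed.

Lemma fps_coef_monM_eq0 u a g m (i : 'I_n) : (m i < u i)%N -> fps_coef (fps_mon u a * g) m = 0.
Proof.
move=> lt_i; apply: fps_coefM_eq0 => v w vw /=.
have [vu|_] := eqVneq v u; last by rewrite !mul0r.
by move: lt_i; rewrite -vw vu [X in (X < _)%N]ffunE ltnNge leq_addr.
Qed.

Lemma monomial_split u m : (forall i : 'I_n, (u i <= m i)%N) -> exists m', m = u + m'.
Proof. by move=> le; exists [ffun i => (m i - u i)%N]; apply/ffunP => i; rewrite !ffunE; exact: (esym (subnKC (le i))). Qed.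

Lemma fps_monM u a v b : fps_mon u a * fps_mon v b = fps_mon (u + v) (a * b).
Proof.
apply: fpsP => m; have [le|/existsNP[i /negP]] := pselect (forall i : 'I_n, (u i <= m i)%N).
  have [m' ->] := monomial_split le; rewrite fps_coef_monM /= mulrCA; congr (_%:R * _).
  congr nat_of_bool; apply/eqP/eqP => [-> //|/ffunP h].
  by apply/ffunP => i; have := h i; rewrite !ffunE => /addnI.
rewrite -ltnNge => lt_i; rewrite (fps_coef_monM_eq0 _ _ lt_i) /=.
case: eqP => [E|]; last by rewrite mul0r.
by move: lt_i; rewrite E [X in (X < _)%N]ffunE ltnNge leq_addr.
Qed.

Lemma fps_constP : exists c : {rmorphism k -> F}, forall a, c a = fps_mon 0 a.
Proof.
have cB : zmod_morphism (fps_mon 0) by move=> a b; apply: fpsP => m /=; rewrite mulrBr.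
have cM : monoid_morphism (fps_mon 0).
  by split=> [|a b]; [apply: fpsP => m /=; rewrite mulr1|rewrite fps_monM addr0].
pose c1 := GRing.isZmodMorphism.Build _ _ (fps_mon 0) cB.
pose c2 := GRing.isMonoidMorphism.Build _ _ (fps_mon 0) cM.
pose c : {rmorphism k -> F} := HB.pack (fps_mon 0 : k -> F) c1 c2.
by exists c.
Qed.

Definition ordge r f := forall m, (mdeg m < r)%N -> fps_coef f m = 0.

Lemma ordgeM r s f g : ordge r f -> ordge s g -> ordge (r + s) (f * g).
Proof.
move=> fr gs m lt_m; apply: fps_coefM_eq0 => a b ab.
have [/fr -> |le_a] := ltnP (mdeg a) r; first by rewrite mul0r.
rewrite gs ?mulr0 //; move: lt_m; rewrite -ab mdegD => lt.
by rewrite -(ltn_add2l r) (leq_ltn_trans _ lt) // leq_add2r.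
Qed.

Lemma ordge1 f : fps_coef f 0 = 0 <-> ordge 1 f.
Proof.
split=> [f0 m|]; last by apply; rewrite ltnS leqn0 mdeg_eq0.
by rewrite ltnS leqn0 mdeg_eq0 => /eqP ->.
Qed.

Lemma ordgeX r f : fps_coef f 0 = 0 -> ordge r (f ^+ r).
Proof.
move=> /ordge1 f1; elim: r => [|r IHr] // ; rewrite exprS -add1n; exact: ordgeM.
Qed.

Lemma ideal_ordge r : ideal (ordge r).
Proof.
apply: mk_ideal => // [f g fr growth m lt_m|a f fr m lt_m].
  by rewrite fps_coefD fr ?growth ?addr0.
by rewrite -[r]add0n in lt_m; apply: (@ordgeM 0 r).
Qed.

(** Geometric series: each coefficient of the inverse is read off a partial sum long enough for its
    degree. *)
Lemma fps_unit f : fps_coef f 0 != 0 -> exists g, f * g = 1.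
Proof.
move=> f0; pose u : F := FPS (fun=> (fps_coef f 0)^-1); pose g := 1 - u * f.
have g0 : fps_coef g 0 = 0.
  by rewrite fps_coefD fps_coefN fps_coef0M /= mulVf // eqxx subrr.
pose geom r : F := \sum_(i < r) g ^+ i.
pose h : F := FPS (fun m => fps_coef (geom (mdeg m).+1) m).
have hE r : ordge r (h - geom r).
  move=> m lt_m.
  have -> : geom r = geom (mdeg m).+1 + \sum_(i < r - (mdeg m).+1) g ^+ ((mdeg m).+1 + i).
    by rewrite /geom -[in LHS](subnKC lt_m) big_split_ord.
  rewrite fps_coefD fps_coefN fps_coefD opprD addrA subrr add0r fps_coef_sum big1 ?oppr0 // => i _.
  by apply: (ordgeX g0); rewrite addSn ltnS leq_addr.
exists (u * h); rewrite mulrA [f * u]mulrC.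
have -> : u * f = 1 - g by rewrite /g; ring.
apply: fpsP => m; set r := (mdeg m).+1.
have -> : (1 - g) * h = 1 - g ^+ r + (1 - g) * (h - geom r).
  have := subrX1 g r; rewrite -/(geom r) => e.
  have -> : 1 - g ^+ r = (1 - g) * geom r by rewrite -opprB e; ring.
  by ring.
have H := idlM (1 - g) (ideal_ordge r) (hE r).
by rewrite fps_coefD H ?ltnS // addr0 fps_coefD fps_coefN (ordgeX g0) ?subr0 ?ltnS.
Qed.

Let e_ (i : 'I_n) : mon := [ffun j => (j == i : nat)].

Lemma fps_XE (i : 'I_n) : fps_X k i = fps_mon (e_ i) 1.
Proof. by apply: fpsP => m /=; rewrite mulr1. Qed.

Lemma fps_X_decomp f : fps_coef f 0 = 0 -> exists G : 'I_n -> F, f = \sum_i fps_X k i * G i.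
Proof.
move=> f0.
(* [f_m] is attributed to the first variable that occurs in the monomial [m] *)
pose first (m : mon) (i : 'I_n) := [forall j : 'I_n, (j < i)%N ==> (m j == 0%N)].
exists (fun i => FPS (fun m => if first m i then fps_coef f (e_ i + m) else 0)).
apply: fpsP => m; rewrite fps_coef_sum.
have coefX (i : 'I_n) : fps_coef (fps_X k i * FPS (fun m => if first m i then fps_coef f (e_ i + m) else 0)) m =
    if (0 < m i)%N && first m i then fps_coef f m else 0.
  rewrite fps_XE; have [mi|mi] := posnP (m i).
    by rewrite (@fps_coef_monM_eq0 _ _ _ _ i) // mi ffunE eqxx.
  have [j|m' ->] := @monomial_split (e_ i) m; first by rewrite ffunE; case: eqP => [->|].
  rewrite fps_coef_monM mul1r /=; congr (if _ then _ else _).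
  apply: eq_forallb => j; rewrite [in RHS]ffunE [in RHS]ffunE; case: (j =P i) => [->|//].
  by rewrite ltnn.
rewrite (eq_bigr _ (fun i _ => coefX i)); have [m0|] := eqVneq m 0.
  by rewrite big1 ?m0 // => i _; rewrite ffunE.
rewrite -mdeg_eq0 sum_nat_eq0 negb_forall => /existsP[i0 mi0].
have [i mi imin] := @arg_minnP _ i0 (fun i => m i != 0%N) (fun i => i : nat) mi0.
have fi : first m i.
  by apply/forallP => j; apply/implyP; apply: contraTT => /imin; rewrite -leqNgt.
rewrite (bigD1 i) //= lt0n mi fi big1 ?addr0 // => j ji; case: ifP => // /andP[mj /forallP fj].
have := imin j; rewrite -lt0n mj => /(_ isT) le_ij; have := fj i; rewrite ltn_neqAle le_ij andbT.
by rewrite val_eqE eq_sym ji /= (negPf mi).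
Qed.

(** For a finite set [s] of monomials closed under division, this is the ideal of series without
    monomials in [s]; it serves for lower bounds on colengths. *)
Definition vanish (s : seq mon) : set F := [set f | forall m, m \in s -> fps_coef f m = 0].

Definition down (s : seq mon) := forall m m', m \in s -> (forall i, (m' i <= m i)%N) -> m' \in s.

Lemma ideal_vanish s : down s -> ideal (vanish s).
Proof.
move=> ds; apply: mk_ideal => // [f g fs gs m ms|a f fs m ms].
  by rewrite fps_coefD fs ?gs ?addr0.
apply: fps_coefM_eq0 => b c bc; rewrite fs ?mulr0 //; apply: ds ms _ => i.
by rewrite -bc ffunE leq_addl.
Qed.

(** Dropping a monomial of largest degree keeps the set closed under division and strictly enlarges
    the ideal. *)
Lemma ige_vanish_sorted s : sorted (relpre mdeg geq) s -> uniq s -> down s ->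
  ige (vanish s) setT (size s).
Proof.
elim: s => [|m s IHs] sorteds /= uniqs ds; first by apply: (@lenge0 F F^o) => //; exact: ideal_vanish.
have /andP[ms us] := uniqs.
have tr : transitive (relpre mdeg geq : rel mon) by move=> a b c /= h1 h2; exact: leq_trans h2 h1.
have /andP[/allP maxm ss] : all (relpre mdeg geq m) s && sorted (relpre mdeg geq) s.
  by have := sorteds; rewrite /= path_sortedE.
have ds' : down s.
  move=> a b sa le_ba; have := ds a b _ le_ba; rewrite !inE sa orbT => /(_ isT)/orP[/eqP bm|//].
  have le_am := maxm _ sa; rewrite /= -bm in le_am.
  have [c aE] := monomial_split le_ba; move: le_am; rewrite aE mdegD -{2}[mdeg b]addn0 leq_add2l leqn0 mdeg_eq0.
  by move=> /eqP c0; rewrite aE c0 addr0 in sa.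
rewrite -add1n; apply: (@ige_cat _ _ (vanish s)) (IHs ss us ds'); first exact: ideal_vanish.
apply: (@lenge_rcons F F^o _ (vanish (m :: s))) => //; last first.
- by apply: (@lenge0 F F^o) => //; exact: ideal_vanish.
- split=> [f fv a sa|/(_ (fps_mon m 1))]; first by apply: fv; rewrite inE sa orbT.
  have H : vanish s (fps_mon m 1).
    by move=> a sa /=; case: eqP => [am|]; [rewrite -am sa in ms|rewrite mul0r].
  by move=> /(_ H m); rewrite inE eqxx /= eqxx mul1r => /(_ isT)/eqP; rewrite oner_eq0.
- exact: ideal_vanish.
Qed.

Lemma ige_vanish s : uniq s -> down s -> ige (vanish s) setT (size s).
Proof.
move=> us ds; have tot : total (relpre mdeg geq : rel mon) by move=> a b /=; exact: leq_total.
have E : sort (relpre mdeg geq) s =i s by exact: mem_sort.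
have -> : vanish s = vanish (sort (relpre mdeg geq) s).
  by apply/seteqP; split=> f fs m ms; apply: fs; rewrite E in ms *.
rewrite -(size_sort (relpre mdeg geq) s); apply: ige_vanish_sorted.
- exact: sort_sorted.
- by rewrite sort_uniq.
- by move=> a b; rewrite !E; exact: ds.
Qed.

Definition box B : seq mon := [seq mon_of a | a : {ffun 'I_n -> 'I_B}].

Lemma mem_box B m : (m \in box B) = [forall i, (m i < B)%N].
Proof.
apply/mapP/forallP => [[a _ -> i]|lt]; first exact: mon_of_lt.
exists [ffun i => Ordinal (lt i)]; first by rewrite mem_enum.
by apply/ffunP => i; rewrite !ffunE.
Qed.

Lemma down_box B : down (box B).
Proof.
move=> a b; rewrite !mem_box => /forallP lt le; apply/forallP => i; exact: leq_ltn_trans (lt i).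
Qed.

Lemma ige_box B : ige (vanish (box B)) setT (B ^ n).
Proof.
have -> : (B ^ n)%N = size (box B) by rewrite size_map -cardE card_ffun !card_ord.
apply: ige_vanish (@down_box B).
rewrite map_inj_uniq ?enum_uniq // => a b /ffunP h; apply/ffunP => i; apply: val_inj.
by have := h i; rewrite !ffunE.
Qed.

End PowerSeries.

(** Surjectivity modulo [J] suffices to pull chains back; so a polynomial ring can be compared with
    a quotient of a power series ring. *)
Lemma ige_dense (A B : comNzRingType) (f : {rmorphism A -> B}) I J l :
  (forall y, exists x, J (y - f x)) -> (forall x, I x -> J (f x)) ->
  ige J setT l -> ige I setT l.
Proof.
move=> dense IJ; apply: (@lenge_transfer B A B^o A^o (fun X => f @^-1` X)) => [X iX JX _|X Y|X Y iX iY JX XY _ h y Yy].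
- by split=> //; [exact: ideal_preim|move=> x /IJ; exact: JX].
- by move=> _ _ _ XY _ x; exact: XY.
have [x /[dup] Jx /JX Xx] := dense y.
have -> : y = (y - f x) + f x by ring.
apply: (@idlD _ X) => //; apply: h => /=; have -> : f x = y - (y - f x) by ring.
by apply: (@idlB _ Y) => //; exact: XY.
Qed.

Section Quadric.
Variables (k : fieldType) (d : nat).
Local Notation n := d.+1.
Local Notation F := (fps n k).
Local Notation Q := (quadric k d).
Local Notation g := (sum_X_sq n k).

Definition fps_max : set F := [set f | fps_coef f 0 = 0].

Lemma ideal_fps_max : ideal fps_max.
Proof.
apply: mk_ideal => // [f h|a f]; rewrite /fps_max /= => f0.
  by move=> h0; rewrite f0 h0 addr0.
by rewrite -[LHS]/(fps_coef (a * f) 0) fps_coef0M f0 mulr0.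
Qed.

Lemma fps_max_X (i : 'I_n) : fps_max (fps_X k i).
Proof. by rewrite /fps_max /=; case: eqP => // /ffunP/(_ i); rewrite !ffunE eqxx. Qed.

Lemma fps_max_sum_X_sq : fps_max g.
Proof.
apply: idl_sum => [|i _]; first exact: ideal_fps_max.
by rewrite expr2; apply: (idlM _ ideal_fps_max); exact: fps_max_X.
Qed.

Lemma quadric_proj : exists f : {rmorphism F -> Q}, [/\ forall y, exists x, f x = y,
  forall x, f x = 0 <-> princ g x & max_ideal Q = f @` fps_max].
Proof.
have [f [fs fk]] := ideal_quotP (@quadric_ideal n k : idealr F); exists f.
have {}fk x : f x = 0 <-> princ g x.
  have gE : ideal_gen [set g] = princ g.
    apply/seteqP; split; first by apply: (idl_gen_min (ideal_princ _)) => _ ->; exact: princ_id.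
    by apply: (princ_sub (idl_gen_ideal _)); exact: idl_gen_sub.
  by rewrite fk -gE; split=> [/set_mem|/mem_set].
split=> //; apply: loc_max_ideal; split.
- by apply: ideal_im => //; exact: ideal_fps_max.
- move=> [x x0 /eqP]; rewrite -subr_eq0 -(rmorph1 f) -rmorphB => /eqP/fk.
  move/(princ_sub ideal_fps_max fps_max_sum_X_sq); rewrite /fps_max /= x0 eqxx => /eqP.
  by rewrite sub0r oppr_eq0 oner_eq0.
move=> y; have [x <-] := fs y => nx; have [|h e] := @fps_unit _ _ x.
  by apply/eqP => x0; apply: nx; exists x.
by exists (f h); rewrite -rmorphM e rmorph1.
Qed.

(** Sending the last [c] variables to 0 maps the polynomial ring to the quadric, surjectively modulo
    every power of the maximal ideal. Finiteness of colengths in the quadric comes from here as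
    well. *)
Lemma quadric_colength_ub c b q (I := sadd (ideal_gen [set` quadric_seq k d c]) (mixpow (pmax k (n + c)) b q))
    (J := mixpow (max_ideal Q) b q) :
  (exists l, ile J setT l) /\ (col J <= col I)%N.
Proof.
have [f [fs fk mE]] := quadric_proj; have [C CE] := fps_constP n k.
have imQ : ideal (max_ideal Q) by rewrite mE; exact: (ideal_im fs ideal_fps_max).
pose X i : F := fps_X k (inord i : 'I_n).
have [phi [phiC phiX]] := ipoly_eval (f \o C) (fun i => if (i < n)%N then f (X i) else 0) (n + c).
have XQ i : max_ideal Q (f (X i)) by rewrite mE; exists (X i) => //; exact: fps_max_X.
have phiM x : pmax k (n + c) x -> max_ideal Q (phi x).
  move: x; apply: (idl_gen_min (ideal_preim phi imQ)) => x /(nthP 0)[i].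
  rewrite size_ivars => lt_i <-; rewrite -[_ _]/(max_ideal Q (phi (ivars k (n + c))`_i)) phiX //; case: ifP => // _; exact: idl0.
have iJ : ideal J := ideal_mixpow _ _ _.
have IJ x : I x -> J (phi x).
  move: x; apply: (isadd_min (ideal_preim phi iJ)).
    apply: (idl_gen_min (ideal_preim phi iJ)) => x /=; rewrite inE => /orP[/eqP ->|/mapP[l]].
      suff -> : phi (squares k d c) = 0 by exact: idl0.
      rewrite rmorph_sum (eq_bigr (fun i : 'I_n => f (fps_X k i ^+ 2))) => [|i _].
        by rewrite -rmorph_sum; apply/fk; exact: princ_id.
      have lt_i : (i < n + c)%N by rewrite (leq_trans (ltn_ord i)) ?leq_addr.
      by rewrite !rmorphXn phiX // ltn_ord /X inord_val.
    rewrite mem_iota => /andP[_ lt_l] ->; rewrite phiX ?ltn_add2l // ltnNge leq_addr /=.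
    exact: idl0.
  apply: (isadd_min (ideal_preim phi iJ)) => x.
    by move/(iexp_preim phiM); exact: iexp_mixpow.
  by move/(frob_preim phiM); exact: frob_mixpow.
have dense N y : exists x, ideal_exp (max_ideal Q) N (y - phi x).
  elim: N y => [|N IHN] y; first by exists 0.
  have [h <-] := fs y; pose a := fps_coef h 0.
  have [|G GE] := @fps_X_decomp _ _ (h - C a).
    by rewrite fps_coefD fps_coefN CE /= eqxx mul1r subrr.
  have [r rP] := choice (fun i => IHN (f (G i))).
  exists (ipC k (n + c) a + \sum_(i < n) (ivars k (n + c))`_i * r i).
  have -> : f h - phi (ipC k (n + c) a + \sum_(i < n) (ivars k (n + c))`_i * r i) =
      \sum_(i < n) f (X i) * (f (G i) - phi (r i)).
    rewrite rmorphD phiC opprD addrA -rmorphB GE !rmorph_sum -sumrB; apply: eq_bigr => i _.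
    have lt_i : (i < n + c)%N by rewrite (leq_trans (ltn_ord i)) ?leq_addr.
    by rewrite !rmorphM phiX // ltn_ord mulrBr /X inord_val.
  by apply: idl_sum => [|i _]; [exact: iexp_ideal|rewrite iexpS; apply: imulP; [exact: XQ|exact: rP]].
have tr l : ige J setT l -> ige I setT l.
  by apply: ige_dense IJ => y; have [x xP] := dense b y; exists x; exact: iexp_mixpow.
have [l fin] := ile_pmax_exp k (n + c) b.
have finI : ile I setT l.
  apply: ile_sub fin => // x /(iexp_mixpow q); apply: isadd_r; exact: idl_gen_ideal.
have iI : ideal I := ideal_sadd (@idl_gen_ideal _ _) (ideal_mixpow _ _ _).
have finJ : ile J setT l by move=> m /tr; exact: finI.
split; first by exists l.
by apply: (col_ge iI finI); apply: tr; exact: (col_ige iJ finJ).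
Qed.

(** The series without monomials in the box of side [B] form an ideal of colength at least [B^n]. By
    the bounds on [B] it contains the mixed power, and with it the [q]-th power of the quadratic
    form. Replacing that power by the form itself costs the factor [q]. *)
Lemma quadric_colength_lb p e b B : p \in [pchar k] -> (B <= p ^ e)%N -> (n * B <= b)%N ->
  (B ^ n <= p ^ e * col (mixpow (max_ideal Q) b (p ^ e)))%N.
Proof.
move=> pk le_q le_b; set q := (p ^ e)%N.
have [[l fin] _] := quadric_colength_ub 0 b q.
have [f [fs fk mE]] := quadric_proj; have [C _] := fps_constP n k.
have pF : p \in [pchar F] by exact: rmorph_pchar C _ pk.
have [BB0|B0] := posnP B; first by rewrite BB0 exp0n.
have imF := ideal_fps_max.
pose I := mixpow fps_max b q; have iI : ideal I := ideal_mixpow _ _ _.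
have imI : f @` I = mixpow (max_ideal Q) b q by rewrite /I /mixpow sadd_im iexp_im // frob_im // -mE.
have ip := ideal_princ g; have iS := ideal_sadd iI ip.
have kS x : f x = 0 -> sadd I (princ g) x by move=> /fk; exact: isadd_r.
have imS : f @` sadd I (princ g) = mixpow (max_ideal Q) b q.
  rewrite sadd_im imI; apply/seteqP; split; last by apply: isadd_l; exact: ideal_im.
  apply: isadd_min => //; first exact: ideal_mixpow.
  by move=> _ [x /fk -> <-]; apply: idl0; exact: ideal_mixpow.
have finS : ile (sadd I (princ g)) setT (col (mixpow (max_ideal Q) b q)).
  by apply/(@ile_surj _ _ _ fs _ kS); rewrite imS; apply: col_ile fin; exact: ideal_mixpow.
have := ile_pow (k := q) iI finS; apply.
have ibox := @ideal_vanish n k _ (@down_box n B).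
apply: lenge_sub (ige_box n k B) => //.
have qbox : frob q fps_max `<=` vanish (k := k) (box n B).
  apply: (frob_min ibox) => x /fps_X_decomp[G ->]; rewrite expr_sum_pchar //.
  apply: idl_sum => [|i _ m]; first exact: ibox.
  rewrite mem_box => /forallP/(_ i) lt_m.
  have monX r : fps_X k i ^+ r = fps_mon ([ffun j => (j == i : nat)] *+ r) 1.
    elim: r => [|r IHr]; first by rewrite mulr0n; apply: fpsP => a /=; rewrite mulr1.
    by rewrite exprS IHr fps_XE fps_monM mulrS mulr1.
  rewrite exprMn monX (@fps_coef_monM_eq0 _ _ _ _ _ _ i) //.
  rewrite ffunMnE ffunE eqxx; apply: leq_trans lt_m _.
  by rewrite -[1%N *+ _]/(1%N *+ q) natn.
have mbox : ideal_exp fps_max b `<=` vanish (k := k) (box n B).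
  have sub r : ideal_exp fps_max r `<=` ordge (n := n) (k := k) r.
    elim: r => [x _ m|r IHr] //; apply: (imul_min (@ideal_ordge n k r.+1)) => x y x0 /IHr yr.
    by apply: (@ordgeM n k 1 r) => //; apply/ordge1.
  move=> x /sub xb m; rewrite mem_box => /forallP lt_m; apply: xb.
  apply: leq_trans le_b; apply: (@leq_trans (\sum_(i < n) (m i).+1)).
    under eq_bigr do rewrite -addn1; rewrite big_split /= sum_nat_const card_ord muln1.
    by rewrite addnS ltnS leq_addr.
  by rewrite -[n in (n * _)%N]card_ord -sum_nat_const; apply: leq_sum => i _.
have Ibox : I `<=` vanish (k := k) (box n B) by exact: isadd_min.
apply: isadd_min => //; apply: (princ_sub ibox); apply: qbox; apply: frobP.
exact: fps_max_sum_X_sq.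
Qed.

End Quadric.

(** * Nonnegativity of the normalizing constant *)

Section SplineValues.
Variable RR : realType.
Implicit Types (s x : RR) (d : nat).

Definition tpow d x : RR := if 0 <= x then x ^+ d else 0.

(** [d!] times the Irwin-Hall distribution function, the volume of the part of the unit cube where
    the coordinates have sum at most [s]. Truncated powers let the sum run to [d] for every [s]. *)
Definition spline d s : RR := \sum_(i < d.+1) (-1) ^+ i * 'C(d, i)%:R * tpow d (s - i%:R).

Lemma tpowS d x : tpow d.+1 x = x * tpow d x.
Proof. by rewrite /tpow; case: ifP => _; rewrite ?exprS ?mulr0. Qed.

(* Leibniz rule for the [d.+1]-st difference of [x * tpow d x] *)
Lemma splineS d s : spline d.+1 s = s * spline d s + (d.+1%:R - s) * spline d (s - 1).
Proof.
rewrite /spline; set t := tpow d.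
have -> : s * (\sum_(i < d.+1) (-1) ^+ i * 'C(d, i)%:R * t (s - i%:R)) =
    \sum_(i < d.+2) (-1) ^+ i * ('C(d, i)%:R * s) * t (s - i%:R).
  rewrite [RHS]big_ord_recr /= bin_small // mul0r mulr0 mul0r addr0 mulr_sumr.
  by apply: eq_bigr => i _; ring.
have -> : (d.+1%:R - s) * (\sum_(i < d.+1) (-1) ^+ i * 'C(d, i)%:R * t (s - 1 - i%:R)) =
    \sum_(i < d.+2) (-1) ^+ i * ((if nat_of_ord i is j.+1 then 'C(d, j)%:R else 0) * (s - d.+1%:R)) * t (s - i%:R).
  rewrite [RHS]big_ord_recl /= !(mul0r, mulr0) add0r mulr_sumr.
  apply: eq_bigr => i _; rewrite /bump /= add1n exprS -addrA -opprD -[i.+1%:R]natr1.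
  by rewrite [i%:R + 1]addrC; ring.
rewrite -big_split; apply: eq_bigr => i _ /=; rewrite tpowS -/t.
rewrite -mulrDl -mulrDr mulrA; congr (_ * _); rewrite -mulrA; congr (_ * _).
case: (i : nat) => [|j]; first by rewrite !bin0; ring.
have e : j.+1%:R * 'C(d.+1, j.+1)%:R = d.+1%:R * 'C(d, j)%:R :> RR.
  by rewrite -!natrM -mul_bin_diag.
rewrite mulrBr [_ * j.+1%:R]mulrC e binS natrD; ring.
Qed.

(** For [s > d + 1] the recurrence [splineS] has a negative coefficient, so nonnegativity there is
    read off the exact value. *)
Lemma spline_large d s : d%:R <= s -> spline d s = d`!%:R.
Proof.
elim: d s => [|d IHd] s le_s.
  by rewrite /spline big_ord_recl big_ord0 /= bin0 /tpow subr0 le_s !expr0 !mulr1 addr0.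
have le1 : d%:R <= s - 1 by rewrite lerBrDr natr1.
rewrite splineS !IHd //; last by apply: le_trans le1 _; rewrite gerBl.
by rewrite factS natrM; ring.
Qed.

Lemma spline_ge0 d s : 0 <= spline d s.
Proof.
elim: d s => [|d IHd] s.
  by rewrite /spline big_ord_recl big_ord0 /= bin0 expr0 !mul1r addr0 /tpow; case: ifP; rewrite ?expr0.
have [s0|s0] := ltP s 0.
  rewrite /spline big1 // => i _; rewrite /tpow ifF ?mulr0 //.
  by apply/negbTE; rewrite -ltNge subr_lt0 (lt_le_trans s0).
have [le_s|lt_s] := leP d.+1%:R s; first by rewrite spline_large.
by rewrite splineS addr_ge0 // mulr_ge0 // subr_ge0 ltW.
Qed.

Lemma calH_ge0 s d : 0 <= s -> 0 <= calH s d.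
Proof.
move=> s0; have -> : calH s d = (d`!%:R)^-1 * spline d s; last first.
  by rewrite mulr_ge0 ?spline_ge0 // invr_ge0.
pose G i := (-1) ^+ i * 'C(d, i)%:R * tpow d (s - i%:R).
(* Terms with [i > d] vanish by the binomial coefficient, those with [i > truncn s] by the truncated
   power, so both sums may stop at the smaller index. *)
have G0 i : (d < i)%N || (Num.truncn s < i)%N -> G i = 0.
  case/orP => lt_i; first by rewrite /G bin_small // mulr0 mul0r.
  rewrite /G /tpow ifF ?mulr0 //; apply/negbTE; rewrite -ltNge subr_lt0.
  by rewrite -truncn_lt_nat.
have -> : spline d s = \sum_(0 <= i < (Num.truncn s).+1) G i.
  rewrite /spline -(big_mkord xpredT G).
  have ext a b : (a <= b)%N -> (forall i, (a < i)%N -> G i = 0) ->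
      \sum_(0 <= i < b.+1) G i = \sum_(0 <= i < a.+1) G i.
    move=> le_ab z; rewrite (@big_cat_nat _ _ _ a.+1) //= [X in _ + X]big1_seq ?addr0 // => i.
    by rewrite mem_index_iota => /andP[_ /andP[/z]].
  have [le|le] := leqP d (Num.truncn s).
    by rewrite (ext d) // => i lt_i; apply: G0; rewrite lt_i.
  by rewrite (ext (Num.truncn s)) ?(ltnW le) // => i lt_i; apply: G0; rewrite lt_i orbT.
rewrite /calH mulr_sumr; apply: eq_big_nat => i /andP[_ lt_i].
have -> : G i = (-1) ^+ i * 'C(d, i)%:R * (s - i%:R) ^+ d.
  by rewrite /G /tpow ifT // subr_ge0 -truncn_ge_nat // -ltnS.
by ring.
Qed.

End SplineValues.

(** * Limits *)

Lemma ideal_smulT (A : comNzRingType) (I : set A) : ideal I ->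
  ideal_smul I [set: A^o] = I.
Proof.
move=> iI; apply/seteqP; split; first exact: imul_subl.
by move=> x Ix; rewrite -(mulr1 x); exact: imulP.
Qed.

Section Limits.
Variables (RR : realType) (p : nat) (s : RR).
Hypotheses (p_gt1 : (1 < p)%N) (s_gt0 : 0 < s).
Local Notation q e := (p%:R ^+ e : RR).

Definition ceil_pow e : nat := `|Num.ceil (s * q e)|%N.

Definition mult_seq (A : comNzRingType) e : RR :=
  (col (mixpow (max_ideal A) (ceil_pow e) (p ^ e)))%:R / p%:R ^+ (e * krull_dim A).

Lemma s_multE (A : comNzRingType) :
  s_mult p s A = lim (mult_seq A @ \oo) / calH s (krull_dim A).
Proof.
rewrite /s_mult /e_mult /h_mult; congr (_ / _).
apply: (f_equal (fun u : nat -> RR => lim (u @ \oo))); apply/funext => e.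
by rewrite ideal_smulT; [rewrite quot_lengthE|exact: ideal_mixpow].
Qed.

Lemma q_gt0 e : 0 < q e. Proof. by rewrite exprn_gt0 // ltr0n ltnW. Qed.

Lemma ceil_powP e : s * q e <= (ceil_pow e)%:R < s * q e + 1.
Proof.
have sq : 0 < s * q e by rewrite mulr_gt0 ?q_gt0.
have -> : (ceil_pow e)%:R = (Num.ceil (s * q e))%:~R :> RR.
  by rewrite /ceil_pow natr_absz ger0_norm // ceil_ge0 (lt_trans _ sq) // oppr_lt0.
by have := gt_pred_ceil (s * q e); rewrite rmorphB /= ltrBlDr ceil_ge.
Qed.

Lemma cvg_inv_q (c : RR) : (fun e => c / q e) @ \oo --> (0 : RR).
Proof.
rewrite -(mulr0 c); apply: cvgMr.
have -> : (fun e => (q e)^-1) = (fun e => (p%:R^-1 : RR) ^+ e) by apply/funext => e; rewrite exprVn.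
apply: cvg_expr; rewrite ger0_norm ?invr_ge0 // invf_lt1 ?ltr0n ?ltr1n //; exact: ltnW.
Qed.

(** [u] is bounded by [C2] and nondecreasing up to the error [D / q], which is summable since
    [q = p^e]. *)
Lemma growth_cvg (L : nat -> nat -> nat) d n (C1 C2 : nat) :
  (forall b e, (p ^ d * L b e <= L (p * b + n * p.-1) e.+1)%N) ->
  (forall b b' e, (b <= b')%N -> (L b e <= L b' e)%N) ->
  (forall b e, (b * (L b.+1 e - L b e) <= C1 * L b e)%N) ->
  (forall b e, (L b e <= C2 * (p ^ e) ^ d)%N) ->
  cvg ((fun e => (L (ceil_pow e) e)%:R / p%:R ^+ (e * d) : RR) @ \oo).
Proof.
move=> grow mono hilb bound; set u := fun e : nat => _ : RR.
have p0 : (0 < p)%N := ltnW p_gt1.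
have uC e : u e <= C2%:R.
  rewrite /u ler_pdivrMr ?q_gt0 // -natrX -natrM ler_nat expnM; exact: bound.
have u0 e : 0 <= u e by rewrite divr_ge0 // exprn_ge0.
(* [D] serves two regimes. While [s q <= 2 (n + 1)], [D / q] dominates the bound [C2] on [u].
   Afterwards the shifted exponent [b'] is at least [s q / 2], and [n + 1] increments of size at
   most [C1 C2 q^d / b'] are lost. *)
pose D : RR := (C1.+1 * C2)%:R * (2 * n.+1%:R / s).
have D0 : 0 <= D by rewrite mulr_ge0 // divr_ge0 ?mulr_ge0 // ltW.
have step e : u e - D / q e <= u e.+1.
  have [/andP[ge_a lt_a] /andP[ge_a1 lt_a1]] := (ceil_powP e, ceil_powP e.+1).
  have [small|large] := leP (s * q e) (2 * n.+1%:R).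
    apply: le_trans (u0 e.+1); rewrite subr_le0; apply: le_trans (uC e) _.
    rewrite ler_pdivlMr ?q_gt0 // /D mulrA ler_pdivlMr // -mulrA [q e * s]mulrC.
    apply: ler_pM => //; first by rewrite mulr_ge0 ?ltW ?q_gt0.
    by rewrite ler_nat mulSn leq_addr.
  have le_n : (n.+1 <= ceil_pow e)%N.
    rewrite -(ler_nat RR); apply: le_trans ge_a; apply: le_trans (ltW large).
    by rewrite ler_peMl // ler1n.
  (* The shift by [n + 1] compensates both the summand [n * p.-1] and the rounding in [ceil_pow]:
     [p b' + n (p - 1) <= p s q]. *)
  set b' := (ceil_pow e - n.+1)%N.
  have b'E : b'%:R = (ceil_pow e)%:R - n.+1%:R :> RR by rewrite natrB.
  have b'_ge : s * q e <= 2 * b'%:R by rewrite b'E; lra.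
  have b'_gt0 : 0 < b'%:R :> RR.
    by have := mulr_gt0 s_gt0 (q_gt0 e); lra.
  have telescope r : (b' * L (b' + r) e <= b' * L b' e + r * (C1 * C2 * (p ^ e) ^ d))%N.
    elim: r => [|r IHr]; first by rewrite addn0 mul0n addn0.
    have h1 := hilb (b' + r)%N e; have h2 := bound (b' + r)%N e.
    have h3 : (b' * (L (b' + r.+1) e - L (b' + r) e) <= C1 * C2 * (p ^ e) ^ d)%N.
      rewrite addnS; apply: (@leq_trans ((b' + r) * (L (b' + r).+1 e - L (b' + r) e))).
        by rewrite leq_mul2r leq_addr orbT.
      by apply: leq_trans h1 _; rewrite -mulnA leq_mul2l h2 orbT.
    have h4 := mono (b' + r)%N (b' + r.+1)%N e; rewrite leq_add2l leqnSn in h4.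
    have {}h4 := h4 isT.
    rewrite mulSn addnCA -[X in (_ * X)%N](subnK h4) mulnDr; exact: leq_add.
  have := telescope n.+1; rewrite subnK // => {}telescope.
  have up : (p ^ d * L b' e <= L (ceil_pow e.+1) e.+1)%N.
    apply: leq_trans (grow b' e) _; apply: mono; rewrite -(ler_nat RR); apply: le_trans ge_a1.
    rewrite natrD !natrM b'E exprS mulrCA -[p.-1]subn1 natrB //.
    have p0' : 0 < p%:R :> RR by rewrite ltr0n.
    have : p%:R * ((ceil_pow e)%:R - 1) <= p%:R * (s * q e) by rewrite ler_pM2l //; lra.
    have n0 : 0 <= n%:R :> RR by [].
    rewrite -natr1; nra.
  have u1 : (L b' e)%:R / p%:R ^+ (e * d) <= u e.+1.
    rewrite /u mulSn exprD ler_pdivlMr ?mulr_gt0 ?exprn_gt0 ?ltr0n //.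
    rewrite -mulrA [_^-1 * _]mulrC -mulrA divff ?mulr1; last by rewrite lt0r_neq0 ?exprn_gt0 ?ltr0n.
    by rewrite -natrX -natrM ler_nat mulnC.
  apply: le_trans u1; rewrite lerBlDr /u ler_pdivrMr ?exprn_gt0 ?ltr0n // mulrDl divfK; last first.
    by rewrite lt0r_neq0 ?exprn_gt0 ?ltr0n.
  rewrite -(ler_pM2l b'_gt0) mulrDr -!natrM; move: telescope; rewrite -(ler_nat RR) natrD.
  move/le_trans; apply; rewrite lerD2l.
  rewrite -expnM natrM [(C1 * C2 * _)%:R]natrM natrX mulrA mulrA.
  apply: ler_wpM2r; first by rewrite exprn_ge0.
  rewrite mulrA ler_pdivlMr ?q_gt0 // /D.
  have -> : b'%:R * ((C1.+1 * C2)%:R * (2 * n.+1%:R / s)) = (C1.+1 * C2)%:R * n.+1%:R * (2 * b'%:R) / s by ring.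
  rewrite ler_pdivlMr // -!mulrA [q e * s]mulrC [n.+1%:R * ((C1 * C2)%:R * _)]mulrCA.
  apply: ler_pM => //; first by rewrite !mulr_ge0 ?ltW ?q_gt0.
    by rewrite ler_nat leq_mul2r leqnSn orbT.
  by rewrite ler_pM2l.
(* [2 D / q] at least halves at each step, so subtracting it absorbs the error [D / q]. *)
pose v e := u e - 2 * D / q e.
have vmono : {homo v : n m / (n <= m)%N >-> n <= m}.
  apply/nondecreasing_seqP => e; rewrite /v; have := step e.
  have -> : 2 * D / q e.+1 = 2 * (D / q e) / p%:R by rewrite exprS invfM; ring.
  have Dq : 0 <= D / q e by rewrite divr_ge0 // ltW // q_gt0.
  have : 2 * (D / q e) / p%:R <= D / q e.
    by rewrite ler_pdivrMr ?ltr0n // mulrC ler_wpM2l // ler_nat.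
  rewrite -mulrA; lra.
have vcvg : cvgn v.
  apply: nondecreasing_is_cvgn vmono _; exists C2%:R => _ [e _ <-].
  have h : 0 <= 2 * D / q e by apply: divr_ge0; [exact: mulr_ge0|exact: exprn_ge0].
  by rewrite /v lerBlDr (le_trans (uC e)) // lerDl.
have -> : u = v + (fun e => 2 * D / q e) by apply/funext => e; rewrite fctE /v subrK.
by apply: is_cvgD => //; apply/cvg_ex; exists 0; exact: cvg_inv_q.
Qed.

End Limits.

Theorem theorem1p3 (RR : realType) (d p : nat) (k : fieldType)
    (R S T : comNzRingType)
    (epsR : {rmorphism R -> T}) (epsS : {rmorphism S -> T})
    (d_ge2 : (2 <= d)%N) (p_gt2 : (2 < p)%N) (pchark : p \in [pchar k])
    (locR : noeth_local R) (locS : noeth_local S) (locT : noeth_local T)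
    (pcharR : p \in [pchar R]) (pcharS : p \in [pchar S])
    (pcharT : p \in [pchar T])
    (resR : has_residue_field R k) (resS : has_residue_field S k)
    (resT : has_residue_field T k)
    (epsR_surj : forall t, exists r, epsR r = t)
    (epsS_surj : forall t, exists s, epsS s = t)
    (ciR : complete_intersection R) (nregR : ~ regular_local R)
    (dimR : krull_dim R = d)
    (dimSR : (krull_dim S < krull_dim R)%N)
    (dimTS : (krull_dim T < krull_dim S)%N)
    (s : RR) (s_gt0 : 0 < s) :
  s_mult p s (quadric k d) <= s_mult p s (fiber_product epsR epsS).
Proof.
subst d; set d := krull_dim R in d_ge2 *; have p_gt1 := ltnW p_gt2.
have dimR0 : (0 < krull_dim R)%N := ltnW d_ge2.
have dimS0 : (0 < krull_dim S)%N := leq_ltn_trans (leq0n _) dimTS.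
have q_gt0 e : 0 < p%:R ^+ e :> RR := q_gt0 RR p_gt1 e.
have [nR lR] := noeth_local_loc locR.
case: ciR => _ [Q [f [phi [regQ regf phis phik]]]].
have [C1 hilb] := mixpow_hilbert nR lR.
have [C2 bound] := mixpow_colength_bound nR lR dimR0.
have mono q b b' : (b <= b')%N ->
    (col (mixpow (max_ideal R) b q) <= col (mixpow (max_ideal R) b' q))%N.
  move=> le_b; have [l fin] := ile_iexp nR lR b'.
  apply: (@col_mono _ _ _ l) (mixpow_le le_b) _ _; [exact: ideal_mixpow|exact: ideal_mixpow|].
  by apply: ile_sub fin => //; exact: iexp_mixpow.
have cvgR : cvg (mult_seq p s R @ \oo).
  apply: (growth_cvg p_gt1 s_gt0 (L := fun b e => col (mixpow (max_ideal R) b (p ^ e)))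
    (n := krull_dim Q) (C1 := C1) (C2 := C2)) => //.
  - exact: (complete_intersection_growth locR regQ regf phis phik dimR0 pcharR pchark resR).
  - by move=> b b' e; exact: mono.
set uR := mult_seq p s R in cvgR.
have uR0 e : 0 <= uR e by rewrite /uR /mult_seq divr_ge0 // exprn_ge0.
(* The terms differ by at most [C q^dim S / q^dim R], hence by at most [C / q]. *)
have limP : lim (mult_seq p s (fiber_product epsR epsS) @ \oo) = lim (uR @ \oo).
  have [C fib] := fiber_colength locR locS epsR_surj epsS_surj dimSR dimS0.
  apply: cvg_lim => //; apply: (@squeeze_cvgr _ _ _ _ uR (uR + fun e => C%:R / p%:R ^+ e)) => //.
    apply: nearW => e; rewrite fctE /uR /mult_seq (fiber_krull_dim epsR_surj epsS_surj dimSR dimS0).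
    have /andP[le1 le2] := fib (ceil_pow p s e) (p ^ e)%N.
    rewrite ler_pM2r ?invr_gt0 // ler_nat le1 /= -[X in _ <= _ + X](mulfK (lt0r_neq0 (q_gt0 (e * krull_dim R)%N))).
    rewrite -mulrDl ler_pM2r ?invr_gt0 //; apply: le_trans (_ : _ <= (_ + _)%:R) _; first by rewrite ler_nat; exact: le2.
    rewrite natrD lerD2l natrM -mulrA ler_wpM2l // !natrX -exprM mulrC ler_pdivlMr // -exprD.
    by rewrite ler_weXn2l ?ler1n ?(ltnW p_gt1) // -mulnSr leq_mul2l dimSR orbT.
  by rewrite -[X in _ --> X]addr0; apply: cvgD => //; exact: cvg_inv_q.
have [c lbR] := quadric_colength_le locR regQ regf phis phik dimR0 pcharR pchark resR p_gt2 nregR.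
have leQ e : (col (mixpow (max_ideal (quadric k d)) (ceil_pow p s e) (p ^ e)) <=
    col (mixpow (max_ideal R) (ceil_pow p s e) (p ^ e)))%N.
  by apply: leq_trans (lbR _ _); have [] := @quadric_colength_ub k d c (ceil_pow p s e) (p ^ e)%N.
rewrite !s_multE limP (fiber_krull_dim epsR_surj epsS_surj dimSR dimS0) -/d.
set uQ := mult_seq p s (quadric k d); set D := krull_dim (quadric k d).
have uQ0 e : 0 <= uQ e by rewrite /uQ /mult_seq divr_ge0 // exprn_ge0.
have H0 n : 0 <= calH s n := calH_ge0 n (ltW s_gt0).
have rhs0 : 0 <= lim (uR @ \oo) / calH s d.
  by rewrite divr_ge0 //; apply: limr_ge => //; exact: nearW.
have [cQ|/dvgP ->] := pselect (cvg (uQ @ \oo)); last by rewrite mul0r.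
have [lt_D|lt_D|DE] := ltngtP D d.
(* Convergence is contradictory when [D < d]: [uQ e / p^e] would tend to 0, while
   [quadric_colength_lb] keeps it above a positive [K]. [N] is such that the side [B = q %/ N.+1]
   satisfies [(d + 1) B <= s q]. *)
- have [N Ns] : exists N : nat, d.+1%:R <= s * N.+1%:R.
    exists (Num.truncn (d.+1%:R / s)); rewrite mulrC -ler_pdivrMr //.
    by apply: ltW; exact: truncnS_gt.
  (* Rounding down at most halves [q / (N + 1)], so that [q <= 2 (N + 1) B]; the power [d + 1] is
     the number of variables. *)
  pose K : RR := ((2 * N.+1) ^ d.+1)%:R^-1.
  have K0 : 0 < K by rewrite invr_gt0 ltr0n expn_gt0.
  have lb : \forall e \near \oo, K <= (uQ \* (fun e => 1 / p%:R ^+ e)) e.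
    exists N => // e /= le_e; set q := (p ^ e)%N.
    have lt_q : (N < q)%N by apply: leq_ltn_trans le_e _; exact: ltn_expl.
    set B := (q %/ N.+1)%N.
    have le_B : (d.+1 * B <= ceil_pow p s e)%N.
      rewrite -(ler_nat RR); have /andP[+ _] := ceil_powP p_gt1 s_gt0 e; apply: le_trans.
      rewrite natrM; apply: le_trans (ler_wpM2r _ Ns) _ => //.
      rewrite -mulrA ler_pM2l // -natrM -natrX ler_nat mulnC; exact: leq_trunc_div.
    have lb := quadric_colength_lb pchark (leq_div _ _ : B <= p ^ e)%N le_B.
    have qB : (q <= 2 * N.+1 * B)%N.
      have B1 : (0 < B)%N by rewrite divn_gt0.
      rewrite {1}(divn_eq q N.+1) -/B; have := @ltn_pmod q N.+1 isT.
      nia.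
    have {qB} qB : (q ^ d.+1 <= (2 * N.+1) ^ d.+1 * B ^ d.+1)%N by rewrite -expnMn leq_exp2r.
    rewrite /= /uQ /mult_seq mul1r -mulrA -invfM -exprD ler_pdivlMr // ler_pdivrMl ?ltr0n ?expn_gt0 //.
    have {lb qB} : (q ^ d <= (2 * N.+1) ^ d.+1 * col (mixpow (max_ideal (quadric k d)) (ceil_pow p s e) q))%N.
      rewrite -(@leq_pmul2l q) ?expn_gt0 ?(ltnW p_gt1) // -expnS; apply: leq_trans qB _.
      by rewrite mulnCA leq_mul2l lb orbT.
    rewrite -natrM -(ler_nat RR); apply: le_trans; rewrite !natrX -exprM ler_weXn2l ?ler1n ?(ltnW p_gt1) //.
    by rewrite -mulnSr leq_mul2l lt_D orbT.
  have cv : (uQ \* (fun e => 1 / p%:R ^+ e)) @ \oo --> lim (uQ @ \oo) * 0.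
    by apply: cvgM => //; exact: cvg_inv_q.
  suff : K <= 0 by rewrite leNgt K0.
  rewrite -(mulr0 (lim (uQ @ \oo))) -(cvg_lim _ cv) //; apply: limr_ge => //.
  by apply/cvg_ex; exists (lim (uQ @ \oo) * 0).
- suff -> : lim (uQ @ \oo) = 0 by rewrite mul0r.
  apply: cvg_lim => //; apply: (@squeeze_cvgr _ _ _ _ (fun=> 0) (fun e => C2%:R / p%:R ^+ e)) => //.
  + apply: nearW => e; rewrite uQ0 /= /uQ /mult_seq ler_pdivlMr // mulrAC ler_pdivrMr //.
    apply: (@le_trans _ _ ((C2 * (p ^ e) ^ d)%:R * p%:R ^+ e)).
      rewrite ler_pM2r // ler_nat; apply: leq_trans (leQ e) _; exact: bound.
    rewrite natrM !natrX -exprM -mulrA -exprD ler_wpM2l // ler_weXn2l ?ler1n ?(ltnW p_gt1) //.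
    by rewrite -mulnSr leq_mul2l lt_D orbT.
  + exact: cvg_cst.
  + exact: cvg_inv_q.
rewrite DE ler_wpM2r ?invr_ge0 //; apply: ler_lim => //; apply: nearW => e.
by rewrite /uQ /uR /mult_seq -/D DE ler_pM2r ?invr_gt0 // ler_nat.
Qed.
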